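(* Let $L_d$ denote the least common multiple of the orders of the finite subgroups of $\Gamma_d$. Then $L_1=96$, $L_2=48$, $L_3=72$, $L_7=168$, $L_{11}=24$, $L_{19}=24$. Moreover, $\Gamma_d$ contains a neat subgroup of index $96$ for $d=1$, $96$ for $d=2$, $72$ for $d=3$, $336$ for $d=7$, $432$ for $d=11$, and $864$ for $d=19$; and $\Gamma_2$ contains a torsion-free subgroup of index $48$.
   Context: $J=\begin{pmatrix}0&0&1\\0&1&0\\1&0&0\end{pmatrix}$, $U(J)=\{A\in GL_3(\mathbb{C}):A^*JA=J\}$, $\mathcal{O}_d$ is the ring of integers of $\mathbb{Q}(i\sqrt d)$, and $\Gamma_d=PU(J,\mathcal{O}_d)$ is the image in $PU(J)$ of $U(J)\cap GL_3(\mathcal{O}_d)$. It is a lattice acting on the complex hyperbolic plane, i.e. the set of complex lines in $\mathbb{C}^3$ spanned by vectors $v$ with $v^*Jv<0$. A subgroup of finite index in $\Gamma_d$ is called neat if it is torsion-free and each of its cusp groups (maximal parabolic subgroups, i.e. stabilizers of points of the boundary $\{\mathbb{C}v: v\ne0,\ v^*Jv=0\}$ represented by vectors in $\mathcal{O}_d^3$) consists of elements that can be represented by unipotent matrices in $U(J)$ (i.e. contains no twist-parabolic elements). *)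

(* Defs.v *)
From HB Require Import structures.
From mathcomp Require Import all_boot all_order all_algebra.
From mathcomp Require Import all_classical.
From mathcomp Require Import reals complex.
Set Implicit Arguments.
Unset Strict Implicit.
Unset Printing Implicit Defensive.
Import Order.TTheory GRing.Theory Num.Theory.
Local Open Scope classical_set_scope.
Local Open Scope ring_scope.
Local Open Scope sesquilinear_scope.
Local Open Scope quotient_scope.

Section AbstractGroups.
Variable G : groupType.
Implicit Types H K : set G.

Definition is_subgroup H : Prop := group_closed [in H].

Definition lcosets H K : set (set G) :=
  [set [set (x * h)%g | h in H] | x in K].

Definition has_index H K (n : nat) : Prop := (lcosets H K #= `I_n)%card.

Definition torsion_free H : Prop :=
  forall g n, H g -> (0 < n)%N -> (g ^+ n)%g = 1%g -> g = 1%g.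

Definition finite_subgroup_order K : set nat :=
  [set n | exists F : set G, [/\ is_subgroup F, F `<=` K & (F #= `I_n)%card]].

End AbstractGroups.

Definition is_lcm (S : set nat) (l : nat) : Prop :=
  [/\ (0 < l)%N,
      forall n, S n -> (n %| l)%N
    & forall m, (0 < m)%N -> (forall n, S n -> (n %| m)%N) -> (l <= m)%N].

(* The field C of complex numbers is only used through its structure of
   algebraically closed field with conjugation; it is R[i] in the theorem. *)
Section UnitaryGroup.
Variable C : numClosedFieldType.

Definition J : 'M[C]_3 := \matrix_(i, j) (i + j == 2)%N%:R.

Definition unitaryJ : pred 'M[C]_3 :=
  fun A => (A \in unitmx) && (A ^t* *m J *m A == J).

Record U := MkU { U_val :> 'M[C]_3; _ : unitaryJ U_val }.
HB.instance Definition _ := [isSub for U_val].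
HB.instance Definition _ := [Choice of U by <:].

Lemma unitaryJ1 : unitaryJ 1%:M.
Proof. by rewrite /unitaryJ unitmx1 trmx1 map_mx1 mul1mx mulmx1 eqxx. Qed.

Lemma unitaryJM A B : unitaryJ A -> unitaryJ B -> unitaryJ (A *m B).
Proof.
move=> /andP[uA /eqP hA] /andP[uB /eqP hB]; rewrite /unitaryJ unitmx_mul uA uB.
apply/eqP; rewrite trmx_mul map_mxM -[in RHS]hB -[in RHS]hA.
by rewrite !mulmxA.
Qed.

Lemma unitaryJV A : unitaryJ A -> unitaryJ (invmx A).
Proof.
move=> /andP[uA /eqP hA]; rewrite /unitaryJ unitmx_inv uA /=; apply/eqP.
have e : (invmx A) ^t* *m A ^t* = 1%:M.
  by rewrite -map_mxM -trmx_mul mulmxV // trmx1 map_mx1.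
by rewrite -[in LHS]hA !mulmxA e mul1mx -mulmxA mulmxV // mulmx1.
Qed.

Definition U_one : U := MkU unitaryJ1.
Definition U_mul (A B : U) : U := MkU (unitaryJM (valP A) (valP B)).
Definition U_inv (A : U) : U := MkU (unitaryJV (valP A)).

Lemma U_unit (A : U) : U_val A \in unitmx. Proof. by case/andP: (valP A). Qed.
Lemma U_mulA : associative U_mul.
Proof. by move=> A B D; apply/val_inj; rewrite /= mulmxA. Qed.
Lemma U_mul1 : left_id U_one U_mul.
Proof. by move=> A; apply/val_inj; rewrite /= mul1mx. Qed.
Lemma U_mulr1 : right_id U_one U_mul.
Proof. by move=> A; apply/val_inj; rewrite /= mulmx1. Qed.
Lemma U_mulV : left_inverse U_one U_inv U_mul.
Proof. by move=> A; apply/val_inj; rewrite /= mulVmx ?U_unit. Qed.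
Lemma U_mulrV : right_inverse U_one U_inv U_mul.
Proof. by move=> A; apply/val_inj; rewrite /= mulmxV ?U_unit. Qed.

HB.instance Definition _ :=
  isGroup.Build U U_mulA U_mul1 U_mulr1 U_mulV U_mulrV.

(* If A and c A both preserve J then |c| = 1, so the classes of this relation
   are the cosets in U of the group of scalar matrices it contains. *)
Definition proportional : rel U :=
  fun A B => `[< exists c : C, U_val A = c *: U_val B >].

Lemma U_neq0 (A : U) : U_val A != 0.
Proof.
by apply/eqP=> A0; move: (U_unit A); rewrite A0 unitmxE det0 unitr0.
Qed.

Lemma proportionalP A B :
  reflect (exists2 c : C, c != 0 & U_val A = c *: U_val B) (proportional A B).
Proof.
apply: (iffP (asboolP _)) => [[c e]|[c _ e]]; exists c => //.
by apply/eqP=> c0; have := U_neq0 A; rewrite e c0 scale0r eqxx.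
Qed.

Lemma proportional_refl : reflexive proportional.
Proof. by move=> A; apply/asboolP; exists 1; rewrite scale1r. Qed.

Lemma proportional_sym : symmetric proportional.
Proof.
have H A B : proportional A B -> proportional B A.
  case/proportionalP=> c c0 e; apply/asboolP; exists c^-1.
  by rewrite e scalerA mulVf // scale1r.
by move=> A B; apply/idP/idP; apply: H.
Qed.

Lemma proportional_trans : transitive proportional.
Proof.
move=> B A D /asboolP[c e] /asboolP[c' e']; apply/asboolP; exists (c * c').
by rewrite e e' scalerA.
Qed.

Canonical proportional_equiv :=
  EquivRel proportional proportional_refl proportional_sym proportional_trans.

Definition PU := {eq_quot proportional}.
HB.instance Definition _ := Choice.on PU.
HB.instance Definition _ := EqQuotient.on PU.

Definition PU_one : PU := \pi_PU 1%g.
Definition PU_mul (x y : PU) : PU := \pi_PU (repr x * repr y)%g.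
Definition PU_inv (x : PU) : PU := \pi_PU (repr x)^-1%g.

Lemma pi_PU_mul A B : PU_mul (\pi_PU A) (\pi_PU B) = \pi_PU (A * B)%g.
Proof.
apply/eqmodP/asboolP.
have /eqmodP/asboolP[c ec] := reprK (\pi_PU A).
have /eqmodP/asboolP[c' ec'] := reprK (\pi_PU B).
exists (c * c'); rewrite /= ec ec'.
by rewrite -scalemxAl -scalemxAr scalerA.
Qed.

Lemma pi_PU_inv A : PU_inv (\pi_PU A) = \pi_PU A^-1%g.
Proof.
apply/eqmodP/asboolP.
have /eqmodP/proportionalP[c c0 ec] := reprK (\pi_PU A).
exists c^-1; rewrite /= ec invmxZ //.
by rewrite unitmxZ ?U_unit // unitfE.
Qed.

Lemma PU_mulA : associative PU_mul.
Proof.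
move=> x y z; rewrite -[x]reprK -[y]reprK -[z]reprK.
move: (repr x) (repr y) (repr z) => A B D.
by rewrite (pi_PU_mul B) (pi_PU_mul A B) !pi_PU_mul mulgA.
Qed.
Lemma PU_mul1 : left_id PU_one PU_mul.
Proof. by move=> x; rewrite -[x]reprK pi_PU_mul mul1g. Qed.
Lemma PU_mulr1 : right_id PU_one PU_mul.
Proof. by move=> x; rewrite -[x]reprK pi_PU_mul mulg1. Qed.
Lemma PU_mulV : left_inverse PU_one PU_inv PU_mul.
Proof. by move=> x; rewrite -[x]reprK pi_PU_inv pi_PU_mul mulVg. Qed.
Lemma PU_mulrV : right_inverse PU_one PU_inv PU_mul.
Proof. by move=> x; rewrite -[x]reprK pi_PU_inv pi_PU_mul mulgV. Qed.

HB.instance Definition _ :=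
  isGroup.Build PU PU_mulA PU_mul1 PU_mulr1 PU_mulV PU_mulrV.

Definition imag_quad_field (d : nat) : set C :=
  [set z | exists a b : rat, z = ratr a + ratr b * ('i * sqrtC d%:R)].

Definition ring_of_integers (d : nat) : set C :=
  [set z | imag_quad_field d z /\ integralOver (intr : int -> C) z].

Definition mx_over (S : set C) m n (A : 'M[C]_(m, n)) : Prop :=
  forall i j, S (A i j).

(* For a subring S of C this is GL_3(S): the inverse is required over S too. *)
Definition GL3 (S : set C) : set 'M[C]_3 :=
  [set A | [/\ A \in unitmx, mx_over S A & mx_over S (invmx A)]].

Definition Gamma (d : nat) : set PU :=
  [set \pi_PU A | A in [set A : U | GL3 (ring_of_integers d) A]].

(* Points of the boundary are isotropic lines C v; being a cusp is expressed
   through a spanning vector v with entries in the ring of integers. *)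
Definition cusp_vector (d : nat) (v : 'cV[C]_3) : Prop :=
  [/\ v != 0, v ^t* *m J *m v = 0 & mx_over (ring_of_integers d) v].

(* Stabilizer of the line C v in PU; the scalar c is nonzero if v is. *)
Definition line_stabilizer (v : 'cV[C]_3) : set PU :=
  [set \pi_PU A | A in [set A : U | exists c : C, U_val A *m v = c *: v]].

Definition unipotent (A : 'M[C]_3) : Prop := exists n, (A - 1) ^+ n = 0.

Definition neat (d : nat) (H : set PU) : Prop :=
  [/\ is_subgroup H, H `<=` Gamma d, finite_set (lcosets H (Gamma d)),
      torsion_free H
    & forall v g, cusp_vector d v -> (H `&` line_stabilizer v) g ->
        exists2 A : U, \pi_PU A = g & unipotent A].

End UnitaryGroup.

(* l is L_d, the lcm of the orders of the finite subgroups of Gamma_d; in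
   particular these orders are bounded. *)
Definition L_spec (C : numClosedFieldType) (d l : nat) : Prop :=
  is_lcm (finite_subgroup_order (@Gamma C d)) l.

Definition has_neat_subgroup (C : numClosedFieldType) (d n : nat) : Prop :=
  exists H : set (PU C), neat d H /\ has_index H (Gamma d) n.

Definition has_torsion_free_subgroup (C : numClosedFieldType) (d n : nat) :=
  exists H : set (PU C),
    [/\ is_subgroup H, H `<=` Gamma d, torsion_free H
      & has_index H (Gamma d) n].

(* Main.v *)
From Stdlib Require Import ZArith.
From HB Require Import structures.
From mathcomp Require Import all_boot all_order all_algebra all_fingroup all_solvable.
From mathcomp Require Import all_classical reals complex.
From mathcomp Require Import ssrZ zify ring lra.
Require Import Defs.
Set Implicit Arguments.
Unset Strict Implicit.
Unset Printing Implicit Defensive.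
Import Order.TTheory GRing.Theory Num.Theory.
Local Open Scope classical_set_scope.
Local Open Scope ring_scope.
Local Open Scope sesquilinear_scope.
Local Open Scope quotient_scope.
Delimit Scope Z_scope with zz.
Arguments Z.mul : simpl never.
Arguments Z.add : simpl never.
Arguments Z.sub : simpl never.
Arguments Z.opp : simpl never.

(** * Three by three matrices as tuples *)

(** Units of the rings involved have order dividing 12, so every element of Gamma_d has an integral
    lift whose determinant has cube 1, unique up to cube roots of unity; for d other than 3 this is
    a unique lift of determinant 1. Each subgroup to be found is a congruence subgroup [Hset]: the
    classes whose lifts reduce, modulo a fixed g, into an explicit finite matrix group [HL].

    Index. A matrix preserving J is determined by its determinant and its outer columns, two
    isotropic vectors with product 1. Enumerating such data modulo g yields a finite set containing
    the image of Gamma_d. A computation shows that the products r h, with r the reduction of an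
    explicit integral representative and h in [HL], are distinct and cover this set; the index is
    then the number of r ([Hset_index]).

    Torsion. If 1 + g X has prime order p, some primitive p-th root of unity r is an eigenvalue and
    (r - 1) / g is an algebraic integer. As p is the product of the 1 - r^i, it is divisible by
    g^(p-1), and norms contradict N(g) > 4 ([congruent_free]). The exponent of [HL] is a power of
    one prime p0, and an element of any other prime order has a lift in the kernel of reduction, so
    only p0 needs care ([Hset_torsion_free]). For d = 1, 2 an involution other than 1 and -1 has
    both eigenvalues and a hermitian product with J, which residues exclude ([involution_scalar]).
    For d = 3 one studies the three spectral projections of an element of order three: one onto a
    positive line has norms of Eisenstein integers on the diagonal of J P, which excludes the
    residues at hand ([cube_scalar]). For d = 11, 19 the primes 13 and 7 do not divide the order of
    GL_3(F_5), and reduction at a prime above 5 is faithful on torsion. For d = 7 the group [HL] is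
    trivial.

    Neatness. A spanning vector v of a cusp can be rescaled to have a normalised residue. If M v =
    lam v, then lam is a unit, and a finite check gives det M = lam^3. Hence M / lam has determinant
    1 and fixes v and the functional v^* J, which makes it unipotent ([Hset_neat]).

    Finite subgroups. They act freely on the cosets of a torsion-free subgroup, so their orders
    divide its index ([card_dvd_index]). With explicit finite groups as lower bounds this settles d
    = 1, 2, 3. For d = 7, 11, 19 the surplus factors are removed by embedding finite subgroups in
    GL_3(F_q): order divisible by 16 would force an element of order 8, whose characteristic
    polynomial is impossible ([not16_dvd], [no_order8]), and 9 does not divide the order of
    GL_3(F_5). *)

Inductive m3 (T : Type) : Type := M3 of T & T & T & T & T & T & T & T & T.

Definition m3_map S T (f : S -> T) (A : m3 S) : m3 T :=
  let: M3 a b c d e g h i j := A in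
  M3 (f a) (f b) (f c) (f d) (f e) (f g) (f h) (f i) (f j).

Definition m3_seq T (A : m3 T) : seq T :=
  let: M3 a b c d e g h i j := A in [:: a; b; c; d; e; g; h; i; j].

Section M3Ops.
Variables (T : Type) (add mul : T -> T -> T) (neg cj : T -> T).

Definition m3_mul (A B : m3 T) : m3 T :=
  let: M3 a b c d e g h i j := A in let: M3 a' b' c' d' e' g' h' i' j' := B in
  let r x y z x' y' z' := add (add (mul x x') (mul y y')) (mul z z') in
  M3 (r a b c a' d' h') (r a b c b' e' i') (r a b c c' g' j')
     (r d e g a' d' h') (r d e g b' e' i') (r d e g c' g' j')
     (r h i j a' d' h') (r h i j b' e' i') (r h i j c' g' j').

(* J A^* J, the inverse of A when A preserves J *)
Definition m3_adj (A : m3 T) : m3 T :=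
  let: M3 a b c d e g h i j := A in
  M3 (cj j) (cj g) (cj c) (cj i) (cj e) (cj b) (cj h) (cj d) (cj a).

Definition m3_minor (x y x' y' : T) := add (mul x y') (neg (mul y x')).

Definition m3_det (A : m3 T) : T :=
  let: M3 a b c d e g h i j := A in
  add (add (mul a (m3_minor e g i j)) (neg (mul b (m3_minor d g h j))))
      (mul c (m3_minor d e h i)).

Definition v3_herm (u v : T * T * T) : T :=
  let: (a, b, c) := u in let: (a', b', c') := v in
  add (add (mul (cj c) a') (mul (cj b) b')) (mul (cj a) c').

Definition m3_app (A : m3 T) (u : T * T * T) : T * T * T :=
  let: M3 a b c d e g h i j := A in let: (x, y, z) := u in
  let r x' y' z' := add (add (mul x' x) (mul y' y)) (mul z' z) in
  (r a b c, r d e g, r h i j).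

(* A matrix preserving J is determined by its outer columns u, v and its
   determinant d: the middle column is d J conj(v x u). *)
Definition m3_of_cols (d : T) (u v : T * T * T) : m3 T :=
  let: (a, b, c) := u in let: (a', b', c') := v in
  M3 a (mul d (cj (m3_minor a' b' a b))) a'
     b (mul d (cj (m3_minor c' a' c a))) b'
     c (mul d (cj (m3_minor b' c' b c))) c'.

End M3Ops.

Definition m3_scal T (z : T) (x : T) : m3 T := M3 x z z z x z z z x.

(** * Binary tries, used to decide membership in long lists of matrices *)

Inductive trie := Lf | Nd of trie & trie.

(** Meant for keys of one common length: a node reached when the key is exhausted then marks exactly
    that key as stored. *)
Fixpoint tmem (k : seq bool) (t : trie) : bool :=
  if t is Nd l r then
    if k is b :: k' then tmem k' (if b then r else l) else true
  else false.

Fixpoint tins (k : seq bool) (t : trie) : trie :=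
  let: (l, r) := if t is Nd l r then (l, r) else (Lf, Lf) in
  if k is b :: k' then if b then Nd l (tins k' r) else Nd (tins k' l) r
  else Nd l r.

(** Failure on a repeated key turns success into a certificate that all keys are distinct. *)
Fixpoint tbuild (s : seq (seq bool)) (t : trie) : option trie :=
  if s is k :: s' then if tmem k t then None else tbuild s' (tins k t)
  else Some t.

Lemma tmem_tins k k' t : size k = size k' ->
  tmem k (tins k' t) = (k == k') || tmem k t.
Proof.
elim: k k' t => [|b k IH] [|b' k'] //= t; first by case: t.
case=> Es; case: b'; case: b; case: t => [|l r] //=;
  rewrite ?IH ?eqseq_cons ?eqxx ?andbT ?andbF //=; by case: k {IH Es}.
Qed.

Lemma tbuildP n s t t' : all (fun k => size k == n) s -> tbuild s t = Some t' ->
  [/\ uniq s, {in s, forall k, ~~ tmem k t} &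
      forall k, size k = n -> tmem k t' = (k \in s) || tmem k t].
Proof.
elim: s t => [|k s IH] t /=; first by move=> _ [<-].
case/andP=> /eqP kn sn; case: ifPn => // kt /(IH _ sn) [us nt Ht].
have ks : k \notin s by apply/negP => /nt; rewrite tmem_tins // eqxx.
split; first by rewrite ks.
  move=> k'; rewrite inE => /orP[/eqP->//|k's].
  by have := nt _ k's; rewrite tmem_tins ?(eqP (allP sn _ k's)) // negb_or => /andP[].
by move=> k' k'n; rewrite Ht // tmem_tins ?kn // inE orbA [(_ \in s) || _]orbC.
Qed.

(** * Imaginary quadratic integers and their residues *)

(* The pair (a, b) stands for a + b w, where w^2 = t w - n. *)
Definition zadd (p q : Z * Z) : Z * Z := (p.1 + q.1, p.2 + q.2)%zz.
Definition zneg (p : Z * Z) : Z * Z := (- p.1, - p.2)%zz.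
Definition zmul (t n : Z) (p q : Z * Z) : Z * Z :=
  (p.1 * q.1 - n * (p.2 * q.2), p.1 * q.2 + p.2 * q.1 + t * (p.2 * q.2))%zz.
Definition zconj (t : Z) (p : Z * Z) : Z * Z := (p.1 + t * p.2, - p.2)%zz.
Definition znorm (t n : Z) (p : Z * Z) : Z :=
  (p.1 * p.1 + t * (p.1 * p.2) + n * (p.2 * p.2))%zz.
(** The quotient p / g is p times the conjugate of g, divided by the norm of g. *)
Definition zdvd (t n : Z) (g p : Z * Z) : bool :=
  let q := zmul t n p (zconj t g) in let N := znorm t n g in
  (q.1 mod N =? 0)%zz && (q.2 mod N =? 0)%zz.

Definition bits4 (i : nat) : seq bool :=
  [:: odd i; odd i./2; odd i./2./2; odd i./2./2./2].

(* Residues modulo g are indices in the list rep of representatives; index 0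
   is the residue of 0 and index 1 that of 1. *)
Section Tables.
Variables (t n : Z) (g : Z * Z) (rep : seq (Z * Z)).

(** The value [size rep] would mean that no representative matches; [res_lt] excludes it for valid
    levels. *)
Definition residue (p : Z * Z) : nat :=
  find (fun r => zdvd t n g (zadd p (zneg r))) rep.
Definition mk_add := [seq [seq residue (zadd p q) | q <- rep] | p <- rep].
Definition mk_mul := [seq [seq residue (zmul t n p q) | q <- rep] | p <- rep].
Definition mk_neg := [seq residue (zneg p) | p <- rep].
Definition mk_conj := [seq residue (zconj t p) | p <- rep].
(** Traces of p times the conjugate of q are kept modulo an integer m, and [mk_norm] keeps negated
    norms modulo m, so that isotropy of a vector becomes equality of two table entries. This can be
    finer than the vanishing of the hermitian form modulo g. *)
Definition mk_tr (m : Z) := [seq [seq Z.to_nat ((2 * (zmul t n p (zconj t q)).1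
   + t * (zmul t n p (zconj t q)).2) mod m)%zz | q <- rep] | p <- rep].
Definition mk_norm (m : Z) := [seq Z.to_nat ((- znorm t n p) mod m)%zz | p <- rep].
End Tables.

(** Here [lv_gam] is the modulus g, [lv_pi] a divisor of g used to normalise vectors, and [lv_m] the
    modulus for traces and norms. Ring operations are tabulated so that the large checks reduce to
    table lookups. *)
Record level := Level {
  lv_t : Z; lv_n : Z; lv_gam : Z * Z; lv_pi : Z * Z; lv_m : Z;
  lv_rep : seq (Z * Z);
  lv_tadd : seq (seq nat); lv_tmul : seq (seq nat);
  lv_tneg : seq nat; lv_tconj : seq nat; lv_ttr : seq (seq nat); lv_tnorm : seq nat;
  lv_tbits : seq (seq bool) }.

Definition mk_level t n g pi m rep := Level t n g pi m rep
  (mk_add t n g rep) (mk_mul t n g rep) (mk_neg t n g rep) (mk_conj t n g rep)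
  (mk_tr t n rep m) (mk_norm t n rep m) [seq bits4 i | i <- iota 0 (size rep)].

Section LevelOps.
Variable L : level.
Definition radd (i j : nat) : nat := nth 0%N (nth [::] (lv_tadd L) i) j.
Definition rmul (i j : nat) : nat := nth 0%N (nth [::] (lv_tmul L) i) j.
Definition rneg (i : nat) : nat := nth 0%N (lv_tneg L) i.
Definition rconj (i : nat) : nat := nth 0%N (lv_tconj L) i.
Definition rtr (i j : nat) : nat := nth 0%N (nth [::] (lv_ttr L) i) j.
Definition rnorm (i : nat) : nat := nth 0%N (lv_tnorm L) i.
Definition rbits (i : nat) : seq bool := nth [::] (lv_tbits L) i.
Definition rres (p : Z * Z) : nat := residue (lv_t L) (lv_n L) (lv_gam L) (lv_rep L) p.
Definition rmm : m3 nat -> m3 nat -> m3 nat := m3_mul radd rmul.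
Definition rkey (A : m3 nat) : seq bool := flatten [seq rbits i | i <- m3_seq A].
Definition rcode (A : m3 (Z * Z)) : m3 nat := m3_map rres A.

(** Finite groups and transversals are stored as products of short lists of factors, which keeps the
    data small and reduces closure tests to the factors. *)
Fixpoint products (l : seq (seq (m3 nat))) : seq (m3 nat) :=
  if l is F :: l' then let P := products l' in [seq rmm a b | a <- F, b <- P]
  else [:: m3_scal 0%N 1%N].

Definition coset_keys (R H : seq (m3 nat)) : seq (seq bool) :=
  [seq rkey (rmm r h) | r <- R, h <- H].

Definition vectors : seq (nat * nat * nat) :=
  let I := iota 0 (size (lv_rep L)) in
  flatten [seq [seq (a, b, c) | b <- I, c <- I] | a <- I].

Definition null_vec (u : nat * nat * nat) : bool :=
  let: (a, b, c) := u in rtr a c == rnorm b.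

(** The pairs (u, v) range over all residues that the outer columns of an integral matrix preserving
    J can have, so the trie contains the reduction of every normalised lift. *)
Definition covers (dets : seq nat) (T : trie) : bool :=
  let V := [seq u <- vectors | null_vec u] in
  all (fun u => all (fun v =>
    (v3_herm radd rmul rconj u v == 1%N) ==>
      all (fun d => tmem (rkey (m3_of_cols radd rmul rneg rconj d u v)) T) dets) V) V.

Definition index_check dets (R H : seq (m3 nat)) : bool :=
  if tbuild (coset_keys R H) Lf is Some T then covers dets T else false.
End LevelOps.

(** * Moduli, coset representatives and finite groups for each d *)

Definition level1 := Eval vm_compute in mk_level 0 1 (2,2) (1,1) 4
  [:: (0,0); (1,0); (2,0); (3,0); (0,1); (1,1); (2,1); (3,1)]%zz.
Definition reps1 : seq (seq (m3 (Z * Z))) :=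
  [:: [:: M3 (1,0) (0,0) (0,0) (0,0) (1,0) (0,0) (0,0) (0,0) (1,0);
    M3 (0,0) (0,0) (0,(-1)) (0,0) (1,0) (0,0) (0,(-1)) (0,0) (0,0)];
  [:: M3 (1,0) (0,0) (0,0) (0,0) (1,0) (0,0) (0,0) (0,0) (1,0);
    M3 ((-3),0) (0,0) (0,(-2)) (0,0) (1,0) (0,0) (0,(-2)) (0,0) (1,0)];
  [:: M3 (1,0) (0,0) (0,0) (0,0) (1,0) (0,0) (0,0) (0,0) (1,0);
    M3 (0,1) (1,1) (1,(-1)) (0,0) ((-1),0) (1,1) (0,0) (0,0) (0,1)];
  [:: M3 (1,0) (0,0) (0,0) (0,0) (1,0) (0,0) (0,0) (0,0) (1,0);
    M3 (1,0) (1,(-1)) ((-1),0) (0,0) (1,0) ((-1),(-1)) (0,0) (0,0) (1,0);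
    M3 ((-1),0) (0,0) (0,0) (0,0) (1,0) (0,0) (0,2) (0,0) ((-1),0)];
  [:: M3 (1,0) (0,0) (0,0) (0,0) (1,0) (0,0) (0,0) (0,0) (1,0);
    M3 (0,1) ((-1),(-1)) ((-1),(-1)) (0,0) ((-1),0) ((-1),(-1)) ((-1),0) (1,(-1)) (1,0)];
  [:: M3 (1,0) (0,0) (0,0) (0,0) (1,0) (0,0) (0,0) (0,0) (1,0);
    M3 (1,0) (0,0) (0,0) (0,0) (1,0) (0,0) (0,1) (0,0) (1,0)]]%zz.
Definition sub1 : seq (seq (m3 nat)) :=
  [:: [:: M3 1 0 0 0 1 0 0 0 1;
    M3 3 0 2 5 1 0 5 7 3];
  [:: M3 1 0 0 0 1 0 0 0 1;
    M3 1 2 0 0 1 2 0 0 1];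
  [:: M3 1 0 0 0 1 0 0 0 1;
    M3 1 0 0 2 1 0 0 2 1];
  [:: M3 1 0 0 0 1 0 0 0 1;
    M3 1 0 0 0 1 0 2 0 1]]%N.
Definition level2 := Eval vm_compute in mk_level 0 2 (0,2) (0,1) 8
  [:: (0,0); (1,0); (2,0); (3,0); (0,1); (1,1); (2,1); (3,1)]%zz.
Definition reps2 : seq (seq (m3 (Z * Z))) :=
  [:: [:: M3 (1,0) (0,0) (0,0) (0,0) (1,0) (0,0) (0,0) (0,0) (1,0);
    M3 ((-1),0) (0,0) (0,0) (0,0) (1,0) (0,0) (0,0) (0,0) ((-1),0)];
  [:: M3 (1,0) (0,0) (0,0) (0,0) (1,0) (0,0) (0,0) (0,0) (1,0);
    M3 (0,0) (0,0) (1,0) (0,0) ((-1),0) (0,0) (1,0) (0,0) (0,0)];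
  [:: M3 (1,0) (0,0) (0,0) (0,0) (1,0) (0,0) (0,0) (0,0) (1,0);
    M3 (1,0) (0,(-1)) ((-1),(-1)) (0,0) (1,0) (0,(-1)) (0,0) (0,0) (1,0);
    M3 (1,0) (0,1) ((-1),0) (0,1) ((-1),0) (0,0) ((-1),0) (0,0) (0,0)];
  [:: M3 (1,0) (0,0) (0,0) (0,0) (1,0) (0,0) (0,0) (0,0) (1,0);
    M3 (1,0) (0,(-1)) ((-1),1) (0,(-1)) ((-1),0) (2,0) ((-1),(-1)) ((-2),0) (2,0)];
  [:: M3 (1,0) (0,0) (0,0) (0,0) (1,0) (0,0) (0,0) (0,0) (1,0);
    M3 ((-1),0) (0,0) (0,0) (0,0) (1,0) (0,0) (0,1) (0,0) ((-1),0)];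
  [:: M3 (1,0) (0,0) (0,0) (0,0) (1,0) (0,0) (0,0) (0,0) (1,0);
    M3 (1,0) (0,0) (0,(-1)) (0,0) (1,0) (0,0) (0,(-1)) (0,0) ((-1),0)]]%zz.
Definition sub2 : seq (seq (m3 nat)) :=
  [:: [:: M3 1 0 0 0 1 0 0 0 1;
    M3 1 2 2 0 1 2 0 0 1];
  [:: M3 1 0 0 0 1 0 0 0 1;
    M3 1 0 4 2 1 0 2 2 1]]%N.
(** Two levels occur for d = 2: modulo 2 sqrt(-2) for the neat subgroup, and modulo 4 for the
    torsion-free one of smaller index. *)
Definition level2t := Eval vm_compute in mk_level 0 2 (4,0) (0,1) 8
  [:: (0,0); (1,0); (2,0); (3,0); (0,1); (1,1); (2,1); (3,1); (0,2); (1,2); (2,2); (3,2); (0,3); (1,3); (2,3); (3,3)]%zz.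
Definition reps2t : seq (seq (m3 (Z * Z))) :=
  [:: [:: M3 (1,0) (0,0) (0,0) (0,0) (1,0) (0,0) (0,0) (0,0) (1,0);
    M3 ((-1),0) (0,0) (0,0) (0,0) (1,0) (0,0) (0,0) (0,0) ((-1),0)];
  [:: M3 (1,0) (0,0) (0,0) (0,0) (1,0) (0,0) (0,0) (0,0) (1,0);
    M3 ((-1),0) (0,0) (0,1) (0,0) (1,0) (0,0) (0,1) (0,0) (1,0)];
  [:: M3 (1,0) (0,0) (0,0) (0,0) (1,0) (0,0) (0,0) (0,0) (1,0);
    M3 (1,0) (0,0) (0,1) (0,1) (1,0) ((-2),0) ((-1),0) (0,1) (1,(-1))];
  [:: M3 (1,0) (0,0) (0,0) (0,0) (1,0) (0,0) (0,0) (0,0) (1,0);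
    M3 (1,0) (0,0) (0,(-2)) (0,1) (1,0) (4,0) ((-1),(-1)) (0,1) ((-3),2)];
  [:: M3 (1,0) (0,0) (0,0) (0,0) (1,0) (0,0) (0,0) (0,0) (1,0);
    M3 (6,0) ((-2),(-2)) ((-1),1) ((-2),2) (3,0) (0,(-1)) ((-1),(-1)) (0,1) (1,0);
    M3 (1,0) (0,(-1)) ((-1),(-2)) (0,0) (1,0) (0,(-1)) (0,0) (0,0) (1,0)]]%zz.
Definition sub2t : seq (seq (m3 nat)) :=
  [:: [:: M3 1 0 0 0 1 0 0 0 1;
    M3 5 0 0 0 9 0 6 0 15];
  [:: M3 1 0 0 0 1 0 0 0 1;
    M3 3 0 0 0 1 0 4 0 3];
  [:: M3 1 0 0 0 1 0 0 0 1;
    M3 11 0 0 0 1 0 0 0 11];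
  [:: M3 1 0 0 0 1 0 0 0 1;
    M3 1 8 0 0 1 8 0 0 1];
  [:: M3 1 0 0 0 1 0 0 0 1;
    M3 1 2 6 0 1 2 0 0 1];
  [:: M3 1 0 0 0 1 0 0 0 1;
    M3 1 0 8 0 1 0 0 0 1];
  [:: M3 1 0 0 0 1 0 0 0 1;
    M3 1 0 0 8 1 0 0 8 1];
  [:: M3 1 0 0 0 1 0 0 0 1;
    M3 1 0 0 0 1 0 8 0 1]]%N.
Definition level3 := Eval vm_compute in mk_level 1 1 (3,0) ((-1),2) 3
  [:: (0,0); (1,0); (2,0); (0,1); (1,1); (2,1); (0,2); (1,2); (2,2)]%zz.
Definition reps3 : seq (seq (m3 (Z * Z))) :=
  [:: [:: M3 ((-1),1) (0,0) (0,0) (0,0) ((-1),1) (0,0) (0,0) (0,0) ((-1),1);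
    M3 ((-1),0) (0,0) (0,0) (0,0) (0,(-1)) (0,0) (0,0) (0,0) ((-1),0);
    M3 ((-1),0) (0,0) (0,0) (0,0) ((-1),1) (0,0) (0,0) (0,0) ((-1),0)];
  [:: M3 ((-1),1) (0,0) (0,0) (0,0) ((-1),1) (0,0) (0,0) (0,0) ((-1),1);
    M3 (0,0) (0,0) ((-1),0) (0,0) (1,(-1)) (0,0) ((-1),0) (0,0) ((-1),2);
    M3 ((-2),1) (0,0) (0,1) (0,0) (1,(-1)) (0,0) (0,1) (0,0) (0,0)];
  [:: M3 ((-1),1) (0,0) (0,0) (0,0) ((-1),1) (0,0) (0,0) (0,0) ((-1),1);
    M3 ((-1),0) ((-1),0) (0,1) ((-1),0) (0,0) ((-1),1) (0,1) ((-1),1) (1,(-1))];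
  [:: M3 ((-1),1) (0,0) (0,0) (0,0) ((-1),1) (0,0) (0,0) (0,0) ((-1),1);
    M3 ((-1),0) (0,0) (0,0) (0,0) (1,0) (0,0) (0,0) (0,0) ((-1),0)];
  [:: M3 ((-1),1) (0,0) (0,0) (0,0) ((-1),1) (0,0) (0,0) (0,0) ((-1),1);
    M3 ((-1),(-1)) (0,0) ((-2),2) (0,0) (1,(-1)) (0,0) ((-2),2) (0,0) (1,1)]]%zz.
Definition sub3 : seq (seq (m3 nat)) :=
  [:: [:: M3 1 0 0 0 1 0 0 0 1;
    M3 0 0 1 0 2 1 1 1 5;
    M3 1 1 5 1 2 4 5 4 8];
  [:: M3 1 0 0 0 1 0 0 0 1;
    M3 5 0 0 0 5 0 0 0 5;
    M3 6 0 0 0 6 0 0 0 6];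
  [:: M3 1 0 0 0 1 0 0 0 1;
    M3 1 4 0 0 1 4 8 0 1;
    M3 1 8 0 0 1 8 4 0 1];
  [:: M3 1 0 0 0 1 0 0 0 1;
    M3 1 0 4 0 1 0 8 0 1;
    M3 1 0 8 0 1 0 4 0 1];
  [:: M3 1 0 0 0 1 0 0 0 1;
    M3 1 0 0 4 1 0 8 4 1;
    M3 1 0 0 8 1 0 4 8 1]]%N.
Definition level7 := Eval vm_compute in mk_level 1 2 ((-1),2) ((-1),2) 7
  [:: (0,0); (1,0); (2,0); (3,0); (4,0); (5,0); (6,0)]%zz.
Definition reps7 : seq (seq (m3 (Z * Z))) :=
  [:: [:: M3 (1,0) (0,0) (0,0) (0,0) (1,0) (0,0) (0,0) (0,0) (1,0);
    M3 ((-1),0) (0,0) (0,0) (0,0) (1,0) (0,0) (0,0) (0,0) ((-1),0);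
    M3 (0,0) (0,0) ((-1),0) (0,0) ((-1),0) ((-1),0) ((-1),0) (1,0) (0,1);
    M3 (1,0) ((-1),0) (0,(-1)) (0,0) (1,0) (1,0) (0,0) (0,0) (1,0);
    M3 (0,0) (0,0) (1,0) (0,0) ((-1),0) ((-1),0) (1,0) ((-1),0) (0,(-1));
    M3 ((-1),0) (1,0) (0,1) (0,0) (1,0) (1,0) (0,0) (0,0) ((-1),0);
    M3 (1,0) (0,0) (0,0) ((-1),1) (1,0) (0,0) ((-1),0) (0,1) (1,0);
    M3 (1,0) (0,0) (0,0) (0,1) (1,0) (0,0) ((-1),0) ((-1),1) (1,0);
    M3 ((-1),0) (0,(-1)) (1,0) (0,0) (1,0) ((-1),1) (0,0) (0,0) ((-1),0);
    M3 ((-1),0) (0,0) (0,0) (0,1) (1,0) (0,0) (1,0) (1,(-1)) ((-1),0);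
    M3 ((-1),0) (1,(-1)) (1,0) (0,0) (1,0) (0,1) (0,0) (0,0) ((-1),0);
    M3 (1,0) (1,(-1)) ((-1),0) (0,(-1)) ((-1),0) (0,0) ((-1),0) (0,0) (0,0);
    M3 (1,0) ((-1),0) ((-1),1) (1,0) (0,0) (0,1) (0,(-1)) ((-1),1) (2,0);
    M3 ((-1),0) (1,0) (0,1) (1,(-1)) (0,1) ((-1),0) (1,0) ((-1),1) ((-1),0);
    M3 ((-1),0) (1,(-1)) (1,0) ((-1),1) (0,(-1)) (1,0) (1,0) ((-1),0) (0,(-1));
    M3 (0,(-1)) ((-1),1) (2,0) ((-1),0) (0,0) (0,(-1)) (1,0) ((-1),0) ((-1),1);
    M3 (1,0) ((-1),1) ((-1),0) ((-1),1) (0,(-1)) (1,0) ((-1),0) (1,0) (0,1);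
    M3 ((-1),1) ((-1),0) (1,0) (0,(-1)) (0,0) ((-1),0) (2,0) ((-1),1) (0,(-1));
    M3 (1,0) ((-1),0) (0,(-1)) (1,(-1)) (0,1) ((-1),0) ((-1),0) (1,(-1)) (1,0);
    M3 (0,1) (1,(-1)) ((-2),0) ((-1),0) (0,0) (0,(-1)) ((-1),0) (1,0) (1,(-1));
    M3 ((-1),2) (0,0) (3,0) (0,0) ((-1),0) (0,0) ((-2),0) (0,0) ((-1),2);
    M3 (1,(-2)) (0,0) (2,0) (0,0) ((-1),0) (0,0) ((-3),0) (0,0) (1,(-2));
    M3 ((-1),2) (0,0) ((-2),0) (0,0) ((-1),0) (0,0) (3,0) (0,0) ((-1),2);
    M3 (3,0) (0,0) ((-1),2) (0,0) (1,0) (0,0) ((-1),2) (0,0) ((-2),0);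
    M3 (1,1) (0,1) (1,(-1)) ((-1),0) (0,(-1)) (0,1) ((-2),1) ((-1),0) (1,1);
    M3 (0,1) (1,0) ((-1),0) (1,(-1)) ((-1),(-1)) (0,1) ((-2),0) ((-2),1) (1,0);
    M3 ((-1),(-1)) (0,(-1)) ((-1),1) ((-1),0) (0,(-1)) (0,1) (2,(-1)) (1,0) ((-1),(-1));
    M3 ((-2),0) (1,(-1)) (0,1) (0,(-1)) (2,0) ((-1),1) (1,(-1)) (0,1) ((-2),0)];
  [:: M3 (1,0) (0,0) (0,0) (0,0) (1,0) (0,0) (0,0) (0,0) (1,0);
    M3 (0,0) (0,0) ((-1),0) (0,0) ((-1),0) (0,0) ((-1),0) (0,0) (0,0);
    M3 (0,(-1)) (1,0) (1,0) (1,0) ((-1),0) (0,0) (1,0) (0,0) (0,0)];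
  [:: M3 (1,0) (0,0) (0,0) (0,0) (1,0) (0,0) (0,0) (0,0) (1,0);
    M3 ((-1),0) ((-1),0) (0,1) (0,0) (1,0) ((-1),0) (0,0) (0,0) ((-1),0)];
  [:: M3 (1,0) (0,0) (0,0) (0,0) (1,0) (0,0) (0,0) (0,0) (1,0);
    M3 (0,(-1)) (1,2) ((-1),3) ((-1),(-1)) (3,1) (1,2) (0,1) ((-1),(-1)) (0,(-1))]]%zz.
(** The empty product is the trivial group: this encodes the principal congruence subgroup modulo
    sqrt(-7). *)
Definition sub7 : seq (seq (m3 nat)) :=
  [:: ]%N.
(** Here 3 splits as w times its conjugate, so the residue ring has zero divisors and [lv_pi] is the
    proper factor w of the modulus. *)
Definition level11 := Eval vm_compute in mk_level 1 3 (3,0) (0,1) 3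
  [:: (0,0); (1,0); (2,0); (0,1); (1,1); (2,1); (0,2); (1,2); (2,2)]%zz.
Definition reps11 : seq (seq (m3 (Z * Z))) :=
  [:: [:: M3 (1,0) (0,0) (0,0) (0,0) (1,0) (0,0) (0,0) (0,0) (1,0);
    M3 ((-1),0) (0,0) (0,0) (0,0) (1,0) (0,0) (0,0) (0,0) ((-1),0);
    M3 ((-1),0) (0,0) (1,(-2)) (0,0) (1,0) (0,0) (0,0) (0,0) ((-1),0);
    M3 (1,0) ((-1),0) (0,(-1)) (0,0) (1,0) (1,0) (0,0) (0,0) (1,0);
    M3 (1,0) (0,0) ((-1),2) (0,0) (1,0) (0,0) (0,0) (0,0) (1,0);
    M3 (1,0) (0,0) (1,(-2)) (0,0) (1,0) (0,0) (0,0) (0,0) (1,0);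
    M3 ((-1),0) (0,0) ((-1),2) (0,0) (1,0) (0,0) (0,0) (0,0) ((-1),0);
    M3 ((-1),0) (1,0) (1,(-1)) (0,0) (1,0) (1,0) (0,0) (0,0) ((-1),0);
    M3 ((-1),0) (1,(-1)) (2,(-1)) (0,0) (1,0) (0,1) (0,0) (0,0) ((-1),0)];
  [:: M3 (1,0) (0,0) (0,0) (0,0) (1,0) (0,0) (0,0) (0,0) (1,0);
    M3 (1,0) (0,1) ((-1),(-1)) (0,0) (1,0) ((-1),1) (0,0) (0,0) (1,0);
    M3 (1,0) (0,0) (0,0) (0,1) (1,0) (0,0) (0,(-3)) ((-1),1) (1,0)];
  [:: M3 (1,0) (0,0) (0,0) (0,0) (1,0) (0,0) (0,0) (0,0) (1,0);
    M3 (2,(-1)) (0,(-1)) ((-1),0) (0,2) (2,1) (2,(-1)) (0,3) (2,1) (3,(-1))];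
  [:: M3 (1,0) (0,0) (0,0) (0,0) (1,0) (0,0) (0,0) (0,0) (1,0);
    M3 ((-1),0) ((-1),0) ((-1),3) (0,0) (1,0) ((-1),0) (0,0) (0,0) ((-1),0)];
  [:: M3 (1,0) (0,0) (0,0) (0,0) (1,0) (0,0) (0,0) (0,0) (1,0);
    M3 (1,1) ((-2),(-1)) ((-3),0) (3,0) ((-4),0) ((-3),1) ((-3),0) (3,0) (2,(-1))];
  [:: M3 (1,0) (0,0) (0,0) (0,0) (1,0) (0,0) (0,0) (0,0) (1,0);
    M3 (8,0) ((-4),4) ((-3),0) (0,(-4)) (7,0) (0,2) ((-3),0) (2,(-2)) (2,0)]]%zz.
(** A group of order 13. *)
Definition sub11 : seq (seq (m3 nat)) :=
  [:: [:: M3 1 0 0 0 1 0 0 0 1;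
    M3 0 3 4 7 4 6 1 5 0;
    M3 4 2 6 4 1 1 5 8 4;
    M3 2 5 4 8 3 7 6 4 2;
    M3 6 4 8 7 5 8 6 5 6;
    M3 3 5 6 1 0 7 2 2 3;
    M3 2 8 6 7 8 4 8 5 2;
    M3 2 8 5 6 4 4 4 3 2;
    M3 7 3 5 2 0 6 2 1 7;
    M3 5 4 4 6 6 8 5 3 5;
    M3 2 3 8 8 7 6 5 4 2;
    M3 8 1 5 4 1 2 6 8 8;
    M3 0 5 8 6 8 7 1 3 0]]%N.
(** Here 3 is inert: the residue ring is the field with nine elements and [lv_pi] is the modulus
    itself. *)
Definition level19 := Eval vm_compute in mk_level 1 5 (3,0) (3,0) 3
  [:: (0,0); (1,0); (2,0); (0,1); (1,1); (2,1); (0,2); (1,2); (2,2)]%zz.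
Definition reps19 : seq (seq (m3 (Z * Z))) :=
  [:: [:: M3 (1,0) (0,0) (0,0) (0,0) (1,0) (0,0) (0,0) (0,0) (1,0);
    M3 ((-1),0) (0,0) (0,0) (0,0) (1,0) (0,0) (0,0) (0,0) ((-1),0);
    M3 ((-1),0) ((-1),0) (0,1) (0,0) (1,0) ((-1),0) (0,0) (0,0) ((-1),0);
    M3 ((-1),0) (1,0) (0,1) (0,0) (1,0) (1,0) (0,0) (0,0) ((-1),0);
    M3 (1,0) ((-1),0) (0,(-1)) (0,0) (1,0) (1,0) (0,0) (0,0) (1,0);
    M3 (1,0) (1,0) (0,(-1)) (0,0) (1,0) ((-1),0) (0,0) (0,0) (1,0);
    M3 (1,0) ((-1),1) ((-2),(-1)) (0,0) (1,0) (0,1) (0,0) (0,0) (1,0);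
    M3 (1,0) (0,1) ((-2),(-1)) (0,0) (1,0) ((-1),1) (0,0) (0,0) (1,0);
    M3 ((-1),0) (1,(-1)) (2,1) (0,0) (1,0) (0,1) (0,0) (0,0) ((-1),0)];
  [:: M3 (1,0) (0,0) (0,0) (0,0) (1,0) (0,0) (0,0) (0,0) (1,0);
    M3 (1,0) (0,0) (1,(-2)) (0,0) (1,0) (0,0) (0,0) (0,0) (1,0);
    M3 (1,0) (0,0) ((-1),2) (0,0) (1,0) (0,0) (0,0) (0,0) (1,0)];
  [:: M3 (1,0) (0,0) (0,0) (0,0) (1,0) (0,0) (0,0) (0,0) (1,0);
    M3 ((-4),1) ((-1),(-1)) (1,0) ((-3),(-3)) (5,(-1)) ((-1),1) (9,0) ((-3),3) ((-2),(-1))];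
  [:: M3 (1,0) (0,0) (0,0) (0,0) (1,0) (0,0) (0,0) (0,0) (1,0);
    M3 (1,1) (1,0) ((-4),1) ((-3),0) ((-1),0) (1,(-2)) ((-3),0) (0,0) (1,(-2))];
  [:: M3 (1,0) (0,0) (0,0) (0,0) (1,0) (0,0) (0,0) (0,0) (1,0);
    M3 ((-1),0) (0,1) (1,3) (0,0) (1,0) (1,(-1)) (0,0) (0,0) ((-1),0)];
  [:: M3 (1,0) (0,0) (0,0) (0,0) (1,0) (0,0) (0,0) (0,0) (1,0);
    M3 (0,0) (0,0) ((-1),0) (0,0) ((-1),0) (0,0) ((-1),0) (0,0) (0,0);
    M3 (1,0) (0,0) (0,0) ((-1),0) (1,0) (0,0) (0,(-1)) (1,0) (1,0);
    M3 (1,0) (0,0) (0,0) (0,0) (1,0) (0,0) (1,(-2)) (0,0) (1,0)]]%zz.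
Definition sub19 : seq (seq (m3 nat)) :=
  [:: [:: M3 1 0 0 0 1 0 0 0 1;
    M3 1 8 6 2 5 2 1 6 3;
    M3 2 6 6 8 3 7 7 3 4;
    M3 2 7 5 0 1 3 8 6 5;
    M3 6 7 6 5 1 3 4 0 2;
    M3 8 3 5 7 7 5 3 4 2;
    M3 7 2 5 5 6 4 1 2 1]]%N.

(** * The ring of integers *)

Section Quad.
Variable C : numClosedFieldType.

Definition zC (z : Z) : C := (int_of_Z z)%:~R.

Lemma zC_is_zmod_morphism : zmod_morphism zC.
Proof. by move=> x y; rewrite /zC rmorphB rmorphB. Qed.
Lemma zC_is_monoid_morphism : monoid_morphism zC.
Proof. by split=> [|x y]; rewrite /zC ?rmorph1 // rmorphM rmorphM. Qed.
HB.instance Definition _ := GRing.isZmodMorphism.Build Z C zC zC_is_zmod_morphism.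
HB.instance Definition _ := GRing.isMonoidMorphism.Build Z C zC zC_is_monoid_morphism.

Lemma zC_inj : injective zC.
Proof. by move=> x y /intr_inj /(can_inj int_of_ZK). Qed.
Lemma zCD x y : zC (x + y)%zz = zC x + zC y. Proof. exact: rmorphD. Qed.
Lemma zCN x : zC (- x)%zz = - zC x. Proof. exact: rmorphN. Qed.
Lemma zCB x y : zC (x - y)%zz = zC x - zC y. Proof. exact: rmorphB. Qed.
Lemma zCM x y : zC (x * y)%zz = zC x * zC y. Proof. exact: rmorphM. Qed.
Lemma zC_conj x : (zC x)^* = zC x. Proof. by rewrite /zC rmorph_int. Qed.
Lemma zC_nat (k : nat) : zC (Z.of_nat k) = k%:R.
Proof. by rewrite /zC (_ : int_of_Z _ = k) //; lia. Qed.
Lemma zC_eq0 x : zC x = 0 -> x = 0%zz.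
Proof. by rewrite -(rmorph0 zC) => /zC_inj. Qed.
Lemma zC_le x y : (zC x <= zC y) = (x <=? y)%zz.
Proof. by rewrite /zC ler_int; lia. Qed.
Lemma zC_int (k : int) : zC (Z_of_int k) = k%:~R.
Proof. by rewrite /zC Z_of_intK. Qed.

Definition tau (d : nat) : C := 'i * sqrtC d%:R.
Definition omega (d : nat) : C := if (d %% 4 == 3)%N then (1 + tau d) / 2%:R else tau d.

Lemma tau2 d : tau d ^+ 2 = - d%:R.
Proof. by rewrite /tau exprMn sqrCi sqrtCK mulN1r. Qed.
Lemma tau_conj d : (tau d)^* = - tau d.
Proof.
rewrite /tau rmorphM /= conjCi mulNr; congr (- (_ * _)).
by apply/CrealP; rewrite ger0_real // sqrtC_ge0 ler0n.
Qed.

(* t and n are the trace and norm of the generator w of the ring of integers. *)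
Definition quad (d : nat) (t n : Z) : Prop :=
  (if (d %% 4 == 3)%N then t = 1 /\ (4 * n = Z.of_nat d + 1)%zz
   else t = 0 /\ n = Z.of_nat d) /\ (0 < d)%N.

Variables (d : nat) (t n : Z).
Hypothesis qd : quad d t n.

Lemma omega_tau : 2%:R * omega d = zC t + zC (2 - t)%zz * tau d.
Proof.
have [] := qd; rewrite /omega; case: ifP => _ [-> _] _.
  by rewrite mulrC divfK ?pnatr_eq0 // (_ : zC (2 - 1)%zz = 1) ?mul1r.
by rewrite rmorph0 add0r (_ : zC (2 - 0)%zz = 2%:R) //.
Qed.

Lemma quad_disc : zC (t * t - 4 * n)%zz = zC ((2 - t) * (2 - t))%zz * (- d%:R).
Proof.
rewrite -(zC_nat d) -zCN -zCM; congr zC.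
by have [] := qd; case: ifP => _ [-> En] _ /=; lia.
Qed.

Lemma omega2 : omega d ^+ 2 = zC t * omega d - zC n.
Proof.
have n4 : 4%:R != 0 :> C by rewrite pnatr_eq0.
apply: (mulfI n4); have D := quad_disc.
rewrite zCB !zCM in D.
have E := omega_tau; have T := tau2 d.
have -> : 4%:R * omega d ^+ 2 = (2%:R * omega d) ^+ 2 by ring.
have -> : 4%:R * (zC t * omega d - zC n) = 2%:R * zC t * (2%:R * omega d) - 4%:R * zC n by ring.
have E4 : zC 4 = 4%:R by [].
rewrite E; move: D; rewrite E4 => D.
have -> : 4%:R * zC n = zC t * zC t - zC (2 - t)%zz * zC (2 - t)%zz * (- d%:R) by rewrite -D; ring.
by rewrite -T; ring.
Qed.

Lemma omega_conj : (omega d)^* = zC t - omega d.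
Proof.
have n2 : 2%:R != 0 :> C by rewrite pnatr_eq0.
apply: (mulfI n2); rewrite mulrBr omega_tau.
have -> : 2%:R * (omega d)^* = (2%:R * omega d)^* by rewrite rmorphM rmorph_nat.
by rewrite omega_tau rmorphD rmorphM /= !zC_conj tau_conj; ring.
Qed.

Definition emb (p : Z * Z) : C := zC p.1 + zC p.2 * omega d.

Lemma embD p q : emb (zadd p q) = emb p + emb q.
Proof. by rewrite /emb /= !zCD; ring. Qed.
Lemma embN p : emb (zneg p) = - emb p.
Proof. by rewrite /emb /= !zCN; ring. Qed.
Lemma embM p q : emb (zmul t n p q) = emb p * emb q.
Proof.
rewrite /emb /= zCB !zCD !zCM.
have O := omega2; have -> : zC p.1 * zC q.1 - zC n * (zC p.2 * zC q.2) +
  (zC p.1 * zC q.2 + zC p.2 * zC q.1 + zC t * (zC p.2 * zC q.2)) * omega d =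
  zC p.1 * zC q.1 + (zC p.1 * zC q.2 + zC p.2 * zC q.1) * omega d +
  zC p.2 * zC q.2 * (zC t * omega d - zC n) by ring.
by rewrite -O; ring.
Qed.
Lemma emb_conj p : (emb p)^* = emb (zconj t p).
Proof. by rewrite /emb rmorphD rmorphM /= !zC_conj omega_conj zCD zCN zCM; ring. Qed.
Lemma emb_zC x : emb (x, 0%zz) = zC x.
Proof. by rewrite /emb /= rmorph0 mul0r addr0. Qed.
Lemma emb_norm p : emb p * (emb p)^* = zC (znorm t n p).
Proof.
rewrite emb_conj -embM -emb_zC; congr emb.
by case: p => a b; rewrite /zmul /zconj /znorm /=; congr pair; lia.
Qed.

Lemma tau_neq0 : tau d != 0.
Proof.
have d0 : d%:R != 0 :> C by rewrite pnatr_eq0 -lt0n; case: qd.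
by rewrite -sqrf_eq0 tau2 oppr_eq0.
Qed.

Lemma emb_eq0 p : emb p = 0 -> p = (0, 0)%zz.
Proof.
case: p => a b; rewrite /emb /= => E.
have n2 : 2%:R != 0 :> C by rewrite pnatr_eq0.
have E2 : zC (2 * a + t * b)%zz + zC (b * (2 - t))%zz * tau d = 0.
  rewrite zCD !zCM; have -> : zC 2 = 2%:R by [].
  transitivity (2%:R * (zC a + zC b * omega d)); last by rewrite E mulr0.
  by have O := omega_tau; ring: O.
have E3 : zC (2 * a + t * b)%zz - zC (b * (2 - t))%zz * tau d = 0.
  have := congr1 Num.conj E2; rewrite rmorphD rmorphM /= rmorph0 !zC_conj tau_conj => <-.
  by ring.
have E4 : zC (2 * a + t * b)%zz = 0.
  apply: (mulfI n2); rewrite mulr0 -[RHS](addr0 0) -{1}E2 -E3; ring.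
have E5 : zC (b * (2 - t))%zz = 0.
  by apply: (mulIf tau_neq0); rewrite mul0r -E2 E4 add0r.
move/zC_eq0: E4 => E4; move/zC_eq0: E5 => E5.
have [t1|t0] : t = 1%zz \/ t = 0%zz by have [] := qd; case: ifP => _ []; auto.
  by congr pair; rewrite t1 in E4 E5; lia.
by congr pair; rewrite t0 in E4 E5; lia.
Qed.

Lemma emb_inj : injective emb.
Proof.
move=> p q /eqP; rewrite -subr_eq0 -embN -embD => /eqP/emb_eq0.
by case: p q => [a b] [a' b'] [E1 E2]; congr pair; lia.
Qed.

Lemma znorm_ge0 p : (0 <= znorm t n p)%zz.
Proof.
have : zC 0 <= zC (znorm t n p) by rewrite -emb_norm rmorph0 mul_conjC_ge0.
by rewrite zC_le; lia.
Qed.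

Lemma znorm_eq0 p : znorm t n p = 0%zz -> p = (0, 0)%zz.
Proof.
move=> E; apply: emb_eq0; apply/eqP; rewrite -mul_conjC_eq0 emb_norm E.
by rewrite rmorph0.
Qed.

Lemma zdvdP g p : g != (0, 0)%zz ->
  reflect (exists q, emb p = emb g * emb q) (zdvd t n g p).
Proof.
move=> g0; have g0' : emb g != 0.
  by apply: contraNneq g0 => /emb_eq0->.
have N0 : znorm t n g <> 0%zz by move=> /znorm_eq0 Eg; rewrite Eg eqxx in g0.
have cg : (emb g)^* != 0 by rewrite conjC_eq0.
have M p' q : emb p' = emb g * emb q <->
    zmul t n p' (zconj t g) = ((znorm t n g * q.1), (znorm t n g * q.2))%zz.
  split=> [E|E].
    apply: emb_inj; rewrite embM E -emb_conj -mulrA [_ * _^*]mulrC mulrA emb_norm.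
    by rewrite /emb /= !zCM; ring.
  apply: (mulIf cg); rewrite emb_conj -(embM p') E -emb_conj mulrAC emb_norm.
  by rewrite /emb /= !zCM; ring.
rewrite /zdvd; apply: (iffP idP).
  case/andP=> /Z.eqb_spec E1 /Z.eqb_spec E2.
  exists ((zmul t n p (zconj t g)).1 / znorm t n g, (zmul t n p (zconj t g)).2 / znorm t n g)%zz.
  apply/M; case: (zmul _ _ _ _) E1 E2 => x y /= E1 E2.
  by congr pair; [rewrite {1}(Z.div_mod x _ N0) E1|rewrite {1}(Z.div_mod y _ N0) E2]; lia.
case=> q /M ->; apply/andP; split; apply/Z.eqb_spec; rewrite /= Z.mul_comm; exact: Z.mod_mul.
Qed.

End Quad.

Lemma Zeven_odd_rem (x : Z) : exists q r, x = (2 * q + r)%zz /\ (r = 0 \/ r = 1)%zz.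
Proof.
exists (x / 2)%zz, (x mod 2)%zz.
have := Z.div_mod x 2; have := Z.mod_pos_bound x 2; lia.
Qed.

Section Integers.
Variable C : numClosedFieldType.
Notation zint := (integralOver (intr : int -> C)).

Lemma zint_int (k : int) : zint k%:~R.
Proof. exact: (@integral_id _ _ (intr : {rmorphism int -> C})). Qed.

Lemma zint_conj z : zint z -> zint z^*.
Proof.
case=> p pm pz; exists p => //.
have -> : map_poly (intr : int -> C) p = map_poly Num.conj (map_poly intr p).
  by rewrite -map_poly_comp; apply: eq_map_poly => x /=; rewrite rmorph_int.
by rewrite /root horner_map (eqP pz) /= rmorph0.
Qed.

(** Gauss's lemma: X - q is a rational multiple of an integer polynomial dividing p. Since p is
    monic, that polynomial has leading coefficient 1 or -1. *)
Lemma zint_ratr q : zint (ratr q) -> exists k : int, q = k%:~R.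
Proof.
case=> p pm pz.
have {pz} : root (map_poly (intr : int -> rat) p) q.
  rewrite -(fmorph_root (ratr : rat -> C)) -map_poly_comp.
  by rewrite (eq_map_poly (g := intr)) // => x /=; rewrite ratr_int.
rewrite -dvdp_XsubCl => /dvdpP_rat_int[p1 [a a0 E] [r Er]].
have lr : lead_coef p1 * lead_coef r = 1 by rewrite -lead_coefM -Er (monicP pm).
have : lead_coef ('X - q%:P) = 1 by rewrite lead_coefXsubC.
rewrite E lead_coefZ lead_coef_map_inj //; last exact: intr_inj.
have [l1|l1] : lead_coef p1 = 1 \/ lead_coef p1 = -1.
- have : lead_coef p1 \is a GRing.unit by apply/unitrPr; exists (lead_coef r).
  by case/pred2P; auto.
- rewrite l1 mulr1 => a1; exists (- p1`_0).
  have := congr1 (fun f : {poly rat} => f`_0) E.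
  rewrite a1 scale1r coef_map coefB coefX coefC /= sub0r => Eq.
  by rewrite rmorphN /= -Eq opprK.
rewrite l1 mulrN1 => /eqP; rewrite eqr_oppLR => /eqP a1; exists (p1`_0).
have := congr1 (fun f : {poly rat} => f`_0) E.
by rewrite a1 scaleN1r coefN coef_map coefB coefX coefC /= sub0r => /oppr_inj.
Qed.

Lemma ratr_conj q : (ratr q : C)^* = ratr q.
Proof. by rewrite /ratr fmorph_div !rmorph_int. Qed.

Definition sqfree (d : nat) := forall k, (k ^ 2 %| d)%N -> k = 1%N.

(** If y = a / b in lowest terms, then b^2 divides d. *)
Lemma sqfree_rat d (y : rat) (m : int) : sqfree d ->
  d%:R * y ^+ 2 = m%:~R -> exists k : int, y = k%:~R.
Proof.
move=> sd; case: (ratP y) => a b cab E.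
suff -> : b = 0%N by exists a; rewrite divr1.
have b0 : (b.+1)%:R != 0 :> rat by rewrite pnatr_eq0.
have {E} : (d%:Z * a ^+ 2 = m * (b.+1%:Z) ^+ 2)%R.
  apply: (@intr_inj rat); rewrite !rmorphM /= -E -!pmulrn; field.
  by rewrite nat1r.
move/(congr1 absz); rewrite !expr2 !abszM /= !mulnn => E.
apply/eqP; rewrite -eqSS; apply/eqP/sd.
have : (b.+1 ^ 2 %| d * `|a| ^ 2)%N by rewrite E dvdn_mull.
by rewrite Gauss_dvdl // coprimeXl // coprimeXr // coprime_sym.
Qed.

Variables (d : nat) (t n : Z).
Hypothesis (qd : quad d t n) (sd : sqfree d).

Lemma zint_omega : zint (omega C d).
Proof.
exists ('X^2 - (int_of_Z t)%:P * 'X + (int_of_Z n)%:P).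
  rewrite monicE -addrA lead_coefDl ?lead_coefXn // size_polyXn ltnS.
  rewrite (leq_trans (size_polyD _ _)) // geq_max size_polyN.
  rewrite (leq_trans (size_polyC_leq1 _)) // andbT.
  rewrite (leq_trans (size_polyMleq _ _)) // size_polyX addn2 /=.
  by rewrite ltnS size_polyC_leq1.
rewrite /root rmorphD rmorphB /= map_polyXn rmorphM /= map_polyX !map_polyC /=.
rewrite !hornerE; have := omega2 C qd; rewrite /zC expr2 => ->.
by apply/eqP; ring.
Qed.

Lemma zint_emb p : zint (emb C d p).
Proof.
apply: integral_add; first exact: zint_int.
by apply: integral_mul; [exact: zint_int | exact: zint_omega].
Qed.

Lemma omega_field : exists a b : rat, omega C d = ratr a + ratr b * tau C d.
Proof.
rewrite /omega; case: ifP => _.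
  exists (1/2%:R), (1/2%:R); rewrite fmorph_div rmorph1 rmorph_nat.
  by ring.
by exists 0, 1; rewrite rmorph0 rmorph1 add0r mul1r.
Qed.

(** For an integral z = a + b tau, the trace 2a and the norm a^2 + d b^2 are rational and integral,
    hence integers. Then d (2b)^2 is an integer, and squarefreeness makes 2b one. Parities modulo 4
    decide whether half-integers can occur. *)
Lemma ring_of_integersP z :
  ring_of_integers d z <-> exists p, z = emb C d p.
Proof.
split=> [[[a [b Ez]] iz]|[p ->]]; last first.
  split; last exact: zint_emb.
  have [a [b E]] := omega_field.
  exists ((int_of_Z p.1)%:~R + (int_of_Z p.2)%:~R * a), ((int_of_Z p.2)%:~R * b).
  by rewrite /emb E !rmorphD !rmorphM /= !ratr_int -/(tau C d) /zC; ring.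
have Ecz : z^* = ratr a - ratr b * tau C d.
  by rewrite Ez -/(tau C d) rmorphD /= ratr_conj (rmorphM _ (ratr b)) /= ratr_conj tau_conj mulrN.
have icz := zint_conj iz.
have [A EA] : exists k : int, 2%:R * a = k%:~R.
  apply: zint_ratr; have := integral_add iz icz; rewrite Ecz Ez.
  by congr (zint _); rewrite rmorphM rmorph_nat /= /tau; ring.
have [N EN] : exists k : int, a ^+ 2 + d%:R * b ^+ 2 = k%:~R.
  apply: zint_ratr; have := integral_mul iz icz; rewrite Ecz Ez -/(tau C d).
  congr (zint _); rewrite rmorphD rmorphM !rmorphXn rmorph_nat /=.
  by have T := tau2 C d; ring: T.
have [B EB] : exists k : int, 2%:R * b = k%:~R.
  apply: (sqfree_rat (m := 4 * N - A * A) sd).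
  by rewrite rmorphB !rmorphM /= -EN -EA; ring.
have EAB : A * A + d%:Z * (B * B) = 4 * N.
  apply: (@intr_inj rat); rewrite rmorphD !rmorphM /= -EN -EA -EB -pmulrn.
  by ring.
have n2 : 2%:R != 0 :> C by rewrite pnatr_eq0.
have Ez2 : 2%:R * z = A%:~R + B%:~R * tau C d.
  have EAC : A%:~R = 2%:R * ratr a :> C by rewrite -ratr_int -EA rmorphM rmorph_nat.
  have EBC : B%:~R = 2%:R * ratr b :> C by rewrite -ratr_int -EB rmorphM rmorph_nat.
  by rewrite Ez EAC EBC -/(tau C d); ring.
(* Read A^2 + d B^2 = 4 N modulo 4: for d = 3 modulo 4 the parities of A and B agree; otherwise both
   are even. *)
have [k Ek] : exists k : Z * Z, (2 * k.1 + t * k.2 = Z_of_int A)%zz /\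
    (k.2 * (2 - t) = Z_of_int B)%zz.
  have sd4 : ~~ (4 %| d)%N by apply/negP => /(@sd 2).
  have Hd : (Z_of_int A * Z_of_int A + Z.of_nat d * (Z_of_int B * Z_of_int B)
    = 4 * Z_of_int N)%zz by move: EAB; lia.
  have [mA rA] : exists q r, (Z_of_int A = 2 * q + r)%zz /\ (r = 0 \/ r = 1)%zz.
    exact: Zeven_odd_rem.
  have [mB rB] : exists q r, (Z_of_int B = 2 * q + r)%zz /\ (r = 0 \/ r = 1)%zz.
    exact: Zeven_odd_rem.
  case: rA => rA [EA' HA]; case: rB => rB [EB' HB].
  have [e r4] : exists e r, (Z.of_nat d = 4 * e + r)%zz /\ (r = Z.of_nat (d %% 4)%N)%zz.
    by exists (Z.of_nat (d %/ 4)%N), (Z.of_nat (d %% 4)%N); lia.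
  case: r4 => r [Ed Er].
  have r3 : (r = 1 \/ r = 2 \/ r = 3)%zz by lia.
  have Hm : exists x, ((rA * rA + r * (rB * rB)) = 4 * x)%zz.
    exists (Z_of_int N - mA * mA - mA * rA - e * (4 * mB * mB + 4 * mB * rB + rB * rB) - r * (mB * mB + mB * rB))%zz.
    by move: Hd; rewrite EA' EB' Ed; lia.
  case: Hm => x Hm.
  have [] := qd; case: ifP => d3 [Et En] _; rewrite Et /=.
    have : rA = rB by case: HA HB r3 Hm => -> [] -> [->|[->|->]]; lia.
    by move=> Er'; exists (mA - mB, 2 * mB + rB)%zz; split=> /=; lia.
  have r12 : (r = 1 \/ r = 2)%zz by lia.
  have : rA = 0%zz /\ rB = 0%zz by case: HA HB r12 Hm => -> [] -> [->|->]; lia.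
  by case=> rA0 rB0; exists (mA, mB); split=> /=; lia.
exists k; apply: (mulfI n2); rewrite Ez2 /emb.
have -> : 2%:R * (zC C k.1 + zC C k.2 * omega C d) =
  2%:R * zC C k.1 + zC C k.2 * (2%:R * omega C d) by ring.
rewrite (omega_tau C qd).
case: Ek => EkA EkB; rewrite -!zC_int -EkA -EkB zCD !zCM.
by have -> : zC C 2 = 2%:R by []; ring.
Qed.
End Integers.

(** * Integral matrices *)

Definition m3_at T (M : m3 T) (k : nat) : T :=
  let: M3 a b c d e g h i j := M in nth a [:: a; b; c; d; e; g; h; i; j] k.

Section MatrixOfTuple.
Variables (T : Type) (R : comNzRingType) (f : T -> R).

Definition mxm (M : m3 T) : 'M[R]_3 := \matrix_(i, j) f (m3_at M (3 * i + j)%N).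

Variables (add mul : T -> T -> T) (neg : T -> T).
Hypotheses (fD : forall x y, f (add x y) = f x + f y)
  (fM : forall x y, f (mul x y) = f x * f y) (fN : forall x, f (neg x) = - f x).

Lemma mx3P (A B : 'M[R]_3) : 
  [/\ A 0 0 = B 0 0, A 0 1 = B 0 1 & A 0 2%:R = B 0 2%:R] ->
  [/\ A 1 0 = B 1 0, A 1 1 = B 1 1 & A 1 2%:R = B 1 2%:R] ->
  [/\ A 2%:R 0 = B 2%:R 0, A 2%:R 1 = B 2%:R 1 & A 2%:R 2%:R = B 2%:R 2%:R] ->
  A = B.
Proof.
move=> [a b c] [e g h] [k l m]; apply/matrixP => i j.
have ord3 (x : 'I_3) : [\/ x = 0, x = 1 | x = 2%:R].
  by case: x => [[|[|[|]]]] // ?; [apply: Or31|apply: Or32|apply: Or33]; apply: val_inj.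
by case: (ord3 i) => ->; case: (ord3 j) => ->.
Qed.

Lemma mxm_mul M N : mxm (m3_mul add mul M N) = mxm M *m mxm N.
Proof.
case: M => a b c d e g h i j; case: N => a' b' c' d' e' g' h' i' j'.
apply/mx3P; split; rewrite !mxE !big_ord_recl big_ord0 !mxE /= !fD !fM;
  by rewrite addr0 addrA.
Qed.

Lemma mxm_scal z x : f z = 0 -> mxm (m3_scal z x) = (f x)%:M.
Proof. by move=> fz; apply/mx3P; split; rewrite !mxE /= ?fz ?mulr1n ?mulr0n. Qed.

Lemma det_mx3 (A : 'M[R]_3) : \det A =
  A 0 0 * (A 1 1 * A 2%:R 2%:R - A 1 2%:R * A 2%:R 1)
  - A 0 1 * (A 1 0 * A 2%:R 2%:R - A 1 2%:R * A 2%:R 0)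
  + A 0 2%:R * (A 1 0 * A 2%:R 1 - A 1 1 * A 2%:R 0).
Proof.
rewrite (expand_det_row _ 0) !big_ord_recl big_ord0 /cofactor.
rewrite !(expand_det_row _ 0) !big_ord_recl !big_ord0 /cofactor !det_mx11 !mxE /=.
have E0 : lift (0 : 'I_3) (0 : 'I_2) = 1 by apply: val_inj.
have E1 : lift (0 : 'I_3) (lift (0 : 'I_2) (0 : 'I_1)) = 2%:R by apply: val_inj.
have E2 : lift (1 : 'I_3) (0 : 'I_2) = 0 by apply: val_inj.
have E3 : lift (1 : 'I_3) (lift (0 : 'I_2) (0 : 'I_1)) = 2%:R by apply: val_inj.
have E4 : lift (2%:R : 'I_3) (0 : 'I_2) = 0 by apply: val_inj.
have E5 : lift (2%:R : 'I_3) (lift (0 : 'I_2) (0 : 'I_1)) = 1 by apply: val_inj.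
have E6 : lift (lift (0 : 'I_2) (0 : 'I_1)) (0 : 'I_1) = 0 by apply: val_inj.
rewrite !E6 !E0 !E1 !E2 !E3 !E4 !E5 /= /bump /= !add0n !addn0 !expr0 !expr1.
rewrite !mulN1r !mul1r !addr0; ring.
Qed.

Lemma mxm_det M : f (m3_det add mul neg M) = \det (mxm M).
Proof.
case: M => a b c d e g h i j; rewrite det_mx3 !mxE /m3_det /m3_minor /=.
by rewrite !(fD, fM, fN).
Qed.

End MatrixOfTuple.

Lemma mxm_inj T (R : comNzRingType) (f : T -> R) : injective f -> injective (mxm f).
Proof.
move=> fI [a b c d e g h i j] [a' b' c' d' e' g' h' i' j'] E.
have H x y := congr1 (fun A : 'M_3 => A x y) E.
move: (H 0 0) (H 0 1) (H 0 2%:R) (H 1 0) (H 1 1) (H 1 2%:R) (H 2%:R 0) (H 2%:R 1)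
  (H 2%:R 2%:R); rewrite !mxE /=.
by do 9![move/fI=> ->].
Qed.

Section Integral.
Variables (C : numClosedFieldType) (d : nat) (t n : Z).
Hypothesis (qd : quad d t n).
Local Notation emb := (emb C d).
Local Notation mx := (mxm emb).
Local Notation M3mul := (m3_mul zadd (zmul t n)).
Local Notation M3adj := (m3_adj (zconj t)).
Local Notation M3det := (m3_det zadd (zmul t n) zneg).
Local Notation M31 := (m3_scal (0, 0)%zz (1, 0)%zz).

Lemma emb0 : emb (0, 0)%zz = 0. Proof. by rewrite emb_zC rmorph0. Qed.
Lemma emb1 : emb (1, 0)%zz = 1. Proof. by rewrite emb_zC rmorph1. Qed.

Lemma mxM M N : mx (M3mul M N) = mx M *m mx N.
Proof. by apply: mxm_mul; [exact: embD | exact: (@embM C d t n qd)]. Qed.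
Lemma mx1 : mx M31 = 1%:M.
Proof. by rewrite mxm_scal ?emb0 // emb1. Qed.
Lemma mxdet M : emb (M3det M) = \det (mx M).
Proof. by apply: mxm_det; [exact: embD | exact: (@embM C d t n qd) | exact: embN]. Qed.
Lemma mx_inj : injective mx.
Proof. exact: mxm_inj (emb_inj (C := C) qd). Qed.

Lemma JJ : J C *m J C = 1%:M.
Proof.
apply/mx3P; split; rewrite !mxE !big_ord_recl big_ord0 !mxE /=;
  by rewrite ?mulr0 ?mul0r ?mulr1 ?addr0 ?add0r.
Qed.

Lemma mxadj M : mx (M3adj M) = J C *m (mx M)^t* *m J C.
Proof.
case: M => a b c e g h i j k; apply/mx3P; split;
  rewrite !mxE !big_ord_recl big_ord0 !mxE !big_ord_recl !big_ord0 !mxE /=;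
  by rewrite ?mulr0 ?mul0r ?mulr1 ?mul1r ?addr0 ?add0r -(emb_conj C qd).
Qed.

Lemma unitaryJ_adj (A : 'M[C]_3) :
  unitaryJ A = (J C *m A^t* *m J C *m A == 1%:M).
Proof.
apply/andP/eqP=> [[uA /eqP E]|E].
  by rewrite -(mulmxA (J C)) -(mulmxA (J C)) E JJ.
split; first by case: (mulmx1_unit E).
by apply/eqP; rewrite -[LHS]mul1mx -[in LHS]JJ -!mulmxA [X in _ *m X]mulmxA
  [X in _ *m X]mulmxA E mulmx1.
Qed.

Lemma mx_unitary M : unitaryJ (mx M) -> M3mul (M3adj M) M = M31.
Proof.
move=> uM; apply: mx_inj; rewrite mxM mx1 mxadj; apply/eqP.
by rewrite -unitaryJ_adj.
Qed.

Lemma mx_unitaryP M : M3mul (M3adj M) M = M31 -> unitaryJ (mx M).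
Proof. by move=> E; rewrite unitaryJ_adj -mxadj -mxM E mx1. Qed.

End Integral.

(** * Normalised lifts *)

Section Lifts.
Variables (C : numClosedFieldType) (d : nat) (t n : Z) (us : seq (Z * Z)).
Hypothesis (qd : quad d t n) (sd : sqfree d).
Hypothesis unitsP : forall u, znorm t n u = 1%zz -> u \in us.
Hypothesis units12 : forall u, u \in us -> emb C d u ^+ 12 = 1.
Local Notation emb := (emb C d).
Local Notation mx := (mxm emb).
Local Notation M3mul := (m3_mul zadd (zmul t n)).
Local Notation M3adj := (m3_adj (zconj t)).
Local Notation M3det := (m3_det zadd (zmul t n) zneg).
Local Notation M31 := (m3_scal (0, 0)%zz (1, 0)%zz).
Local Notation pi := (\pi_(PU C)).
Local Notation adjK := (mxadj C qd).

(* The units of the ring of integers have order dividing 12, so multiplying a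
   matrix by its own determinant makes the cube of its determinant trivial. *)
Definition isG (M : m3 (Z * Z)) : bool :=
  (m3_seq (M3mul (M3adj M) M) == m3_seq M31) &&
  (zmul t n (M3det M) (zmul t n (M3det M) (M3det M)) == (1, 0)%zz).

Definition lifts (M : m3 (Z * Z)) (g : PU C) : Prop :=
  exists2 A : U C, pi A = g & U_val A = mx M.

Lemma m3_seq_inj T : injective (@m3_seq T).
Proof. by case=> a b c e g h i j k [] a' b' c' e' g' h' i' j' k' [] /=; do 9![move=> ->]. Qed.

Lemma isGP M : reflect (M3mul (M3adj M) M = M31 /\ \det (mx M) ^+ 3 = 1) (isG M).
Proof.
apply: (iffP andP) => [[/eqP/m3_seq_inj-> /eqP E]|[-> E]]; split=> //.
  by rewrite -(mxdet C qd) !exprS expr0 mulr1 -!(embM C qd) E emb1.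
apply/eqP/(emb_inj (C := C) qd); rewrite !(embM C qd) emb1 -E (mxdet C qd).
by rewrite !exprS expr0 mulr1.
Qed.

Lemma pi_mul (A B : U C) : pi (A * B)%g = (pi A * pi B)%g.
Proof. by rewrite -[RHS]/(PU_mul _ _) pi_PU_mul. Qed.
Lemma pi_inv (A : U C) : pi A^-1%g = (pi A)^-1%g.
Proof. by rewrite -[RHS]/(PU_inv _) pi_PU_inv. Qed.

Lemma adj_mx M : M3mul (M3adj M) M = M31 -> mx (M3adj M) *m mx M = 1%:M.
Proof. by move=> E; rewrite -(mxM C qd) E mx1. Qed.
Lemma mx_adj M : M3mul (M3adj M) M = M31 -> mx M *m mx (M3adj M) = 1%:M.
Proof. by move/adj_mx/mulmx1C. Qed.

Lemma isG1 : isG M31.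
Proof.
apply/isGP; rewrite mx1 det1 expr1n; split=> //.
by apply: (mx_inj (C := C) qd); rewrite (mxM C qd) adjK mx1 trmx1 map_mx1 !mulmx1 JJ.
Qed.

Lemma adjM M N : M3adj (M3mul M N) = M3mul (M3adj N) (M3adj M).
Proof.
apply: (mx_inj (C := C) qd); rewrite (mxM C qd) !adjK (mxM C qd) trmx_mul map_mxM /=.
by rewrite -!mulmxA [X in _ = _ *m (_ *m X)]mulmxA JJ mul1mx.
Qed.

Lemma mulA M N P : M3mul M (M3mul N P) = M3mul (M3mul M N) P.
Proof. by apply: (mx_inj (C := C) qd); rewrite !(mxM C qd) mulmxA. Qed.
Lemma mul1M M : M3mul M31 M = M.
Proof. by apply: (mx_inj (C := C) qd); rewrite !(mxM C qd) mx1 mul1mx. Qed.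
Lemma mulM1 M : M3mul M M31 = M.
Proof. by apply: (mx_inj (C := C) qd); rewrite !(mxM C qd) mx1 mulmx1. Qed.

Lemma isGM M N : isG M -> isG N -> isG (M3mul M N).
Proof.
move=> /isGP[uM dM] /isGP[uN dN]; apply/isGP; split.
  by rewrite adjM -mulA [X in M3mul _ X]mulA uM mul1M.
by rewrite (mxM C qd) det_mulmx exprMn dM dN mulr1.
Qed.

Lemma isGV M : isG M -> isG (M3adj M).
Proof.
move=> /isGP[uM dM]; apply/isGP; split.
  have -> : M3adj (M3adj M) = M.
    have zK p : zconj t (zconj t p) = p.
      by case: p => a b; rewrite /zconj /=; congr pair; lia.
    by case: (M) => a b c e g h i j k; rewrite /= !zK.
  by apply: (mx_inj (C := C) qd); rewrite (mxM C qd) mx1 mx_adj.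
have := congr1 (fun A => \det A ^+ 3) (mx_adj uM).
by rewrite det_mulmx det1 exprMn dM mul1r expr1n.
Qed.

Lemma lifts_ex M : isG M -> exists g, lifts M g.
Proof.
move=> /isGP[uM _]; pose A := MkU (mx_unitaryP C qd uM).
by exists (pi A), A.
Qed.

Lemma lifts_inj M g g' : lifts M g -> lifts M g' -> g = g'.
Proof.
move=> [A <- EA] [B <- EB]; congr (pi _).
by apply: val_inj; rewrite /= EA EB.
Qed.

Lemma lifts1 : lifts M31 1%g.
Proof. by exists 1%g; rewrite ?mx1. Qed.

Lemma liftsM M N g h : lifts M g -> lifts N h -> lifts (M3mul M N) (g * h)%g.
Proof.
move=> [A <- EA] [B <- EB]; exists (A * B)%g; first by rewrite pi_mul.
by rewrite (mxM C qd) -EA -EB.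
Qed.

Lemma liftsV M g : isG M -> lifts M g -> lifts (M3adj M) g^-1%g.
Proof.
move=> /isGP[uM _] [A <- EA]; exists A^-1%g; first by rewrite pi_inv.
have := adj_mx uM; rewrite -EA => E; change (invmx A = mx (M3adj M)).
by rewrite -[RHS]mulmx1 -(mulmxV (U_unit A)) mulmxA E mul1mx.
Qed.

Definition m3_smul (u : Z * Z) (M : m3 (Z * Z)) := m3_map (zmul t n u) M.

Lemma mx_smul u M : mx (m3_smul u M) = emb u *: mx M.
Proof. by case: M => a b c e g h i j k; apply/mx3P; split; rewrite !mxE /= (embM C qd). Qed.

Lemma adjmxZ p q (u : C) (A : 'M[C]_(p, q)) : (u *: A)^t* = u^* *: A^t*.
Proof. by apply/matrixP => i j; rewrite !mxE rmorphM. Qed.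

Lemma int_entries (A : 'M[C]_3) : mx_over (ring_of_integers d) A -> exists M, A = mx M.
Proof.
move=> iA; have H i j := (ring_of_integersP qd sd (A i j)).1 (iA i j).
have [a0 E0] := H 0 0; have [a1 E1] := H 0 1; have [a2 E2] := H 0 2%:R.
have [b0 F0] := H 1 0; have [b1 F1] := H 1 1; have [b2 F2] := H 1 2%:R.
have [c0 G0] := H 2%:R 0; have [c1 G1] := H 2%:R 1; have [c2 G2] := H 2%:R 2%:R.
by exists (M3 a0 a1 a2 b0 b1 b2 c0 c1 c2); apply/mx3P; split; rewrite mxE.
Qed.

Lemma mx_int M : mx_over (ring_of_integers d) (mx M).
Proof. by move=> i j; apply/(ring_of_integersP qd sd); rewrite mxE; eexists. Qed.

Lemma det_norm M : M3mul (M3adj M) M = M31 -> znorm t n (M3det M) = 1%zz.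
Proof.
move=> uM; apply: (zC_inj (C := C)); rewrite rmorph1 -(emb_norm C qd) (mxdet C qd).
have := congr1 determinant (adj_mx uM); rewrite adjK !det_mulmx det1 => <-.
rewrite det_map_mx det_tr /=.
have dJ : \det (J C) * \det (J C) = 1 by rewrite -det_mulmx JJ det1.
by rewrite -mulrA mulrACA dJ mul1r mulrC.
Qed.

Lemma smul_unitary u M : znorm t n u = 1%zz -> M3mul (M3adj M) M = M31 ->
  M3mul (M3adj (m3_smul u M)) (m3_smul u M) = M31.
Proof.
move=> nu uM; have eu : emb u * (emb u)^* = 1 by rewrite (emb_norm C qd) nu rmorph1.
apply: (mx_inj (C := C) qd); rewrite (mxM C qd) adjK mx_smul mx1 adjmxZ.
rewrite -!(scalemxAl, scalemxAr) scalerA eu scale1r.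
by rewrite -adjK adj_mx.
Qed.

(** If u is the determinant of an integral lift M, then u M has determinant u^4, whose cube is u^12
    = 1. Conversely the inverse of a matrix satisfying [isG] is its J-adjoint, hence integral. *)
Lemma GammaP g : Gamma d g <-> exists2 M, isG M & lifts M g.
Proof.
split=> [[A /= [uA iA iA'] <-]|[M gM [A <- EA]]]; last first.
  exists A => //=; have /isGP[uM _] := gM; split; first exact: U_unit.
    by rewrite EA; apply: mx_int.
  suff -> : invmx A = mx (M3adj M) by apply: mx_int.
  have := adj_mx uM; rewrite -EA => E.
  by rewrite -[RHS]mulmx1 -(mulmxV (U_unit A)) mulmxA E mul1mx.
have [M EM] := int_entries iA.
have uM : M3mul (M3adj M) M = M31.
  by apply: (mx_unitary (C := C) qd); rewrite -EM; apply: (valP A).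
have d12 := units12 (unitsP (det_norm uM)).
have nd := det_norm uM; set u := M3det M in d12 nd.
have nu : emb u * (emb u)^* = 1 by rewrite (emb_norm C qd) nd rmorph1.
have gM' : isG (m3_smul u M).
  apply/isGP; split; first exact: smul_unitary.
  by rewrite mx_smul detZ -(mxdet C qd) -exprSr -exprM.
have [_ [B _ EB]] := lifts_ex gM'; exists (m3_smul u M) => //; exists B => //.
apply/eqmodP/proportionalP; exists (emb u).
  by apply/eqP => u0; move: nu; rewrite u0 mul0r => /eqP; rewrite eq_sym oner_eq0.
by rewrite EB mx_smul -EM.
Qed.

(** Two lifts differ by a unit u. Cubes of determinants give u^9 = 1, and u^12 = 1 holds for every
    unit, so u^3 = 1. *)
Lemma lifts_unit M M' g : isG M -> isG M' -> lifts M g -> lifts M' g ->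
  exists u, [/\ M' = m3_smul u M, znorm t n u = 1%zz & emb u ^+ 3 = 1].
Proof.
move=> /isGP[uM dM] /isGP[uM' dM'] [A <- EA] [B EBA EB].
move/eqmodP/proportionalP: EBA => [c c0 Ec]; rewrite EA EB in Ec.
have Ec1 : mx (M3mul M' (M3adj M)) = c%:M.
  by rewrite (mxM C qd) Ec -scalemxAl mx_adj // scalemx1.
have [u Eu] : exists u, c = emb u.
  exists (m3_at (M3mul M' (M3adj M)) 0%N).
  by have := congr1 (fun A : 'M_3 => A 0 0) Ec1; rewrite !mxE /= mulr1n.
rewrite {}Eu in c0 Ec {Ec1}.
have EM : M' = m3_smul u M by apply: (mx_inj (C := C) qd); rewrite mx_smul.
have u9 : emb u ^+ 9 = 1.
  have := dM'; rewrite Ec detZ exprMn dM mulr1 -exprM => <- //.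
have nu : znorm t n u = 1%zz.
  apply: (zC_inj (C := C)); rewrite rmorph1 -(emb_norm C qd).
  have := adj_mx uM'; rewrite adjK Ec adjmxZ.
  rewrite -!(scalemxAl, scalemxAr) scalerA -adjK adj_mx // => E.
  by have := congr1 (fun A : 'M_3 => A 0 0) E; rewrite !mxE /= mulr1.
exists u; split=> //; have := units12 (unitsP nu).
by rewrite (_ : 12 = 9 + 3)%N // exprD u9 mul1r.
Qed.

Definition mpow (M : m3 (Z * Z)) k := iter k (M3mul M) M31.

Lemma mx_mpow M k : mx (mpow M k) = mx M ^+ k.
Proof. by elim: k => [|k IH]; rewrite ?mx1 // [mpow _ _]/= (mxM C qd) IH exprS. Qed.
Lemma lifts_mpow M x k : lifts M x -> lifts (mpow M k) (x ^+ k)%g.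
Proof.
move=> lM; elim: k => [|k IH]; first exact: lifts1.
by rewrite expgS; apply: liftsM.
Qed.
Lemma isG_mpow M k : isG M -> isG (mpow M k).
Proof. by move=> gM; elim: k => [|k IH]; [exact: isG1|apply: isGM]. Qed.

End Lifts.

(** * Residue rings *)

Definition ztr (t : Z) (p : Z * Z) : Z := (2 * p.1 + t * p.2)%zz.

(** Closure of the addition and negation tables, with the residue of w, makes [rep] a complete
    system of residues; that each representative is its own residue makes it irredundant. The last
    line ensures that m divides N(g) and the trace of every multiple of g. *)
Definition level_ok (L : level) : bool :=
  let: Level t n g pi m rep tadd tmul tneg tconj ttr tnorm tbits := L in
  let r := residue t n g rep in let s := size rep in
  [&& g != (0, 0)%zz, pi != (0, 0)%zz & zdvd t n pi g] &&
  [&& nth (0, 0)%zz rep 0 == (0, 0)%zz, nth (0, 0)%zz rep 1 == (1, 0)%zz & (1 < s <= 16)%N] &&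
  [&& all (fun i => r (nth (0, 0)%zz rep i) == i) (iota 0 s),
      all (all (fun i => i < s)%N) tadd, all (fun i => i < s)%N tneg & (r (0, 1)%zz < s)%N] &&
  [&& tadd == mk_add t n g rep, tmul == mk_mul t n g rep, tneg == mk_neg t n g rep
    & tconj == mk_conj t n g rep] &&
  [&& ttr == mk_tr t n rep m, tnorm == mk_norm t n rep m
    & tbits == [seq bits4 i | i <- iota 0 s]] &&
  [&& (0 <? m)%zz, (ztr t g mod m =? 0)%zz, (ztr t (zmul t n g (0, 1)) mod m =? 0)%zz
    & (znorm t n g mod m =? 0)%zz].

Lemma pair_closure (P : Z * Z -> Prop) :
  P (0, 0)%zz -> P (1, 0)%zz -> P (0, 1)%zz ->
  (forall p q, P p -> P q -> P (zadd p q)) -> (forall p, P p -> P (zneg p)) ->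
  forall p, P p.
Proof.
move=> P0 P1 Pw PD PN.
have Pn p : P p -> forall k : nat, P ((Z.of_nat k * p.1), (Z.of_nat k * p.2))%zz.
  move=> Pp; elim=> [|k IH]; first by rewrite !Z.mul_0_l.
  by have := PD _ _ Pp IH; congr P; rewrite /zadd /=; congr pair; lia.
have PZ p : P p -> forall k, P ((k * p.1), (k * p.2))%zz.
  move=> Pp k; case: (Z.leb_spec 0 k) => hk.
    by have := Pn _ Pp (Z.to_nat k); rewrite Z2Nat.id.
  have := PN _ (Pn _ Pp (Z.to_nat (- k)%zz)); congr P; rewrite /zneg /=.
  by congr pair; rewrite Z2Nat.id; lia.
case=> a b; have := PD _ _ (PZ _ P1 a) (PZ _ Pw b); congr P.
by rewrite /zadd /=; congr pair; lia.
Qed.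

Section Residues.
Variables (C : numClosedFieldType) (d : nat) (L : level).
Local Notation t := (lv_t L).
Local Notation n := (lv_n L).
Local Notation g := (lv_gam L).
Local Notation rep := (lv_rep L).
Local Notation emb := (emb C d).
Hypothesis (qd : quad d t n) (Lok : level_ok L).
Local Notation repn := (nth (0, 0)%zz rep).
Local Notation res := (rres L).

Definition cong (p q : Z * Z) : bool := zdvd t n g (zadd p (zneg q)).

Lemma gam_neq0 : g != (0, 0)%zz.
Proof. by move: Lok; case: (L) => ? ? ? ? ? ? ? ? ? ? ? ? ? /= /andP[/andP[/andP[/andP[/andP[/and3P[]]]]]]. Qed.

Lemma congP p q : reflect (exists x, emb p = emb q + emb g * emb x) (cong p q).
Proof.
apply: (iffP (zdvdP C qd _ gam_neq0)) => -[x]; rewrite embD embN => E; exists x.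
  by rewrite -E addrC subrK.
by rewrite E addrC addKr.
Qed.

Lemma congE p q : cong p q -> exists x, p = zadd q (zmul t n g x).
Proof.
by move/congP=> [x E]; exists x; apply: (emb_inj (C := C) qd); rewrite embD (embM C qd).
Qed.

Lemma cong_refl p : cong p p.
Proof. by apply/congP; exists (0, 0)%zz; rewrite emb0 mulr0 addr0. Qed.
Lemma cong_sym p q : cong p q = cong q p.
Proof.
by apply/congP/congP=> -[x E]; exists (zneg x); rewrite embN E; ring.
Qed.
Lemma cong_trans p q r : cong p q -> cong q r -> cong p r.
Proof.
move=> /congP[x E] /congP[y F]; apply/congP; exists (zadd x y).
by rewrite embD E F; ring.
Qed.
Lemma congD p q p' q' : cong p p' -> cong q q' -> cong (zadd p q) (zadd p' q').
Proof.
move=> /congP[x E] /congP[y F]; apply/congP; exists (zadd x y).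
by rewrite !embD E F; ring.
Qed.
Lemma congN p p' : cong p p' -> cong (zneg p) (zneg p').
Proof.
by move=> /congP[x E]; apply/congP; exists (zneg x); rewrite !embN E; ring.
Qed.
Lemma congM p q p' q' : cong p p' -> cong q q' -> cong (zmul t n p q) (zmul t n p' q').
Proof.
move=> /congP[x E] /congP[y F]; apply/congP.
exists (zadd (zadd (zmul t n x q') (zmul t n y p')) (zmul t n g (zmul t n x y))).
by rewrite !(embD, embM C qd) E F; ring.
Qed.

Lemma cong_residue p q : cong p q -> res p = res q.
Proof.
move=> pq; apply: eq_find => r; rewrite -!/(cong _ _).
by apply/idP/idP; apply: cong_trans; rewrite // cong_sym.
Qed.

Let okE := Lok.

Lemma rep0 : repn 0 = (0, 0)%zz.
Proof. by move: okE; case: (L) => ? ? ? ? ? ? ? ? ? ? ? ? ? /=; do 4![case/andP]; case/andP => _ /and3P[/eqP]. Qed.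
Lemma rep1 : repn 1 = (1, 0)%zz.
Proof. by move: okE; case: (L) => ? ? ? ? ? ? ? ? ? ? ? ? ? /=; do 4![case/andP]; case/andP => _ /and3P[_ /eqP]. Qed.
Lemma size_rep : (1 < size rep <= 16)%N.
Proof. by move: okE; case: (L) => ? ? ? ? ? ? ? ? ? ? ? ? ? /=; do 4![case/andP]; case/andP => _ /and3P[_ _]. Qed.

Lemma resK i : (i < size rep)%N -> res (repn i) = i.
Proof.
move=> li; have : all (fun i => res (repn i) == i) (iota 0 (size rep)).
  by move: okE; rewrite /rres; case: (L) => ? ? ? ? ? ? ? ? ? ? ? ? ? /=; do 3![case/andP]; case/andP => _ /and4P[].
by move/allP/(_ i); rewrite mem_iota /= add0n li => /(_ isT)/eqP.
Qed.

Lemma cong_rep p : (res p < size rep)%N -> cong p (repn (res p)).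
Proof. by rewrite -has_find => /(nth_find (0, 0)%zz). Qed.

Lemma tables : [/\ lv_tadd L = mk_add t n g rep, lv_tmul L = mk_mul t n g rep,
  lv_tneg L = mk_neg t n g rep & lv_tconj L = mk_conj t n g rep].
Proof.
move: okE; case: (L) => ? ? ? ? ? ? ? ? ? ? ? ? ? /=; do 2![case/andP]; case/andP => _.
by case/and4P=> /eqP-> /eqP-> /eqP-> /eqP->.
Qed.

Lemma raddE i j : (i < size rep)%N -> (j < size rep)%N ->
  radd L i j = res (zadd (repn i) (repn j)).
Proof.
move=> li lj; rewrite /radd; have [-> _ _ _] := tables.
by rewrite (nth_map (0, 0)%zz) // (nth_map (0, 0)%zz).
Qed.
Lemma rmulE i j : (i < size rep)%N -> (j < size rep)%N ->
  rmul L i j = res (zmul t n (repn i) (repn j)).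
Proof.
move=> li lj; rewrite /rmul; have [_ -> _ _] := tables.
by rewrite (nth_map (0, 0)%zz) // (nth_map (0, 0)%zz).
Qed.
Lemma rnegE i : (i < size rep)%N -> rneg L i = res (zneg (repn i)).
Proof.
by move=> li; rewrite /rneg; have [_ _ -> _] := tables; rewrite (nth_map (0, 0)%zz).
Qed.
Lemma rconjE i : (i < size rep)%N -> rconj L i = res (zconj t (repn i)).
Proof.
by move=> li; rewrite /rconj; have [_ _ _ ->] := tables; rewrite (nth_map (0, 0)%zz).
Qed.

(** The elements that have a representative form an additive group containing 1 and w. *)
Lemma res_lt p : (res p < size rep)%N.
Proof.
have [H1 H2 H3] : [/\ all (all (fun i => i < size rep)%N) (lv_tadd L),
    all (fun i => i < size rep)%N (lv_tneg L) & (res (0, 1)%zz < size rep)%N].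
  by move: okE; rewrite /rres; case: (L) => ? ? ? ? ? ? ? ? ? ? ? ? ? /=; do 3![case/andP]; case/andP => _ /and4P[].
have /andP[s1 _] := size_rep.
refine (@pair_closure (fun p => is_true (res p < size rep)%N) _ _ _ _ _ p) => [|||a b la lb|a la].
- by rewrite -rep0 resK // (ltn_trans _ s1).
- by rewrite -rep1 resK.
- exact: H3.
- rewrite (cong_residue (congD (cong_rep la) (cong_rep lb))) -raddE // /radd.
  move/allP: H1; have [E1 _ _ _] := tables.
  have s1' : (res a < size (lv_tadd L))%N by rewrite E1 size_map.
  move/(_ _ (mem_nth [::] s1'))/allP; apply; apply: mem_nth.
  by rewrite E1 (nth_map (0, 0)%zz) // size_map.
rewrite (cong_residue (congN (cong_rep la))) -rnegE // /rneg.
move/allP: H2; apply; apply: mem_nth; have [_ _ -> _] := tables.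
by rewrite size_map.
Qed.

Lemma res_cong p q : res p = res q -> cong p q.
Proof.
move=> E; have := cong_rep (res_lt p); rewrite E => pq.
by apply: cong_trans pq _; rewrite cong_sym cong_rep ?res_lt.
Qed.

Lemma res0 : res (0, 0)%zz = 0%N.
Proof. by rewrite -rep0 resK //; case/andP: size_rep => /ltnW. Qed.
Lemma res1 : res (1, 0)%zz = 1%N.
Proof. by rewrite -rep1 resK //; case/andP: size_rep. Qed.
Lemma resD p q : res (zadd p q) = radd L (res p) (res q).
Proof. by rewrite raddE ?res_lt //; apply/cong_residue/congD; apply/cong_rep/res_lt. Qed.
Lemma resM p q : res (zmul t n p q) = rmul L (res p) (res q).
Proof. by rewrite rmulE ?res_lt //; apply/cong_residue/congM; apply/cong_rep/res_lt. Qed.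
Lemma resN p : res (zneg p) = rneg L (res p).
Proof. by rewrite rnegE ?res_lt //; apply/cong_residue/congN/cong_rep/res_lt. Qed.
Hypothesis gamc : zdvd t n g (zconj t g).
(** The ideal generated by g is stable under conjugation because g divides its conjugate. *)
Lemma congJ p p' : cong p p' -> cong (zconj t p) (zconj t p').
Proof.
move=> /congP[x E]; apply/congP; have [y Ey] := zdvdP C qd _ gam_neq0 gamc.
exists (zmul t n y (zconj t x)).
by rewrite -!(emb_conj C qd) E rmorphD rmorphM /= !(emb_conj C qd) Ey (embM C qd); ring.
Qed.
Lemma resJ p : res (zconj t p) = rconj L (res p).
Proof. by rewrite rconjE ?res_lt //; apply/cong_residue/congJ/cong_rep/res_lt. Qed.

Local Notation code := (rcode L).
Local Notation M3mul := (m3_mul zadd (zmul t n)).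

Lemma codeM M N : code (M3mul M N) = rmm L (code M) (code N).
Proof.
case: M => a b c e h i j k l; case: N => a' b' c' e' h' i' j' k' l'.
by rewrite /rcode /rmm /= !resD !resM.
Qed.
Lemma code_adj M : code (m3_adj (zconj t) M) = m3_adj (rconj L) (code M).
Proof. by case: M => a b c e h i j k l; rewrite /rcode /= !resJ. Qed.
Lemma code_det M : res (m3_det zadd (zmul t n) zneg M) =
  m3_det (radd L) (rmul L) (rneg L) (code M).
Proof.
by case: M => a b c e h i j k l; rewrite /rcode /m3_det /m3_minor /= !(resD, resM, resN).
Qed.
Lemma code1 : code (m3_scal (0, 0)%zz (1, 0)%zz) = m3_scal 0%N 1%N.
Proof. by rewrite /rcode /= res0 res1. Qed.

Definition ranged (h : m3 nat) := all (fun i => i < size rep)%N (m3_seq h).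

Lemma code_ranged M : ranged (code M).
Proof. by case: M => a b c e h i j k l; rewrite /ranged /= !res_lt. Qed.

Lemma code_surj h : ranged h -> exists M, code M = h.
Proof.
case: h => a b c e h i j k l; rewrite /ranged /= => H; exists (m3_map repn (M3 a b c e h i j k l)).
by rewrite /rcode /=; move: H; do 9![case/andP=> /resK-> ]; move=> _.
Qed.

Lemma rmmA a b c : ranged a -> ranged b -> ranged c ->
  rmm L a (rmm L b c) = rmm L (rmm L a b) c.
Proof.
move=> /code_surj[A <-] /code_surj[B <-] /code_surj[D <-].
by rewrite -!codeM (mulA C qd).
Qed.
Lemma rmm_ranged a b : ranged a -> ranged b -> ranged (rmm L a b).
Proof. by move=> /code_surj[A <-] /code_surj[B <-]; rewrite -codeM code_ranged. Qed.
Lemma rmm1 a : ranged a -> rmm L a (m3_scal 0%N 1%N) = a.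
Proof. by move=> /code_surj[A <-]; rewrite -code1 -codeM (mulM1 C qd). Qed.
Lemma rmm1l a : ranged a -> rmm L (m3_scal 0%N 1%N) a = a.
Proof. by move=> /code_surj[A <-]; rewrite -code1 -codeM (mul1M C qd). Qed.

Lemma rkey_inj a b : ranged a -> ranged b -> rkey L a = rkey L b -> a = b.
Proof.
have bE i : (i < size rep)%N -> rbits L i = bits4 i.
  move=> li; have : lv_tbits L = [seq bits4 i | i <- iota 0 (size rep)].
    by move: okE; case: (L) => ? ? ? ? ? ? ? ? ? ? ? ? ? /=; case/andP; case/andP => _ /and3P[_ _ /eqP].
  by rewrite /rbits => ->; rewrite (nth_map 0%N) ?size_iota // nth_iota.
have b4 i j : (i < size rep)%N -> (j < size rep)%N -> bits4 i = bits4 j -> i = j.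
  have /andP[_ s16] := size_rep.
  move=> /leq_trans/(_ s16) li /leq_trans/(_ s16) lj /eqP E.
  have : all (fun i => all (fun j => (bits4 i == bits4 j) ==> (i == j)) (iota 0 16)) (iota 0 16).
    by [].
  move/allP/(_ i); rewrite mem_iota => /(_ li)/allP/(_ j); rewrite mem_iota => /(_ lj).
  by move/implyP/(_ E)/eqP.
case: a => a1 a2 a3 a4 a5 a6 a7 a8 a9; case: b => b1 b2 b3 b4' b5 b6 b7 b8 b9.
rewrite /ranged /rkey /=; do 9![case/andP=> ?]; move=> _; do 9![case/andP=> ?]; move=> _.
rewrite !bE // => /eqP; rewrite !eqseq_cat //.
by do 9![case/andP=> /eqP/b4-> //].
Qed.

Lemma rkey_size a : ranged a -> size (rkey L a) = 36%N.
Proof.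
have bE i : (i < size rep)%N -> rbits L i = bits4 i.
  move=> li; have : lv_tbits L = [seq bits4 i | i <- iota 0 (size rep)].
    by move: okE; case: (L) => ? ? ? ? ? ? ? ? ? ? ? ? ? /=; case/andP; case/andP => _ /and3P[_ _ /eqP].
  by rewrite /rbits => ->; rewrite (nth_map 0%N) ?size_iota // nth_iota.
case: a => a1 a2 a3 a4 a5 a6 a7 a8 a9.
rewrite /ranged /rkey /= => H; move: H; do 9![case/andP=> /bE-> ].
by move=> _; rewrite !size_cat.
Qed.

Lemma trace_gam : [/\ (0 < lv_m L)%zz, (ztr t g mod lv_m L = 0)%zz,
  (ztr t (zmul t n g (0, 1)%zz) mod lv_m L = 0)%zz & (znorm t n g mod lv_m L = 0)%zz].
Proof.
move: okE; case: (L) => ? ? ? ? ? ? ? ? ? ? ? ? ? /=; case/andP => _.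
case/and4P=> /Z.ltb_spec0 ? /Z.eqb_spec ? /Z.eqb_spec ? /Z.eqb_spec ?; by split.
Qed.

Lemma null_tables : lv_ttr L = mk_tr t n rep (lv_m L) /\ lv_tnorm L = mk_norm t n rep (lv_m L).
Proof.
move: okE; case: (L) => ? ? ? ? ? ? ? ? ? ? ? ? ? /=; case/andP; case/andP => _.
by case/and3P => /eqP-> /eqP->.
Qed.

(** Passing to representatives changes the form by traces of multiples of g and by multiples of
    N(g), all divisible by m. *)
Lemma code_null a b c : (ztr t (zmul t n a (zconj t c)) + znorm t n b = 0)%zz ->
  null_vec L (res a, res b, res c).
Proof.
move=> E; have [m0 Hg Hw HN] := trace_gam; set m := lv_m L in m0 Hg Hw HN.
have m0' : m <> 0%zz by lia.
have dv x : (x mod m = 0 -> exists k, x = k * m)%zz.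
  by move=> Ex; exists (x / m)%zz; have := Z.div_mod x m m0'; lia.
have [kg Eg] := dv _ Hg; have [kw Ew] := dv _ Hw; have [kN EN] := dv _ HN.
have trg y : exists k, (ztr t (zmul t n g y) = k * m)%zz.
  exists (y.1 * kg + y.2 * kw)%zz.
  have -> : ztr t (zmul t n g y) = (y.1 * ztr t g + y.2 * ztr t (zmul t n g (0, 1)))%zz.
    by rewrite /ztr /zmul /=; ring.
  by rewrite Eg Ew; ring.
rewrite /null_vec /rtr /rnorm; have [-> ->] := null_tables.
rewrite (nth_map (0, 0)%zz) ?res_lt // (nth_map (0, 0)%zz) ?res_lt //.
rewrite (nth_map (0, 0)%zz) ?res_lt //.
have [x Ex] := congE (cong_rep (res_lt a)).
have [y Ey] := congE (cong_rep (res_lt b)).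
have [z Ez] := congE (cong_rep (res_lt c)).
set a' := repn _ in Ex *; set b' := repn _ in Ey *; set c' := repn _ in Ez *.
rewrite -/m -/(ztr t (zmul t n a' (zconj t c'))).
have [k1 K1] := trg (zmul t n x (zconj t c)).
have [k2 K2] := trg (zmul t n z (zconj t a')).
have [k3 K3] := trg (zmul t n y (zconj t b')).
(* With a = a' + g x, b = b' + g y, c = c' + g z, the corrections are the traces of g x conj(c), g z
   conj(a') and g y conj(b'), and N(g) N(y). *)
have F : (ztr t (zmul t n a' (zconj t c')) + znorm t n b' =
   0 - (k1 + k2 + k3 + kN * znorm t n y) * m)%zz.
  have -> : (0 - (k1 + k2 + k3 + kN * znorm t n y) * m =
    ztr t (zmul t n a (zconj t c)) + znorm t n b - k1 * m - k2 * m - k3 * m - znorm t n y * (kN * m))%zz.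
    by rewrite E; ring.
  rewrite -K1 -K2 -K3 -EN Ex Ey Ez /ztr /znorm /zmul /zconj /zadd /=; ring.
apply/eqP; congr Z.to_nat.
have -> : ztr t (zmul t n a' (zconj t c')) =
   (- znorm t n b' + (- (k1 + k2 + k3 + kN * znorm t n y)) * m)%zz by lia.
by rewrite Z.mod_add.
Qed.

End Residues.

(** * Subgroups, indices and finite subgroups of abstract groups *)

Section AbstractIndex.
Variable G : groupType.
Implicit Types H K F : set G.

Lemma is_subgroupP H : is_subgroup H <->
  [/\ H 1%g, forall x y, H x -> H y -> H (x * y)%g & forall x, H x -> H x^-1%g].
Proof.
have mE x : (x \in [in H]) = (x \in H) by [].
split=> [[H1 HD]|[H1 HM HV]].
  have HB x y : H x -> H y -> H (x * y^-1)%g.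
    move=> Hx Hy; have := HD x y; rewrite !mE => /(_ (mem_set Hx) (mem_set Hy)).
    by rewrite inE.
  have H1' : H 1%g by move: H1; rewrite mE inE.
  have HV x : H x -> H x^-1%g by move=> Hx; have := HB _ _ H1' Hx; rewrite div1g.
  by split=> // x y Hx Hy; have := HB _ _ Hx (HV _ Hy); rewrite invgK.
split; first by rewrite mE inE.
by move=> x y; rewrite !mE !inE => Hx Hy; apply: HM => //; apply: HV.
Qed.

Definition cos H (x : G) : set G := [set (x * h)%g | h in H].

Lemma cos_eq H x y : is_subgroup H -> cos H x = cos H y <-> H (x^-1 * y)%g.
Proof.
case/is_subgroupP=> H1 HM HV; split=> [E|Hxy].
  have : cos H x y by rewrite E; exists 1%g; rewrite ?mulg1.
  by case=> h Hh <-; rewrite mulKg.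
apply/seteqP; split=> _ [h Hh <-].
  exists ((x^-1 * y)^-1 * h)%g; first by apply: HM => //; apply: HV.
  by rewrite invMg invgK !mulgA mulgV mul1g.
by exists (x^-1 * y * h)%g; [apply: HM | rewrite !mulgA mulgV mul1g].
Qed.

Lemma index_of_reps H K N (r : nat -> G) : is_subgroup H ->
  (forall i, (i < N)%N -> K (r i)) ->
  (forall i j, (i < N)%N -> (j < N)%N -> H ((r i)^-1 * r j)%g -> i = j) ->
  (forall x, K x -> exists2 i, (i < N)%N & H ((r i)^-1 * x)%g) ->
  has_index H K N.
Proof.
move=> sH rK rI rS; rewrite /has_index.
have -> : lcosets H K = (fun i => cos H (r i)) @` `I_N.
  apply/seteqP; split=> [_ [x Kx <-]|_ [i /= li <-]].
    by have [i li Hi] := rS x Kx; exists i => //; apply/cos_eq.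
  by exists (r i) => //; apply: rK.
apply: inj_card_eq => i j; rewrite !inE /= => li lj.
by move/(cos_eq _ _ sH); apply: rI.
Qed.

Lemma index_reps H K N : is_subgroup H -> is_subgroup K -> has_index H K N ->
  exists r : 'I_N -> G, [/\ forall i, K (r i),
    forall i j, H ((r i)^-1 * r j)%g -> i = j &
    forall x, K x -> exists i, H ((r i)^-1 * x)%g].
Proof.
move=> sH sK /card_esym/card_set_bijP[f [fS fI fT]].
have fex (i : 'I_N) : exists x, K x /\ cos H x = f i.
  by have [x Kx <-] := fS i (ltn_ord i); exists x.
have {}[r rP] := choice fex; exists r; split=> [i|i j Hij|x Kx].
- by case: (rP i).
- apply/val_inj/fI; rewrite ?inE; [exact: ltn_ord|exact: ltn_ord|].
  by case: (rP i) => _ <-; case: (rP j) => _ <-; apply/cos_eq.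
have [i li Ei] : (f @` `I_N) (cos H x) by apply: fT; exists x.
by exists (Ordinal li); apply/(cos_eq _ _ sH); case: (rP (Ordinal li)) => _ ->.
Qed.

Lemma finite_order F x k : is_subgroup F -> (F #= `I_k)%card -> F x ->
  exists2 m, (0 < m)%N & (x ^+ m = 1)%g.
Proof.
move=> sF /card_set_bijP[f [fS fI fT]] Fx.
have [F1 FM FV] := (is_subgroupP F).1 sF.
have FX m : F (x ^+ m)%g by elim: m => // m IH; rewrite expgS; apply: FM.
pose h (m : 'I_k.+1) : 'I_k := Ordinal (fS _ (FX m) : (f (x ^+ m)%g < k)%N).
have /injectivePn[a [b ab /(congr1 val)/= Eab]] : ~~ injectiveb h.
  by apply/negP => /injectiveP/leq_card; rewrite !card_ord ltnn.
have {Eab} E : (x ^+ a = x ^+ b)%g by apply: fI; rewrite ?inE.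
wlog lab : a b E {ab} / (a < b)%N.
  move=> W; have : (a != b)%N by [].
  by rewrite neq_ltn => /orP[]; apply: W.
exists (b - a)%N; rewrite ?subn_gt0 // .
by apply: (mulgI (x ^+ a)%g); rewrite -expgnDr subnKC ?mulg1 // ltnW.
Qed.

Lemma prime_order_power (x : G) k : (0 < k)%N -> (x ^+ k = 1)%g -> x != 1%g ->
  exists a p, [/\ prime p, (x ^+ a)%g != 1%g & ((x ^+ a) ^+ p = 1)%g].
Proof.
move=> k0 xk x1.
have [m [m0 xm mmin]] : exists m, [/\ (0 < m)%N, (x ^+ m = 1)%g &
    forall j, (0 < j < m)%N -> (x ^+ j)%g != 1%g].
  have ex : exists m, (0 < m)%N && ((x ^+ m)%g == 1%g) by exists k; rewrite k0 xk eqxx.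
  case: (ex_minnP ex) => m /andP[m0 /eqP xm] mmin; exists m; split=> // j /andP[j0 jm].
  by apply: contraTN jm => xj; rewrite -leqNgt mmin // j0 xj.
have m1 : (1 < m)%N by rewrite ltn_neqAle m0 andbT; apply: contraNneq x1 => E; move: xm; rewrite -E expg1 => ->.
have pp := pdiv_prime m1; have pm := pdiv_dvd m.
exists (m %/ pdiv m)%N, (pdiv m); split=> //; last by rewrite -expgnA divnK.
by apply: mmin; rewrite divn_gt0 ?prime_gt0 // dvdn_leq //= ltn_Pdiv // prime_gt1.
Qed.

Lemma enum_finite F k : (F #= `I_k)%card -> exists f : 'I_k -> G,
  [/\ forall i, F (f i), injective f & forall x, F x -> exists i, f i = x].
Proof.
move=> /card_set_bijP[h [hS hI hT]].
have hex (i : 'I_k) : exists x, F x /\ h x = i.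
  by have [x Fx <-] := hT _ (ltn_ord i); exists x.
have [f fP] := choice hex; exists f; split=> [i|i j E|x Fx].
- by case: (fP i).
- by apply: val_inj; rewrite /= -(proj2 (fP i)) -(proj2 (fP j)) E.
exists (Ordinal (hS _ Fx)); case: (fP (Ordinal (hS _ Fx))) => Ff /= E.
by apply: hI; rewrite ?inE.
Qed.

(* A finite subgroup F of K acts freely on the cosets of a torsion-free
   subgroup H of K. *)
Lemma card_dvd_index H K F N k : is_subgroup H -> is_subgroup K -> is_subgroup F ->
  F `<=` K -> (F #= `I_k)%card -> torsion_free H -> has_index H K N -> (k %| N)%N.
Proof.
move=> sH sK sF FK Fk tH HN; have [r [rK rI rS]] := index_reps sH sK HN.
have finF := finite_order sF Fk.
have [f [fS fI fT]] := enum_finite Fk.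
have [H1 HM HV] := (is_subgroupP H).1 sH; have [K1 KM KV] := (is_subgroupP K).1 sK.
have [F1 FM FV] := (is_subgroupP F).1 sF.
(* Two indices are related when their cosets lie in one F-orbit; every class is shown to have k
   elements. *)
pose e (i j : 'I_N) := `[< exists2 x, F x & H ((r i)^-1 * (x * r j))%g >].
have eR : reflexive e.
  by move=> i; apply/asboolP; exists 1%g => //; rewrite mul1g mulVg.
have eS : symmetric e.
  suff S i j : e i j -> e j i by move=> i j; apply/idP/idP; apply: S.
  move/asboolP=> [x Fx Hx]; apply/asboolP; exists x^-1%g; first exact: FV.
  by have := HV _ Hx; rewrite !invMg invgK mulgA.
have eT : transitive e.
  move=> j i l /asboolP[x Fx Hx] /asboolP[y Fy Hy]; apply/asboolP.
  exists (x * y)%g; first exact: FM.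
  by have := HM _ _ Hx Hy; congr H; rewrite !mulgA mulgK.
have eE : {in [set: 'I_N]%SET & &, equivalence_rel e}.
  by move=> i j l _ _ _; split=> // ij; apply/idP/idP; apply: eT; rewrite // eS.
have := card_uniform_partition (n := k) _ (equivalence_partitionP eE).
rewrite cardsT card_ord => ->; first exact: dvdn_mull.
move=> A /imsetP[i _ ->].
have act (m : 'I_k) : exists j, H ((r j)^-1 * (f m * r i))%g.
  by apply: rS; apply: KM => //; apply/FK/fS.
have [h hP] := choice act.
(* Freeness: if [f m] and [f m'] send the coset of [r i] to the same coset, a conjugate of the
   torsion element (f m)^-1 f m' lies in H, hence is trivial. *)
have hI : injective h.
  move=> m m' E; have := HM _ _ (HV _ (hP m)) (hP m'); rewrite -E !invMg invgK.
  rewrite !mulgA mulgK -!mulgA => Hx; apply/fI.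
  have [q q0 Eq] := finF _ (FM _ _ (FV _ (fS m)) (fS m')).
  have conjX (x y : G) l : ((y^-1 * (x * y)) ^+ l = y^-1 * (x ^+ l * y))%g.
    elim: l => [|l IH]; first by rewrite !expg0 mul1g mulVg.
    by rewrite !expgS IH !mulgA mulgK.
  have := tH _ q Hx q0; rewrite [(_^-1 * (f m' * r i))%g]mulgA conjX Eq mul1g mulVg => /(_ erefl).
  move/(congr1 (fun z => r i * z * (r i)^-1)%g); rewrite !mulgA mulgV mul1g mulg1 mulgV mulgK.
  by move/(congr1 (fun z => f m * z)%g); rewrite mulgA mulgV mul1g mulg1.
rewrite -[RHS]card_ord -(card_imset _ hI); apply: eq_card => j.
rewrite !inE /=; apply/asboolP/imsetP=> [[x Fx Hx]|[m _ ->]].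
  have [m Em] := fT _ (FV _ Fx); exists m => //.
  apply: rI; have := HM _ _ (HV _ Hx) (HV _ (hP m)).
  by rewrite Em !invMg !invgK !mulgA mulgK mulgVK.
by exists (f m)^-1%g; [apply/FV/fS|
   have := HV _ (hP m); rewrite !invMg invgK !mulgA].
Qed.
End AbstractIndex.

(** * Congruence subgroups *)

HB.instance Definition _ (T : eqType) :=
  Equality.copy (m3 T) (inj_type (@m3_seq_inj T)).

(** Closure under multiplication is tested against single factors only, since every element is a
    product of factors; [products_ind] makes the passage to arbitrary products. *)
Definition sub_ok (L : level) (S : seq (seq (m3 nat))) : bool :=
  let H := products L S in let G := flatten S in
  let key h := rkey L h in
  if tbuild [seq key h | h <- H] Lf is Some T then
    [&& all (fun h => all (fun i => i < size (lv_rep L))%N (m3_seq h)) G,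
        all (fun h => all (fun g => tmem (key (rmm L h g)) T) G) H,
        all (fun h => tmem (key (m3_adj (rconj L) h)) T) H &
        tmem (key (m3_scal 0%N 1%N)) T]
  else false.

Definition reps_ok (L : level) (R : seq (seq (m3 (Z * Z)))) : bool :=
  all (all (isG (lv_t L) (lv_n L))) R.

Definition codes (L : level) (R : seq (seq (m3 (Z * Z)))) : seq (seq (m3 nat)) :=
  [seq [seq rcode L a | a <- F] | F <- R].

(** Distinctness of all products makes the left factor of a product unique. Membership in [u] is
    expressed by a position because the types carry no equality test. *)
Lemma allpairs_uniq_nth (S T : Type) (U : eqType) (f : S -> T -> U) x0 s u i j y y' :
  uniq [seq f x y | x <- s, y <- u] -> (i < size s)%N -> (j < size s)%N ->
  (exists2 k, (k < size u)%N & y = nth y u k) -> (exists2 k, (k < size u)%N & y' = nth y' u k) ->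
  f (nth x0 s i) y = f (nth x0 s j) y' -> i = j.
Proof.
elim: s i j y y' => [|x s IH] [|i] [|j] y y' //= us li lj yu yu' E; move: us.
- rewrite cat_uniq => /and3P[_ /hasPn H _]; case: yu => k lk Ey; case: yu' => k' lk' Ey'.
  have /H/negP[] : f x y \in [seq f x y | x <- s, y <- u].
    rewrite E Ey'; apply/flattenP; exists [seq f (nth x0 s j) y | y <- u].
      by apply/(nthP [::]); exists j; rewrite ?size_map // (nth_map x0).
    by apply/(nthP (f x y)); exists k'; rewrite ?size_map // (nth_map y').
  by apply/(nthP (f x y)); exists k; rewrite ?size_map // (nth_map y) // -Ey.
- rewrite cat_uniq => /and3P[_ /hasPn H _]; case: yu => k lk Ey; case: yu' => k' lk' Ey'.
  have /H/negP[] : f x y' \in [seq f x y | x <- s, y <- u].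
    rewrite -E Ey; apply/flattenP; exists [seq f (nth x0 s i) y | y <- u].
      by apply/(nthP [::]); exists i; rewrite ?size_map // (nth_map x0).
    by apply/(nthP (f x y)); exists k; rewrite ?size_map // (nth_map y).
  by apply/(nthP (f x y')); exists k'; rewrite ?size_map // (nth_map y') // -Ey'.
rewrite cat_uniq => /and3P[_ _ us]; congr _.+1; exact: IH us li lj yu yu' E.
Qed.

Definition zcube (t n : Z) (u : Z * Z) := zmul t n u (zmul t n u u).

(** Lifts are unique only up to cube roots of unity, so the finite group must contain these scalars
    for membership in [Hset] not to depend on the lift. *)
Definition scal_ok (L : level) (us : seq (Z * Z)) (S : seq (seq (m3 nat))) : bool :=
  all (fun u => (zcube (lv_t L) (lv_n L) u == (1, 0)%zz) ==>
    (m3_scal 0%N (rres L u) \in products L S)) us.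

Lemma ztrE (C : numClosedFieldType) d t n (p : Z * Z) : quad d t n ->
  zC C (ztr t p) = emb C d p + (emb C d p)^*.
Proof.
move=> qd; rewrite (emb_conj C qd) -embD -(emb_zC C d); congr emb.
by case: p => a b; rewrite /ztr /zadd /zconj /=; congr pair; lia.
Qed.

Section Congruence.
Variables (C : numClosedFieldType) (d : nat) (L : level) (us : seq (Z * Z)).
Local Notation t := (lv_t L).
Local Notation n := (lv_n L).
Local Notation g := (lv_gam L).
Local Notation emb := (emb C d).
Hypothesis (qd : quad d t n) (sd : sqfree d) (Lok : level_ok L).
Hypothesis gamc : zdvd t n g (zconj t g).
Hypothesis unitsP : forall u, znorm t n u = 1%zz -> u \in us.
Hypothesis units12 : forall u, u \in us -> emb u ^+ 12 = 1.
Local Notation mx := (mxm emb).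
Local Notation M3mul := (m3_mul zadd (zmul t n)).
Local Notation M3adj := (m3_adj (zconj t)).
Local Notation M3det := (m3_det zadd (zmul t n) zneg).
Local Notation M31 := (m3_scal (0, 0)%zz (1, 0)%zz).
Local Notation isG := (isG t n).
Local Notation lifts := (@lifts C d).
Local Notation code := (rcode L).
Local Notation one := (m3_scal 0%N 1%N).
Local Notation ranged := (ranged L).
Local Notation res := (rres L).

Let cM := codeM C qd Lok.
Let cJ := code_adj C qd Lok gamc.
Let c1 := code1 Lok.
Let cr := code_ranged C qd Lok.
Let rA := rmmA C qd Lok.
Let rr := rmm_ranged C qd Lok.
Let r1 := rmm1 C qd Lok.

Definition Hset (HL : seq (m3 nat)) : set (PU C) :=
  [set x | exists M, [/\ isG M, lifts M x & code M \in HL]].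

Lemma tbuild_mem (s : seq (m3 nat)) T : all ranged s ->
  tbuild [seq rkey L h | h <- s] Lf = Some T ->
  uniq [seq rkey L h | h <- s] /\
  forall h, ranged h -> tmem (rkey L h) T = (h \in s).
Proof.
move=> rs /(tbuildP (n := 36%N))[].
  by apply/allP => _ /mapP[h /(allP rs) rh ->]; rewrite (rkey_size Lok).
move=> us' _ HT; split=> // h rh; rewrite HT ?(rkey_size Lok) //.
have -> : tmem (rkey L h) Lf = false by case: rkey.
rewrite orbF.
apply/mapP/idP=> [[h' h's E]|hs]; last by exists h.
by rewrite (rkey_inj Lok rh (allP rs _ h's) E).
Qed.

Lemma products_ranged S : all ranged (flatten S) -> all ranged (products L S).
Proof.
elim: S => [|F S IH] /=; first by rewrite andbT -c1 cr.
rewrite all_cat => /andP[rF /IH rS]; apply/allP => _ /allpairsP[[a b] /= [aF bS ->]].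
by apply: rr; [exact: (allP rF) | exact: (allP rS)].
Qed.

Lemma products_ind (P : m3 nat -> Prop) S : all ranged (flatten S) ->
  (forall x y, ranged x -> P x -> y \in flatten S -> P (rmm L x y)) ->
  forall h x, h \in products L S -> ranged x -> P x -> P (rmm L x h).
Proof.
elim: S => [|F S IH] /= rS PS h x.
  by rewrite inE => /eqP-> rx Px; rewrite r1.
move: rS; rewrite all_cat => /andP[rF rS] /allpairsP[[a b] /= [aF bS ->]] rx Px.
have ra := allP rF _ aF; have rb := allP (products_ranged rS) _ bS.
rewrite rA //; apply: IH => //; [|exact: rr|].
  by move=> y z ry Py zS; apply: PS => //; rewrite mem_cat zS orbT.
by apply: PS => //; rewrite mem_cat aF.
Qed.

Section Sub.
Variable S : seq (seq (m3 nat)).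
Hypotheses (Sok : sub_ok L S) (Uok : scal_ok L us S).
Local Notation HL := (products L S).

Lemma subP : [/\ all ranged (flatten S), one \in HL,
  forall h k, h \in HL -> k \in HL -> rmm L h k \in HL,
  forall h, h \in HL -> m3_adj (rconj L) h \in HL & uniq [seq rkey L h | h <- HL]].
Proof.
move: Sok; rewrite /sub_ok; case E: tbuild => [T|//] /and4P[rS HM HV H1].
have [uH TE] := tbuild_mem (products_ranged rS) E.
have adjr h : ranged h -> ranged (m3_adj (rconj L) h).
  by move=> /(code_surj Lok)[M <-]; rewrite -cJ cr.
have rH h : h \in HL -> ranged h by apply/allP/products_ranged.
split=> //.
- by rewrite -TE // -c1 cr.
- move=> h k hH kH; apply: (products_ind (P := fun h => h \in HL) rS) => //.
    move=> x y rx xH yS; rewrite -TE; last by apply: rr => //; apply: (allP rS).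
    by move/allP: HM => /(_ x xH)/allP/(_ y yS).
  exact: rH.
- by move=> h hH; rewrite -TE; [apply: (allP HV)|apply/adjr/rH].
Qed.

Lemma smul_HL u M : znorm t n u = 1%zz -> emb u ^+ 3 = 1 -> code M \in HL ->
  code (m3_smul t n u M) \in HL.
Proof.
move=> nu u3 MH; have [_ _ HM _ _] := subP.
have -> : m3_smul t n u M = M3mul (m3_scal (0, 0)%zz u) M.
  apply: (mx_inj (C := C) qd); rewrite (mxM C qd) mxm_scal ?emb0 // mul_scalar_mx.
  by rewrite (mx_smul C qd).
rewrite cM; apply: HM => //; rewrite /rcode /= (res0 Lok).
move/allP: Uok => /(_ u (unitsP nu))/implyP; apply; apply/eqP.
by apply: (emb_inj (C := C) qd); rewrite !(embM C qd) emb1 -u3 !exprS expr0 mulr1.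
Qed.

Lemma Hset_lift M x : isG M -> lifts M x -> Hset HL x -> code M \in HL.
Proof.
move=> gM lM [N [gN lN cN]].
have [u [-> nu u3]] := lifts_unit qd unitsP units12 gN gM lN lM.
exact: smul_HL.
Qed.

Lemma Hset_sub : is_subgroup (Hset HL).
Proof.
have [rS H1 HM HV _] := subP; apply/is_subgroupP; split.
- exists M31; rewrite (isG1 C qd) c1 H1; split=> //; exact: lifts1.
- move=> x y [M [gM lM cMH]] [N [gN lN cNH]]; exists (M3mul M N).
  by split; [exact: (isGM C qd)|exact: (liftsM qd)|rewrite cM; apply: HM].
move=> x [M [gM lM cMH]]; exists (M3adj M).
by split; [exact: (isGV C qd)|exact: (liftsV qd)|rewrite cJ; apply: HV].
Qed.

Lemma Hset_Gamma : Hset HL `<=` Gamma d.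
Proof. by move=> x [M [gM lM _]]; apply/(GammaP qd sd unitsP units12); exists M. Qed.

Lemma Gamma_sub : is_subgroup (@Gamma C d).
Proof.
have GP := GammaP qd sd unitsP units12.
apply/is_subgroupP; split.
- by apply/GP; exists M31; [exact: (isG1 C qd)|exact: lifts1].
- move=> x y /GP[M gM lM] /GP[N gN lN]; apply/GP; exists (M3mul M N).
    exact: (isGM C qd).
  exact: (liftsM qd).
move=> x /GP[M gM lM]; apply/GP; exists (M3adj M).
  exact: (isGV C qd).
exact: (liftsV qd).
Qed.

(** The adjugate [Q] of M is D times the J-adjoint of M, where D = det M. Its middle row involves
    only the outer columns of M, and D conj(D) = 1 lets one solve for the middle column. *)
Lemma adj_cols (a b c e h i j k l : Z * Z) :
  let M := M3 a b c e h i j k l in M3mul (M3adj M) M = M31 ->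
  M = m3_of_cols zadd (zmul t n) zneg (zconj t) (M3det M) (a, e, j) (c, i, l).
Proof.
move=> M uM; have EA := mx_adj C qd uM.
have E x y := congr1 (fun A : 'M[C]_3 => A x y) EA.
pose D := \det (mx M).
pose Q : m3 (Z * Z) := M3
  (zadd (zmul t n h l) (zneg (zmul t n i k))) (zadd (zmul t n c k) (zneg (zmul t n b l))) (zadd (zmul t n b i) (zneg (zmul t n c h)))
  (zadd (zmul t n i j) (zneg (zmul t n e l))) (zadd (zmul t n a l) (zneg (zmul t n c j))) (zadd (zmul t n c e) (zneg (zmul t n a i)))
  (zadd (zmul t n e k) (zneg (zmul t n h j))) (zadd (zmul t n b j) (zneg (zmul t n a k))) (zadd (zmul t n a h) (zneg (zmul t n b e))).
have QM : mx Q *m mx M = D%:M.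
  apply/mx3P; split; rewrite !mxE !big_ord_recl big_ord0 !mxE /= /D -(mxdet C qd)
    /m3_det /m3_minor /= !(embD, embN, embM C qd) ?mulr1n ?mulr0n; ring.
have EQ : mx Q = D *: mx (M3adj M).
  by rewrite -[LHS]mulmx1 -EA mulmxA QM mul_scalar_mx.
have nD : D * D^* = 1.
  by rewrite /D -(mxdet C qd) (emb_norm C qd) (det_norm C qd uM) rmorph1.
have H x y := congr1 (fun A : 'M[C]_3 => A x y) EQ.
have K x z z' : emb z = D * emb (zconj t z') -> x = zmul t n (M3det M) (zconj t z) -> z' = x.
  move=> Ez ->; apply: (emb_inj (C := C) qd); rewrite (embM C qd) (mxdet C qd) -/D.
  rewrite -(emb_conj C qd) Ez -(emb_conj C qd) rmorphM /= conjCK mulrA nD mul1r.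
  by [].
rewrite {1}/M /m3_of_cols /m3_minor; congr M3.
- apply: K erefl; have := H 1 2%:R; rewrite !mxE /= => <-.
  by rewrite !(embD, embN, embM C qd); ring.
- apply: K erefl; have := H 1 1; rewrite !mxE /= => <-.
  by rewrite !(embD, embN, embM C qd); ring.
- apply: K erefl; have := H 1 0; rewrite !mxE /= => <-.
  by rewrite !(embD, embN, embM C qd); ring.
Qed.

Section Index.
Variables (R : seq (seq (m3 (Z * Z)))) (dets : seq nat).
Hypothesis Rok : reps_ok L R.
Hypothesis detsP : forall u, znorm t n u = 1%zz -> emb u ^+ 3 = 1 -> res u \in dets.
Hypothesis Iok : index_check L dets (products L (codes L R)) HL.
Local Notation RL := (products L (codes L R)).

Lemma reps_lift r : r \in RL -> exists M, isG M /\ code M = r.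
Proof.
move: Rok; rewrite /reps_ok /codes.
elim: R r => [|F R' IH] r /=.
  by rewrite inE => _ /eqP->; exists M31; rewrite (isG1 C qd) c1.
case/andP=> gF gR /allpairsP[[a b] /= [/mapP[A AF ->] bR ->]].
have [M [gM <-]] := IH b gR bR; exists (M3mul A M); rewrite cM; split=> //.
by apply: (isGM C qd) => //; apply: (allP gF).
Qed.

Lemma reps_ranged : all ranged RL.
Proof. by apply/allP => r /reps_lift[N [_ <-]]. Qed.

Lemma coset_trieP : exists T, [/\ uniq (coset_keys L RL HL), covers L dets T &
  forall x, ranged x -> tmem (rkey L x) T ->
    exists r h, [/\ r \in RL, h \in HL & x = rmm L r h]].
Proof.
have [rS _ _ _ _] := subP; have rH := products_ranged rS.
pose s := [seq rmm L r h | r <- RL, h <- HL].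
have rs : all ranged s.
  apply/allP => _ /allpairsP[[r h] /= [rRL hHL ->]].
  by apply: rr; [exact: (allP reps_ranged)|exact: (allP rH)].
have Es : coset_keys L RL HL = [seq rkey L x | x <- s].
  by rewrite /coset_keys /s map_allpairs.
move: Iok; rewrite /index_check Es.
case E: tbuild => [T|//] cT; have [uT TE] := tbuild_mem rs E.
exists T; split=> // x rx; rewrite TE // => /allpairsP[[r h] /= [? ? ?]].
by exists r, h.
Qed.

(** Three entries of the identity M3adj M M = 1 say that the outer columns are isotropic with
    product 1. These relations, and the formula for the middle column, survive reduction modulo g,
    so the residue of M is among the enumerated matrices. *)
Lemma Gamma_covered M : isG M -> exists r h, [/\ r \in RL, h \in HL & code M = rmm L r h].
Proof.
move=> gM; have /(isGP C qd)[uM dM] := gM; have [T [_ cT TE]] := coset_trieP.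
move: cT; suff : forall d u v, d \in dets -> u \in vectors L -> v \in vectors L ->
    null_vec L u -> null_vec L v -> v3_herm (radd L) (rmul L) (rconj L) u v = 1%N ->
    code M = m3_of_cols (radd L) (rmul L) (rneg L) (rconj L) d u v ->
    covers L dets T -> exists r h, [/\ r \in RL, h \in HL & code M = rmm L r h].
  move: (gM) (uM) dM; case: (M) => a b c e h i j k l gM' uM' dM' W.
  have vV x y z : (res x, res y, res z) \in vectors L.
    apply/flattenP; exists [seq (res x, b', c') | b' <- iota 0 (size (lv_rep L)), c' <- iota 0 (size (lv_rep L))].
      by apply/mapP; exists (res x); rewrite // mem_iota (res_lt C qd Lok).
    by apply/allpairsP; exists (res y, res z); rewrite !mem_iota !(res_lt C qd Lok).
  have nullE x y z : zadd (zadd (zmul t n (zconj t z) x) (zmul t n (zconj t y) y))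
      (zmul t n (zconj t x) z) = (0, 0)%zz -> null_vec L (res x, res y, res z).
    move=> Ez; apply: (code_null C qd Lok gamc); apply: (zC_inj (C := C)).
    rewrite rmorph0 -[RHS](emb0 C d) -Ez !embD !(embM C qd) zCD -(emb_norm C qd).
    rewrite (ztrE C _ qd) (embM C qd) rmorphM /= -!(emb_conj C qd) conjCK; ring.
  have E13 : zadd (zadd (zmul t n (zconj t l) c) (zmul t n (zconj t i) i))
      (zmul t n (zconj t c) l) = (0, 0)%zz := congr1 (fun A => m3_at A 2) uM'.
  have E31 : zadd (zadd (zmul t n (zconj t j) a) (zmul t n (zconj t e) e))
      (zmul t n (zconj t a) j) = (0, 0)%zz := congr1 (fun A => m3_at A 6) uM'.
  have E33 : zadd (zadd (zmul t n (zconj t j) c) (zmul t n (zconj t e) i))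
      (zmul t n (zconj t a) l) = (1, 0)%zz := congr1 (fun A => m3_at A 8) uM'.
  apply: (W (res (M3det (M3 a b c e h i j k l))) (res a, res e, res j) (res c, res i, res l)) => //.
  - apply: detsP; first exact: (det_norm C qd uM').
    by rewrite (mxdet C qd).
  - exact: nullE.
  - exact: nullE.
  - rewrite /v3_herm -!(resJ C qd Lok gamc) -!(resM C qd Lok) -!(resD C qd Lok) E33.
    exact: res1.
  - rewrite [in LHS](adj_cols uM') /rcode /m3_of_cols /m3_minor /=.
    by rewrite !(resM C qd Lok, resJ C qd Lok gamc, resD C qd Lok, resN C qd Lok).
move=> dt u v dD uV vV nu nv huv EM /allP/(_ u).
rewrite mem_filter nu uV => /(_ isT)/allP/(_ v); rewrite mem_filter nv vV => /(_ isT).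
rewrite huv eqxx => /allP/(_ dt dD); rewrite -EM; apply: TE; exact: cr.
Qed.

(** All products r h are distinct and include every residue of a lift, so the integral lifts of the
    r meet each coset exactly once. *)
Theorem Hset_index : has_index (Hset HL) (@Gamma C d) (size RL).
Proof.
have GP := GammaP qd sd unitsP units12.
have [rS H1 HM HV uH] := subP; have rH := products_ranged rS.
have rR := reps_ranged.
have ex i : exists x : PU C, (i < size RL)%N ->
    exists M, [/\ isG M, lifts M x & code M = nth one RL i].
  case: (ltnP i (size RL)) => // li; last by exists 1%g.
  have [M [gM cMi]] := reps_lift (mem_nth one li).
  by have [x lx] := lifts_ex C qd gM; exists x => _; exists M.
have [r rP] := choice ex.
have cadj M x : isG M -> ranged x -> rmm L (code (M3adj M)) (rmm L (code M) x) = x.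
  move=> /(isGP C qd)[uM _] rx.
  by rewrite rA ?cr // -cM uM c1 (rmm1l C qd Lok).
apply: (@index_of_reps _ _ _ _ r).
- exact: Hset_sub.
- by move=> i /rP[M [gM lM _]]; apply/GP; exists M.
- move=> i j li lj [N [gN lN cN]].
  have [M [gM lM cMi]] := rP _ li; have [M' [gM' lM' cMj]] := rP _ lj.
  have lQ := liftsM qd (liftsV qd gM lM) lM'.
  have gQ := isGM C qd (isGV C qd gM) gM'.
  have qH : code (M3mul (M3adj M) M') \in HL.
    by apply: (Hset_lift gQ lQ); exists N.
  have [_ [uK _ _]] := coset_trieP.
  have inP (h : m3 nat) : h \in HL -> exists2 k, (k < size HL)%N & h = nth h HL k.
    by move=> hH; exists (index h HL); rewrite ?index_mem // nth_index.
  (* The residue of M' is written both as r_i h, with h the residue of M^-1 M', and as r_j times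
     1. *)
  apply: (allpairs_uniq_nth uK (x0 := one) li lj (inP _ qH) (inP _ H1)).
  congr rkey; rewrite r1; last by apply: (allP rR); apply: mem_nth.
  rewrite -cMi -cMj -cM (mulA C qd); congr code; have /(isGP C qd)[uM _] := gM.
  by apply: (mx_inj (C := C) qd); rewrite !(mxM C qd) (mx_adj C qd uM) mul1mx.
move=> x /GP[M gM lM]; have [r' [h [rRL hHL E]]] := Gamma_covered gM.
exists (index r' RL); first by rewrite index_mem.
have [N [gN lN cN]] : exists N, [/\ isG N, lifts N (r (index r' RL)) & code N = r'].
  have li : (index r' RL < size RL)%N by rewrite index_mem.
  by have [N [gN lN cN]] := rP _ li; exists N; rewrite cN nth_index.
exists (M3mul (M3adj N) M); split.
- exact: (isGM C qd (isGV C qd gN) gM).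
- exact: (liftsM qd (liftsV qd gN lN) lM).
by rewrite cM E -cN cadj //; apply: (allP rH).
Qed.

End Index.
End Sub.
End Congruence.

(** The prime p = 2 is where the threshold N > 4 is needed. *)
Lemma norm_pow_gt (N p : nat) : (4 < N)%N -> (1 < p)%N -> (p ^ 2 < N ^ p.-1)%N.
Proof.
move=> N5 p1; apply: (@leq_trans (5 ^ p.-1)%N); last by rewrite leq_exp2r // -ltnS prednK // ltnW.
case: p p1 => [|[|p]] //= _; elim: p => // p IH.
rewrite (expnS 5); move: IH; rewrite -!mulnn; set x := (5 ^ _)%N; nia.
Qed.

(** * Torsion in principal congruence subgroups *)

Section Kernel.
Variables (C : numClosedFieldType) (d : nat) (t n : Z).
Hypothesis (qd : quad d t n) (sd : sqfree d).
Local Notation emb := (emb C d).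
Local Notation mx := (mxm emb).
Notation zint := (integralOver (intr : int -> C)).

Lemma ztau_field (p q : Z * Z) : q != (0, 0)%zz -> imag_quad_field d (emb p / emb q).
Proof.
move=> q0; pose N := znorm t n q; pose P := zmul t n p (zconj t q).
have N0 : zC C N != 0.
  by apply/eqP => /zC_eq0/(znorm_eq0 C qd) E; rewrite E eqxx in q0.
have -> : emb p / emb q = (zC C P.1 + zC C P.2 * omega C d) / zC C N.
  rewrite -/(emb P) /P (embM C qd) /N -(emb_norm C qd) -(emb_conj C qd).
  rewrite -mulf_div mulfV ?mulr1 //.
  by apply: contraNneq N0 => E; rewrite /N -(emb_norm C qd) E mulr0.
have [a [b ->]] := omega_field C d.
exists (((int_of_Z P.1)%:~R + (int_of_Z P.2)%:~R * a) / (int_of_Z N)%:~R),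
  ((int_of_Z P.2)%:~R * b / (int_of_Z N)%:~R).
have M (x y : rat) : ratr (x * y) = ratr x * ratr y :> C by rewrite rmorphM.
have D (x y : rat) : ratr (x + y) = ratr x + ratr y :> C by rewrite rmorphD.
have V (x : rat) : ratr x^-1 = (ratr x)^-1 :> C by rewrite fmorphV.
by rewrite !(M, D, V) !ratr_int -/(tau C d) /zC; ring.
Qed.

(** An eigenvalue is a root of the monic characteristic polynomial, whose coefficients [e1], [e2],
    [e3] are integral; integrality is transitive. *)
Lemma zint_eigenvalue (X : m3 (Z * Z)) (w : C) :
  \det (mx X - w%:M) = 0 -> zint w.
Proof.
case: X => a b c e f h i j k.
set A := mxm _ _ => E.
pose e1 := emb (zadd (zadd a f) k).
pose e2 := emb (zadd (zadd (zadd (zmul t n a f) (zneg (zmul t n b e)))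
  (zadd (zmul t n a k) (zneg (zmul t n c i)))) (zadd (zmul t n f k) (zneg (zmul t n h j)))).
pose e3 := emb (m3_det zadd (zmul t n) zneg (M3 a b c e f h i j k)).
pose p := Poly [:: - e3; e2; - e1; 1].
have ps : p = [:: - e3; e2; - e1; 1] :> seq C.
  by apply: (@PolyK _ 0); rewrite /= oner_eq0.
apply: (@integral_root_monic _ _ _ _ p).
- by rewrite monicE /lead_coef ps.
- rewrite /root horner_Poly /=; apply/eqP; transitivity (- \det (A - w%:M)).
    rewrite /A.
  2: by rewrite E oppr0.
  rewrite det_mx3 !mxE /= /e1 /e2 /e3 /m3_det /m3_minor !(embD, embN, embM C qd).
  rewrite ?mulr1n ?mulr0n; ring.
move=> x; rewrite ps !inE => /or4P[] /eqP->; try exact: (zint_emb C qd).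
- by apply: integral_opp; exact: (zint_emb C qd).
- by apply: integral_opp; exact: (zint_emb C qd).
exact: integral1.
Qed.

Variable g : Z * Z.
Hypothesis g0 : g != (0, 0)%zz.

Lemma embg0 : emb g != 0.
Proof. by apply: contraNneq g0 => /(emb_eq0 qd)->. Qed.

(** If r is an eigenvalue of 1 + g X, then (r - 1) / g is one of X. *)
Lemma zint_congruent (A : 'M[C]_3) X r : A = 1%:M + emb g *: mx X ->
  \det (A - r%:M) = 0 -> zint ((r - 1) / emb g).
Proof.
move=> -> E; apply: (@zint_eigenvalue X); apply: (mulfI (expf_neq0 3 embg0)).
rewrite mulr0 -detZ -E; congr determinant.
rewrite scalerBr scale_scalar_mx mulrCA mulfV ?embg0 // mulr1 raddfB /=.
by rewrite opprB addrCA addrA.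
Qed.

Lemma zint_unity (z : C) k : (0 < k)%N -> z ^+ k = 1 -> zint z.
Proof.
move=> k0 zk; apply: (@integral_root_monic _ _ _ _ ('X^k - 1)).
- by rewrite monicXnsubC.
- by rewrite /root !hornerE zk subrr.
move=> x /(nthP 0)[i _ <-]; rewrite -polyC1 coefB coefXn coefC.
apply: integral_sub; first exact: integral_nat.
by case: ifP => _; [exact: integral1|exact: integral0].
Qed.

(** If no root of q = 1 + X + ... + X^(p-1) were an eigenvalue, q(A) would be invertible; but (A -
    1) q(A) = 0, so A would be 1. A root of q that is a p-th root of unity is not 1, hence
    primitive. *)
Lemma eigen_unity (A : 'M[C]_3) p : prime p -> A ^+ p = 1 -> A <> 1 ->
  exists2 r, p.-primitive_root r & \det (A - r%:M) = 0.
Proof.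
move=> pp Ap A1; pose q : {poly C} := \sum_(i < p) 'X^i.
have qA : horner_mx A q = \sum_(i < p) A ^+ i.
  by rewrite rmorph_sum /=; apply: eq_bigr => i _; rewrite rmorphXn /= horner_mx_X.
have dS : \det (horner_mx A q) = 0.
  apply/eqP/negPn/negP => dS; apply: A1; apply/eqP; rewrite -subr_eq0.
  have uS : horner_mx A q \is a GRing.unit by rewrite unitmxE unitfE.
  have E : (A - 1) * horner_mx A q = 0 by rewrite qA -subrX1 Ap subrr.
  by rewrite -[_ - 1](mulrK uS) E mul0r.
have [rs Eq] := closed_field_poly_normal q.
have qn : q != 0.
  apply/eqP => q0; have := subrX1 ('X : {poly C}) p; rewrite -/q q0 mulr0 => /eqP.
  by rewrite -size_poly_eq0 size_XnsubC ?prime_gt0.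
have lq : lead_coef q != 0 by rewrite lead_coef_eq0.
have hX z : horner_mx A ('X - z%:P) = A - z%:M.
  by rewrite rmorphB /= horner_mx_X horner_mx_C.
have [r rrs dr] : exists2 r, r \in rs & \det (A - r%:M) = 0.
  have : \det (horner_mx A (\prod_(z <- rs) ('X - z%:P))) = 0.
    move: dS; rewrite Eq linearZ /= detZ => /eqP; rewrite mulf_eq0 expf_eq0 (negPf lq) andbF.
    by move/eqP.
  elim: (rs) => [|z s IH].
    by rewrite big_nil rmorph1 det1 => /eqP; rewrite oner_eq0.
  rewrite big_cons rmorphM /= det_mulmx hX => /eqP; rewrite mulf_eq0 => /orP[] /eqP.
    by exists z; rewrite ?mem_head.
  by case/IH=> r rs' dr; exists r => //; rewrite inE rs' orbT.
have qr : root q r by rewrite Eq rootZ // root_prod_XsubC.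
have rp : r ^+ p = 1.
  apply/eqP; rewrite -subr_eq0; have := congr1 (fun f => f.[r]) (subrX1 ('X : {poly C}) p).
  by rewrite -/q hornerM (eqP qr) mulr0 !hornerE => ->.
have r1 : r != 1.
  apply: contraTneq qr => ->; rewrite /root horner_sum.
  under eq_bigr do rewrite hornerXn expr1n.
  by rewrite sumr_const card_ord pnatr_eq0 -lt0n prime_gt0.
exists r => //.
have [m mr mp] := prim_order_exists (prime_gt0 pp) rp.
have [_ pd] := primeP pp; case/orP: (pd m mp) => /eqP Em; last by rewrite -Em.
by have := prim_expr_order mr; rewrite Em expr1 => E; rewrite E eqxx in r1.
Qed.

Lemma prod_1_subX (p : nat) (r : C) : (0 < p)%N -> p.-primitive_root r ->
  \prod_(1 <= i < p) (1 - r ^+ i) = p%:R.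
Proof.
move=> p0 rp; have E := factor_Xn_sub_1 rp.
have {}E : \prod_(1 <= i < p) ('X - (r ^+ i)%:P) = \sum_(i < p) 'X^i :> {poly C}.
  apply: (mulfI (negbT (polyXsubC_eq0 (1 : C)))).
  by rewrite polyC1 -subrX1 -E [in RHS]big_ltn // expr0 polyC1.
have := congr1 (fun f => f.[1]) E; rewrite horner_prod horner_sum.
under eq_bigr do rewrite hornerXsubC.
by move=> ->; under eq_bigr do rewrite hornerXn expr1n; rewrite sumr_const card_ord.
Qed.

(** In p = prod (1 - r^i), each of the p - 1 factors is a multiple of 1 - r, hence of g, among
    algebraic integers. So p / g^(p-1) is integral, and it lies in the quadratic field. *)
Lemma kernel_torsion (M X : m3 (Z * Z)) p : prime p ->
  mx M = 1%:M + emb g *: mx X -> mx M ^+ p = 1 -> mx M <> 1 ->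
  exists y, p%:R = emb g ^+ p.-1 * emb y.
Proof.
move=> pp EM Mp M1; have [r rp dr] := eigen_unity pp Mp M1.
have p0 := prime_gt0 pp.
have zr : zint r by apply: (zint_unity p0); apply: prim_expr_order.
have z1 := zint_congruent EM dr.
have zi i : zint ((r ^+ i - 1) / emb g).
  rewrite subrX1 mulrAC; apply: integral_mul => //.
  elim/big_ind: _ => [|x y|j _]; [exact: integral0|exact: integral_add|].
  elim: (nat_of_ord j) => [|k IH]; first by rewrite expr0; exact: integral1.
  by rewrite exprS; apply: integral_mul.
have zP : zint (p%:R / emb g ^+ p.-1).
  rewrite -(prod_1_subX p0 rp).
  have -> : \prod_(1 <= i < p) (1 - r ^+ i) / emb g ^+ p.-1 =
      \prod_(1 <= i < p) - ((r ^+ i - 1) / emb g).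
    under [RHS]eq_bigr do rewrite -mulNr opprB.
    by rewrite big_split /= prodr_const_nat subn1 exprVn.
  elim/big_ind: _ => [|x y|j _]; [exact: integral1|exact: integral_mul|].
  exact: integral_opp.
have : ring_of_integers d (p%:R / emb g ^+ p.-1).
  split=> //; have [P EP] : exists P, emb g ^+ p.-1 = emb P.
    elim: p.-1 => [|k [P EP]]; first by exists (1, 0)%zz; rewrite emb1.
    by exists (zmul t n g P); rewrite exprS EP (embM C qd).
  rewrite EP -(zC_nat C) -(emb_zC C d); apply: ztau_field.
  apply/eqP => P0; have := expf_neq0 p.-1 embg0; rewrite EP P0 emb0 eqxx //.
case/(ring_of_integersP qd sd) => y Ey; exists y.
by rewrite -Ey mulrC divfK // expf_neq0 // embg0.
Qed.

(** Taking norms in [kernel_torsion], N(g)^(p-1) divides p^2, against [norm_pow_gt]. *)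
Lemma congruent_free (M X : m3 (Z * Z)) p : (4 < Z.to_nat (znorm t n g))%N -> prime p ->
  mx M = 1%:M + emb g *: mx X -> mx M ^+ p = 1 -> mx M = 1.
Proof.
move=> N4 pp EX Mp; apply: contrapT => M1.
have [y Ey] := kernel_torsion pp EX Mp M1.
have E : p%:R ^+ 2 = zC C (znorm t n g) ^+ p.-1 * zC C (znorm t n y).
  rewrite -!(emb_norm C qd) exprMn expr2 {1}Ey -(rmorph_nat Num.conj p) Ey.
  by rewrite rmorphM rmorphXn /=; ring.
have Eg : znorm t n g = Z.of_nat (Z.to_nat (znorm t n g)).
  by rewrite Z2Nat.id //; exact: (znorm_ge0 C qd).
have Ey' : znorm t n y = Z.of_nat (Z.to_nat (znorm t n y)).
  by rewrite Z2Nat.id //; exact: (znorm_ge0 C qd).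
move: E; rewrite Eg Ey' !zC_nat -!natrX -natrM => /eqP; rewrite eqr_nat => /eqP E.
have := norm_pow_gt N4 (prime_gt1 pp); rewrite E.
case: (Z.to_nat (znorm t n y)) E => [|m] E; last by rewrite ltnNge leq_pmulr.
by move: E; rewrite muln0 => /eqP; rewrite expn_eq0 => /andP[/eqP p0 _]; rewrite p0 in pp.
Qed.
End Kernel.

(** * Unipotent stabilisers of cusps *)

Section Unipotent.
Variable F : fieldType.

Lemma ord3D : ((1 + 1 = 2%:R :> 'I_3)%R * (1 + 2%:R = 0 :> 'I_3)%R *
  (2%:R + 1 = 0 :> 'I_3)%R * (2%:R + 2%:R = 1 :> 'I_3)%R)%type.
Proof. by do !split; apply: val_inj. Qed.

(** The cross product of two vectors orthogonal to v is parallel to v; adding indices in ['I_3] is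
    cyclic. *)
Lemma cross_parallel (a b v : 'I_3 -> F) :
  let c (i : 'I_3) := a (i + 1) * b (i + 2%:R) - a (i + 2%:R) * b (i + 1) in
  a 0 * v 0 + a 1 * v 1 + a 2%:R * v 2%:R = 0 ->
  b 0 * v 0 + b 1 * v 1 + b 2%:R * v 2%:R = 0 ->
  forall i k, c i * v k = c k * v i.
Proof.
move=> c av bv i k.
have ord3 (x : 'I_3) : [\/ x = 0, x = 1 | x = 2%:R].
  by case: x => [[|[|[|]]]] // ?; [apply: Or31|apply: Or32|apply: Or33]; apply: val_inj.
have E01 : c 0 * v 1 - c 1 * v 0 = 0.
  transitivity (b 2%:R * (a 0 * v 0 + a 1 * v 1 + a 2%:R * v 2%:R) -
    a 2%:R * (b 0 * v 0 + b 1 * v 1 + b 2%:R * v 2%:R)); last by rewrite av bv; ring.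
  have -> : c 0 = a 1 * b 2%:R - a 2%:R * b 1 by rewrite /c ?add0r ?ord3D.
  have -> : c 1 = a 2%:R * b 0 - a 0 * b 2%:R by rewrite /c ?add0r ?ord3D.
  by ring.
have E02 : c 0 * v 2%:R - c 2%:R * v 0 = 0.
  transitivity (a 1 * (b 0 * v 0 + b 1 * v 1 + b 2%:R * v 2%:R) -
    b 1 * (a 0 * v 0 + a 1 * v 1 + a 2%:R * v 2%:R)); last by rewrite av bv; ring.
  have -> : c 0 = a 1 * b 2%:R - a 2%:R * b 1 by rewrite /c ?add0r ?ord3D.
  have -> : c 2%:R = a 0 * b 1 - a 1 * b 0 by rewrite /c ?add0r ?ord3D.
  by ring.
have E12 : c 1 * v 2%:R - c 2%:R * v 1 = 0.
  transitivity (b 0 * (a 0 * v 0 + a 1 * v 1 + a 2%:R * v 2%:R) -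
    a 0 * (b 0 * v 0 + b 1 * v 1 + b 2%:R * v 2%:R)); last by rewrite av bv; ring.
  have -> : c 1 = a 2%:R * b 0 - a 0 * b 2%:R by rewrite /c ?add0r ?ord3D.
  have -> : c 2%:R = a 0 * b 1 - a 1 * b 0 by rewrite /c ?add0r ?ord3D.
  by ring.
move/subr0_eq: E01; move/subr0_eq: E02; move/subr0_eq: E12 => E12 E02 E01.
by case: (ord3 i) => ->; case: (ord3 k) => ->.
Qed.

(** Entry (i, j) of the adjugate: with cyclic indices the cofactor signs disappear. *)
Definition cof (N : 'M[F]_3) (i j : 'I_3) : F :=
  N (j + 1) (i + 1) * N (j + 2%:R) (i + 2%:R) - N (j + 1) (i + 2%:R) * N (j + 2%:R) (i + 1).

Lemma sum3 (f : 'I_3 -> F) : \sum_i f i = f 0 + f 1 + f 2%:R.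
Proof.
rewrite !big_ord_recl big_ord0 addr0 addrA.
by congr (_ + f _ + f _); apply: val_inj.
Qed.

(** The columns of the adjugate of N are parallel to v and its rows to w, so it is a multiple of v
    w, whose trace is w v = 0. *)
Lemma trace_cof0 (N : 'M[F]_3) (v : 'cV_3) (w : 'rV_3) : v != 0 -> w != 0 ->
  N *m v = 0 -> w *m N = 0 -> w *m v = 0 -> cof N 0 0 + cof N 1 1 + cof N 2%:R 2%:R = 0.
Proof.
move=> v0 w0 Nv wN wv.
have Nv' i : N i 0 * v 0 0 + N i 1 * v 1 0 + N i 2%:R * v 2%:R 0 = 0.
  by have := congr1 (fun A : 'cV_3 => A i 0) Nv; rewrite !mxE sum3.
have wN' j : w 0 0 * N 0 j + w 0 1 * N 1 j + w 0 2%:R * N 2%:R j = 0.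
  by have := congr1 (fun A : 'rV_3 => A 0 j) wN; rewrite !mxE sum3.
have wv' : w 0 0 * v 0 0 + w 0 1 * v 1 0 + w 0 2%:R * v 2%:R 0 = 0.
  by have := congr1 (fun A : 'M_1 => A 0 0) wv; rewrite !mxE sum3.
have colP i j k : cof N i j * v k 0 = cof N k j * v i 0.
  exact: (@cross_parallel (N (j + 1)) (N (j + 2%:R)) (fun i => v i 0)).
have rowP i j l : cof N i j * w 0 l = cof N i l * w 0 j.
  have := @cross_parallel (fun x => N x (i + 1)) (fun x => N x (i + 2%:R)) (w 0).
  move=> /(_ _ _ j l) H; rewrite /cof [N (j + 1) (i + 2%:R) * _]mulrC [N (l + 1) (i + 2%:R) * _]mulrC.
  by apply: H; [rewrite -[RHS](wN' (i + 1)) | rewrite -[RHS](wN' (i + 2%:R))]; ring.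
have [k vk] : exists k, v k 0 != 0.
  apply/existsP; apply: contraNT v0; rewrite negb_exists => /forallP H.
  by apply/eqP/matrixP => i j; rewrite ord1 mxE; apply/eqP; have := H i; rewrite negbK.
have [l wl] : exists l, w 0 l != 0.
  apply/existsP; apply: contraNT w0; rewrite negb_exists => /forallP H.
  by apply/eqP/matrixP => i j; rewrite ord1 mxE; apply/eqP; have := H j; rewrite negbK.
have R (a b c x y : F) : (a + b + c) * x * y = a * x * y + b * x * y + c * x * y by ring.
have R2 (a b c x y z u : F) :
  a * x * u + b * y * u + c * z * u = (a * u) * x + (b * u) * y + (c * u) * z by ring.
apply: (mulIf vk); apply: (mulIf wl); rewrite !mul0r R !(colP _ _ k) R2 !(rowP k _ l).
by rewrite -!mulrA -!mulrDr wv' mulr0.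
Qed.

Lemma cayley_hamilton3 (N : 'M[F]_3) : N ^+ 3 = (N 0 0 + N 1 1 + N 2%:R 2%:R) *: N ^+ 2
    - (cof N 0 0 + cof N 1 1 + cof N 2%:R 2%:R) *: N + (\det N)%:M.
Proof.
have C0 : cof N 0 0 = N 1 1 * N 2%:R 2%:R - N 1 2%:R * N 2%:R 1 by rewrite /cof ?add0r ?ord3D.
have C1 : cof N 1 1 = N 2%:R 2%:R * N 0 0 - N 2%:R 0 * N 0 2%:R by rewrite /cof ?add0r ?ord3D.
have C2 : cof N 2%:R 2%:R = N 0 0 * N 1 1 - N 0 1 * N 1 0 by rewrite /cof ?add0r ?ord3D.
rewrite C0 C1 C2 det_mx3 exprS expr2 -!mulmxE.
by apply/mx3P; split; rewrite !mxE !sum3 !mxE !sum3 ?mulr1n ?mulr0n; ring.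
Qed.

Lemma mul_cof_mx (N : 'M[F]_3) : (\matrix_(i, j) cof N i j) *m N = (\det N)%:M.
Proof.
rewrite det_mx3; apply/mx3P; split; rewrite !mxE sum3 !mxE /cof ?add0r ?ord3D ?mulr1n ?mulr0n;
  by ring.
Qed.

Lemma cube_nilpotent (N : 'M[F]_3) : N 0 0 + N 1 1 + N 2%:R 2%:R = 0 ->
  cof N 0 0 + cof N 1 1 + cof N 2%:R 2%:R = 0 -> \det N = 0 -> N ^+ 3 = 0.
Proof.
move=> e1 e2 e3.
by rewrite cayley_hamilton3 e1 e2 e3 !scale0r subrr add0r raddf0.
Qed.

(** For N = A - 1, the determinant and the second symmetric function e2 vanish; det (1 + N) = 1 + tr
    N + e2 + det N then kills the trace, and Cayley-Hamilton gives N^3 = 0. *)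
Lemma unipotent_of_fixed (A : 'M[F]_3) (v : 'cV_3) (w : 'rV_3) : v != 0 -> w != 0 ->
  A *m v = v -> w *m A = w -> w *m v = 0 -> \det A = 1 -> (A - 1) ^+ 3 = 0.
Proof.
move=> v0 w0 Av wA wv dA.
have Nv : (A - 1) *m v = 0 by rewrite mulmxBl Av mul1mx subrr.
have wN : w *m (A - 1) = 0 by rewrite mulmxBr wA mulmx1 subrr.
have e2 := trace_cof0 v0 w0 Nv wN wv.
have e3 : \det (A - 1) = 0.
  apply/eqP/negPn/negP => nd; case/eqP: v0.
  have u : A - 1 \in unitmx by rewrite unitmxE unitfE.
  by rewrite -[v]mul1mx -(mulVmx u) -mulmxA Nv mulmx0.
apply: cube_nilpotent => //.
set N := A - 1 in e2 e3 *.
have -> : N 0 0 + N 1 1 + N 2%:R 2%:R =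
  \det A - 1 - (cof N 0 0 + cof N 1 1 + cof N 2%:R 2%:R) - \det N.
  have -> : A = N + 1 by rewrite subrK.
  have C0 : cof N 0 0 = N 1 1 * N 2%:R 2%:R - N 1 2%:R * N 2%:R 1 by rewrite /cof ?add0r ?ord3D.
  have C1 : cof N 1 1 = N 2%:R 2%:R * N 0 0 - N 2%:R 0 * N 0 2%:R by rewrite /cof ?add0r ?ord3D.
  have C2 : cof N 2%:R 2%:R = N 0 0 * N 1 1 - N 0 1 * N 1 0 by rewrite /cof ?add0r ?ord3D.
  rewrite C0 C1 C2 !det_mx3; clearbody N.
  have NE (i j : 'I_3) : (N + 1) i j = N i j + (i == j)%:R by rewrite !mxE.
  have neq : (((0 : 'I_3) == 1) = false) * (((0 : 'I_3) == 2%:R) = false) *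
    (((1 : 'I_3) == 0) = false) * (((1 : 'I_3) == 2%:R) = false) *
    (((2%:R : 'I_3) == 0) = false) * (((2%:R : 'I_3) == 1) = false) by [].
  by rewrite !NE !neq !eqxx mulr1n mulr0n; ring.
by rewrite dA e2 e3 !subr0 subrr.
Qed.
End Unipotent.

(** * Torsion and cusps of congruence subgroups *)

Definition rpow (L : level) (h : m3 nat) (k : nat) : m3 nat :=
  iter k (rmm L h) (m3_scal 0%N 1%N).

Definition exponent_ok (L : level) (S : seq (seq (m3 nat))) (q : nat) : bool :=
  all (fun h => m3_seq (rpow L h q) == m3_seq (m3_scal 0%N 1%N)) (products L S).


Lemma znorm1 t n : znorm t n (1, 0)%zz = 1%zz.
Proof. by rewrite /znorm /=; lia. Qed.

Section Torsion.
Variables (C : numClosedFieldType) (d : nat) (L : level) (us : seq (Z * Z)).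
Local Notation t := (lv_t L).
Local Notation n := (lv_n L).
Local Notation g := (lv_gam L).
Local Notation emb := (emb C d).
Hypothesis (qd : quad d t n) (sd : sqfree d) (Lok : level_ok L).
Hypothesis gamc : zdvd t n g (zconj t g).
Hypothesis unitsP : forall u, znorm t n u = 1%zz -> u \in us.
Hypothesis units12 : forall u, u \in us -> emb u ^+ 12 = 1.
Hypothesis units_uniq : uniq [seq rres L u | u <- us].
Local Notation mx := (mxm emb).
Local Notation M3mul := (m3_mul zadd (zmul t n)).
Local Notation M3adj := (m3_adj (zconj t)).
Local Notation M3det := (m3_det zadd (zmul t n) zneg).
Local Notation M31 := (m3_scal (0, 0)%zz (1, 0)%zz).
Local Notation isG := (isG t n).
Local Notation lifts := (@lifts C d).
Local Notation code := (rcode L).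
Local Notation one := (m3_scal 0%N 1%N).
Local Notation res := (rres L).

Lemma unit_res_inj u v : znorm t n u = 1%zz -> znorm t n v = 1%zz -> res u = res v -> u = v.
Proof.
move=> /unitsP uu /unitsP vu E.
have si x : x \in us -> (index x us < size [seq res u | u <- us])%N.
  by move=> xu; rewrite size_map index_mem.
have := nth_uniq 0%N (si _ uu) (si _ vu) units_uniq.
rewrite !(nth_map (0, 0)%zz) ?index_mem // !nth_index // E eqxx => /esym/eqP Ei.
by rewrite -(nth_index (0, 0)%zz uu) Ei nth_index.
Qed.

Local Notation mpow := (mpow t n).

Lemma code_mpow M k : code (mpow M k) = rpow L (code M) k.
Proof. by elim: k => [|k IH]; rewrite ?(code1 Lok) // /= (codeM C qd Lok) IH. Qed.

Lemma rpow_one k : rpow L one k = one.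
Proof.
elim: k => // k IH; rewrite /rpow iterS -/(rpow L one k) IH.
by rewrite (rmm1 C qd Lok) // -(code1 Lok) (code_ranged C qd Lok).
Qed.

Lemma code_one_congruent M : code M = one -> exists X, mx M = 1%:M + emb g *: mx X.
Proof.
have H p q : res p = res q -> exists x, emb p = emb q + emb g * emb x.
  by move=> /(res_cong C qd Lok)/(congP C qd Lok).
have H0 p : res p = 0%N -> exists x, emb p = emb g * emb x.
  by rewrite -(res0 Lok) => /H[x Ex]; exists x; rewrite Ex emb0 add0r.
have H1 p : res p = 1%N -> exists x, emb p = 1 + emb g * emb x.
  by rewrite -(res1 Lok) => /H[x Ex]; exists x; rewrite Ex emb1.
case: M => a b c e f h i j k [] /=.
move=> /H1[a' Ea] /H0[b' Eb] /H0[c' Ec] /H0[e' Ee] /H1[f' Ef] /H0[h' Eh] /H0[i' Ei] /H0[j' Ej] /H1[k' Ek].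
exists (M3 a' b' c' e' f' h' i' j' k').
by apply/mx3P; split; rewrite !mxE /= ?mulr1n ?mulr0n ?(Ea, Eb, Ec, Ee, Ef, Eh, Ei, Ej, Ek) ?add0r.
Qed.

Lemma kernel_free M p : (4 < Z.to_nat (znorm t n g))%N -> prime p ->
  code M = one -> mx M ^+ p = 1 -> mx M = 1.
Proof.
by move=> N4 pp /code_one_congruent[X EX]; apply: (congruent_free qd sd (gam_neq0 Lok) N4 pp EX).
Qed.

Variable S : seq (seq (m3 nat)).
Hypotheses (Sok : sub_ok L S) (Uok : scal_ok L us S).
Local Notation HL := (products L S).
Local Notation H := (@Hset C d L HL).

Let HLpow h k : h \in HL -> rpow L h k \in HL.
Proof.
have [_ H1 HM _ _] := subP C qd Lok gamc Sok.
by move=> hH; elim: k => [|k IH] //=; apply: HM.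
Qed.

Lemma rpowM h a b : h \in HL -> rpow L h (a * b) = rpow L (rpow L h a) b.
Proof.
have [rS _ _ _ _] := subP C qd Lok gamc Sok.
move=> hH; have /(code_surj Lok)[M <-] := allP (products_ranged C qd Lok rS) _ hH.
by rewrite -!code_mpow; congr code; apply: (mx_inj (C := C) qd); rewrite !(mx_mpow C qd) exprM.
Qed.

(** Some power of a nontrivial torsion element has prime order p. If p differs from p0, a suitable
    exponent divisible by q fixes that element while sending its lift into the kernel of reduction,
    where torsion is excluded. The remaining prime p0 is left to the hypothesis on lifts with scalar
    p0-th power. *)
Lemma Hset_torsion_free p0 q : prime p0 -> p0.-nat q -> exponent_ok L S q ->
  (4 < Z.to_nat (znorm t n g))%N ->
  (forall M u, isG M -> code M \in HL -> znorm t n u = 1%zz -> emb u ^+ 3 = 1 ->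
     mx M ^+ p0 = (emb u)%:M -> exists s, mx M = s%:M) ->
  torsion_free H.
Proof.
move=> pp0 p0q qok N4 Hp0 x k Hx k0 xk; apply: contrapT => x1.
have [_ H1 HM _ _] := subP C qd Lok gamc Sok.
have [a [p [pp y1 yp]]] := prime_order_power k0 xk (introN eqP x1).
have [M0 [gM0 lM0 cM0]] := Hx.
pose M := mpow M0 a; set y := (x ^+ a)%g in y1 yp.
have gM : isG M by apply: (isG_mpow C qd).
have lM : lifts M y by apply: (lifts_mpow qd).
have cM : code M \in HL by rewrite code_mpow; apply: HLpow.
have scalar_trivial N s : isG N -> lifts N y -> mx N = s%:M -> False.
  move=> gN [A EA EAN] EN; case/eqP: y1; rewrite -EA.
  have s0 : s != 0.
    by apply: contraNneq (U_neq0 A) => s0; rewrite EAN EN s0 raddf0.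
  apply/eqmodP; apply/proportionalP; exists s; first exact: s0.
  by rewrite EAN EN scalemx1.
case: (altP (p =P p0)) => [Ep|np].
  have lMp := lifts_mpow qd p lM; rewrite yp in lMp.
  have [u [Eu nu u3]] := lifts_unit qd unitsP units12 (isG1 C qd) (isG_mpow C qd p gM) (lifts1 C d) lMp.
  have Hm : mx M ^+ p0 = (emb u)%:M.
    by rewrite -Ep -(mx_mpow C qd) Eu (mx_smul C qd) mx1 scalemx1.
  have [s Es] := Hp0 M u gM cM nu u3 Hm.
  exact: (scalar_trivial M s gM lM Es).
have cpq : coprime q p.
  by rewrite (pnat_coprime p0q) // /pnat prime_gt0 //= primes_prime //= andbT inE.
have q0 : (0 < q)%N by case/andP: p0q.
(* Since q z = 1 modulo p, the power [N] of M still lifts y, while its residue is trivial because q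
   kills [HL]. *)
have [z zq] : exists z, (q * z = 1 %[mod p])%N.
  case: (egcdnP p q0) => z l E _; exists z; rewrite mulnC E (eqP cpq).
  by rewrite modnMDl.
pose N := mpow M (q * z).
have cN : code N = one.
  rewrite code_mpow rpowM //; have /allP/(_ _ cM)/eqP/m3_seq_inj-> := qok.
  exact: rpow_one.
have lN : lifts N y.
  have := lifts_mpow qd (q * z) lM; congr lifts.
  by rewrite (divn_eq (q * z) p) zq expgnDr mulnC expgnA yp expg1n mul1g modn_small ?prime_gt1 // expg1.
have gN : isG N by apply: (isG_mpow C qd).
have lNp := lifts_mpow qd p lN; rewrite yp in lNp.
have [u [Eu nu u3]] := lifts_unit qd unitsP units12 (isG1 C qd) (isG_mpow C qd p gN) (lifts1 C d) lNp.
(* The scalar u is congruent to 1, and distinct units stay distinct modulo g. *)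
have u1 : u = (1, 0)%zz.
  apply: unit_res_inj; [exact: nu | exact: znorm1 |].
  rewrite (res1 Lok); have := code_mpow N p; rewrite cN Eu.
  rewrite rpow_one.
  by case=> + _ _ _ _ _ _ _ _; rewrite (_ : zmul t n u (1, 0)%zz = u) //; apply: (emb_inj (C := C) qd); rewrite (embM C qd) emb1 mulr1.
apply: (scalar_trivial N 1 gN lN); apply: (kernel_free N4 pp cN).
by rewrite -(mx_mpow C qd) Eu (mx_smul C qd) u1 emb1 scale1r mx1.
Qed.
End Torsion.

(* Every residue not divisible by pi has a multiple equal to unit_class, which is
   1 unless pi is a proper factor of a split prime. *)
Definition reaches (L : level) (e : nat) : bool :=
  all (fun r => zdvd (lv_t L) (lv_n L) (lv_pi L) r ||
    has (fun j => rmul L (rres L r) j == e) (iota 0 (size (lv_rep L)))) (lv_rep L).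

Definition unit_class (L : level) : nat :=
  find (fun e => (e != 0%N) && reaches L e) (iota 0 (size (lv_rep L))).

Definition prim_ok (L : level) : bool :=
  [&& (1 <? znorm (lv_t L) (lv_n L) (lv_pi L))%zz, unit_class L != 0%N & reaches L (unit_class L)].

Definition vectors1 (L : level) : seq (nat * nat * nat) :=
  let I := iota 0 (size (lv_rep L)) in let e := unit_class L in
  [seq (e, a, b) | a <- I, b <- I] ++ [seq (a, e, b) | a <- I, b <- I] ++
  [seq (a, b, e) | a <- I, b <- I].

Definition v3_smul (L : level) (l : nat) (u : nat * nat * nat) :=
  let: (a, b, c) := u in (rmul L l a, rmul L l b, rmul L l c).

Definition has_eig (L : level) (h : m3 nat) (l : nat) (V : seq (nat * nat * nat)) :=
  has (fun u => m3_app (radd L) (rmul L) h u == v3_smul L l u) V.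

(** The residual form of det M = lam^3 for an element fixing a cusp with eigenvalue lam; dividing by
    lam then leaves determinant 1. *)
Definition neat_ok (L : level) (us : seq (Z * Z)) (S : seq (seq (m3 nat))) : bool :=
  let V := [seq u <- vectors1 L | null_vec L u] in
  let cs := [seq (rres L c, rres L (zcube (lv_t L) (lv_n L) c)) | c <- us] in
  all (fun h => all (fun c => has_eig L h c.1 V ==>
    (m3_det (radd L) (rmul L) (rneg L) h == c.2)) cs) (products L S).

Lemma Zsum3_eq0 a b c : (0 <= a)%zz -> (0 <= b)%zz -> (0 <= c)%zz -> (a + b + c <= 0)%zz ->
  [/\ a = 0, b = 0 & c = 0]%zz.
Proof. by move=> *; split; lia. Qed.

Lemma Zsum3_lt q a b c : (0 <= a)%zz -> (0 <= b)%zz -> (0 <= c)%zz -> (0 < a + b + c)%zz ->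
  (1 < q)%zz -> (Z.to_nat (a + b + c)%zz < Z.to_nat (q * a + q * b + q * c)%zz)%N.
Proof.
move=> a0 b0 c0 s0 q1; apply/ssrnat.ltP/Z2Nat.inj_lt; nia.
Qed.

(** * Normalised integral vectors *)

Section Cusps.
Variables (C : numClosedFieldType) (d : nat) (L : level) (us : seq (Z * Z)).
Local Notation t := (lv_t L).
Local Notation n := (lv_n L).
Local Notation g := (lv_gam L).
Local Notation emb := (emb C d).
Hypothesis (qd : quad d t n) (sd : sqfree d) (Lok : level_ok L).
Hypothesis gamc : zdvd t n g (zconj t g).
Hypothesis unitsP : forall u, znorm t n u = 1%zz -> u \in us.
Hypothesis units12 : forall u, u \in us -> emb u ^+ 12 = 1.
Hypothesis units_uniq : uniq [seq rres L u | u <- us].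
Hypothesis Pok : prim_ok L.
Local Notation mx := (mxm emb).
Local Notation M3mul := (m3_mul zadd (zmul t n)).
Local Notation M3adj := (m3_adj (zconj t)).
Local Notation M3det := (m3_det zadd (zmul t n) zneg).
Local Notation M31 := (m3_scal (0, 0)%zz (1, 0)%zz).
Local Notation M3app := (m3_app zadd (zmul t n)).
Local Notation isG := (isG t n).
Local Notation lifts := (@lifts C d).
Local Notation code := (rcode L).
Local Notation res := (rres L).
Local Notation pi := (lv_pi L).
Notation zint := (integralOver (intr : int -> C)).

Definition colv (u : Z * Z * (Z * Z) * (Z * Z)) : 'cV[C]_3 :=
  \col_i emb (nth (0, 0)%zz [:: u.1.1; u.1.2; u.2] i).
Definition vcode (u : Z * Z * (Z * Z) * (Z * Z)) : nat * nat * nat :=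
  (res u.1.1, res u.1.2, res u.2).
Definition zsmul (l : Z * Z) (u : Z * Z * (Z * Z) * (Z * Z)) :=
  (zmul t n l u.1.1, zmul t n l u.1.2, zmul t n l u.2).

Lemma col3P (v w : 'cV[C]_3) : v 0 0 = w 0 0 -> v 1 0 = w 1 0 -> v 2%:R 0 = w 2%:R 0 -> v = w.
Proof.
move=> a b c; apply/matrixP => i j; rewrite ord1.
have ord3 (x : 'I_3) : [\/ x = 0, x = 1 | x = 2%:R].
  by case: x => [[|[|[|]]]] // ?; [apply: Or31|apply: Or32|apply: Or33]; apply: val_inj.
by case: (ord3 i) => ->.
Qed.

Lemma colv_app M u : mx M *m colv u = colv (M3app M u).
Proof.
case: M => a b c e f h i j k; case: u => [[x y] z].
by apply: col3P; rewrite !mxE sum3 !mxE /= !(embD, embM C qd).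
Qed.

Lemma colv_smul l u : colv (zsmul l u) = emb l *: colv u.
Proof. by apply: col3P; rewrite !mxE /= (embM C qd). Qed.

Lemma colv_inj : injective colv.
Proof.
move=> [[x y] z] [[x' y'] z'] E.
have H i := congr1 (fun A : 'cV_3 => A i 0) E.
move: (H 0) (H 1) (H 2%:R); rewrite !mxE /=.
by do 3![move/(emb_inj (C := C) qd) => ->].
Qed.

Lemma vcode_app M u : vcode (M3app M u) = m3_app (radd L) (rmul L) (code M) (vcode u).
Proof.
case: M => a b c e f h i j k; case: u => [[x y] z].
by rewrite /vcode /= !(resD C qd Lok, resM C qd Lok).
Qed.

Lemma vcode_smul l u : vcode (zsmul l u) = v3_smul L (res l) (vcode u).
Proof. by case: u => [[x y] z]; rewrite /vcode /= !(resM C qd Lok). Qed.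

Lemma pi_neq0 : pi != (0, 0)%zz.
Proof. by move: Lok; case: (L) => ? ? ? ? ? ? ? ? ? ? ? ? ? /= /andP[/andP[/andP[/andP[/andP[/and3P[]]]]]]. Qed.
Lemma pi_dvd_gam : zdvd t n pi g.
Proof. by move: Lok; case: (L) => ? ? ? ? ? ? ? ? ? ? ? ? ? /= /andP[/andP[/andP[/andP[/andP[/and3P[]]]]]]. Qed.

Lemma unit_residue x : ~~ zdvd t n pi x ->
  exists2 y, res (zmul t n y x) = unit_class L & emb y != 0.
Proof.
move=> nx; have lx := res_lt C qd Lok x.
have /and3P[_ e0 /allP/(_ _ (mem_nth (0, 0)%zz lx))] := Pok.
have cx := cong_rep lx.
have -> : zdvd t n pi (nth (0, 0)%zz (lv_rep L) (res x)) = false.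
  apply: contraNF nx => /(zdvdP C qd _ pi_neq0)[q Eq].
  have [e Ee] := zdvdP C qd _ pi_neq0 pi_dvd_gam.
  have /(congP C qd Lok)[y Ey] := cx.
  apply/(zdvdP C qd _ pi_neq0); exists (zadd q (zmul t n e y)).
  by rewrite Ey Eq Ee embD (embM C qd); ring.
rewrite -/(res x) => /hasP[j]; rewrite mem_iota /= add0n => lj.
rewrite (resK Lok lx) => /eqP Ej; exists (nth (0, 0)%zz (lv_rep L) j).
  by rewrite (resM C qd Lok) (resK Lok lj) -Ej; rewrite !(rmulE Lok) ?resK //; congr residue;
     apply: (emb_inj (C := C) qd); rewrite !(embM C qd) mulrC.
apply/eqP => /(emb_eq0 qd) y0.
have := Ej; rewrite (rmulE Lok lx lj) y0.
have -> : zmul t n (nth (0, 0)%zz (lv_rep L) (res x)) (0, 0)%zz = (0, 0)%zz.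
  by apply: (emb_inj (C := C) qd); rewrite (embM C qd) emb0 mulr0.
by rewrite (res0 Lok) => e00; case/eqP: e0.
Qed.

(* Divide by pi until some coordinate is a unit modulo g, then normalise it. *)
Lemma primitive_vector u : colv u != 0 -> exists s u',
  [/\ s != 0, colv u' = s *: colv u & vcode u' \in vectors1 L].
Proof.
have norm0 x : (0 <= znorm t n x)%zz by exact: (znorm_ge0 C qd).
pose m (u : Z * Z * (Z * Z) * (Z * Z)) :=
  Z.to_nat (znorm t n u.1.1 + znorm t n u.1.2 + znorm t n u.2)%zz.
have [k] := ubnP (m u); elim: k u => // k IH u mu u0.
have fin y v : emb y != 0 -> vcode (zsmul y v) \in vectors1 L -> v = u -> exists s u',
    [/\ s != 0, colv u' = s *: colv u & vcode u' \in vectors1 L].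
  by move=> y0 vy Ev; exists (emb y), (zsmul y v); rewrite Ev in vy *; rewrite colv_smul.
have mI x : res x \in iota 0 (size (lv_rep L)) by rewrite mem_iota (res_lt C qd Lok).
case: (boolP (zdvd t n pi u.1.1)) => [|/unit_residue[y y1 y0]]; last first.
  apply: (fin y u) => //; rewrite /vcode /= y1 /vectors1 mem_cat.
  by apply/orP; left; apply/allpairsP; exists (res (zmul t n y u.1.2), res (zmul t n y u.2)); rewrite !mI.
case: (boolP (zdvd t n pi u.1.2)) => [|/unit_residue[y y1 y0] _]; last first.
  apply: (fin y u) => //; rewrite /vcode /= y1 /vectors1 !mem_cat.
  by apply/orP; right; apply/orP; left; apply/allpairsP; exists (res (zmul t n y u.1.1), res (zmul t n y u.2)); rewrite !mI.
case: (boolP (zdvd t n pi u.2)) => [|/unit_residue[y y1 y0] _ _]; last first.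
  apply: (fin y u) => //; rewrite /vcode /= y1 /vectors1 !mem_cat.
  by apply/orP; right; apply/orP; right; apply/allpairsP; exists (res (zmul t n y u.1.1), res (zmul t n y u.1.2)); rewrite !mI.
move=> /(zdvdP C qd _ pi_neq0)[c Ec] /(zdvdP C qd _ pi_neq0)[b Eb] /(zdvdP C qd _ pi_neq0)[a Ea].
have p0 : emb pi != 0 by apply: contraNneq pi_neq0 => /(emb_eq0 qd)->.
have Eu : colv u = emb pi *: colv (a, b, c) by apply: col3P; rewrite !mxE.
have u1 : colv (a, b, c) != 0 by apply: contraNneq u0 => E; rewrite Eu E scaler0.
have nM x y : emb x = emb pi * emb y -> znorm t n x = (znorm t n pi * znorm t n y)%zz.
  move=> E; apply: (zC_inj (C := C)); rewrite zCM -!(emb_norm C qd) E rmorphM /=; ring.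
have /and3P[/Z.ltb_spec0 lp _ _] := Pok.
have mu1 : (m (a, b, c) < m u)%N.
  rewrite /m /= (nM _ _ Ea) (nM _ _ Eb) (nM _ _ Ec).
  have na := norm0 a; have nb := norm0 b; have nc := norm0 c.
  apply: Zsum3_lt => //; case: (Z.lt_ge_cases 0 (znorm t n a + znorm t n b + znorm t n c)%zz) => // E.
  have Z0 x : znorm t n x = 0%zz -> x = (0, 0)%zz by exact: (znorm_eq0 C qd).
  have [/Z0 a0 /Z0 b0 /Z0 c0] := Zsum3_eq0 na nb nc E.
  by case/eqP: u1; rewrite a0 b0 c0; apply: col3P; rewrite !mxE /= emb0.
have [s [u' [s0 Eu' vu']]] := IH _ (leq_trans mu1 mu) u1.
exists (s / emb pi), u'; split=> //; first by rewrite mulf_neq0 ?invr_neq0.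
by rewrite Eu' Eu scalerA divfK.
Qed.
End Cusps.

Lemma Zmul_eq1 a b : (0 <= a)%zz -> (0 <= b)%zz -> (a * b = 1)%zz -> a = 1%zz.
Proof. by move=> a0 _ /(Z.eq_mul_1_nonneg _ _ a0)[]. Qed.

(** * Elements fixing a cusp *)

Section Neat.
Variables (C : numClosedFieldType) (d : nat) (L : level) (us : seq (Z * Z)).
Local Notation t := (lv_t L).
Local Notation n := (lv_n L).
Local Notation g := (lv_gam L).
Local Notation emb := (emb C d).
Hypothesis (qd : quad d t n) (sd : sqfree d) (Lok : level_ok L).
Hypothesis gamc : zdvd t n g (zconj t g).
Hypothesis unitsP : forall u, znorm t n u = 1%zz -> u \in us.
Hypothesis units12 : forall u, u \in us -> emb u ^+ 12 = 1.
Hypothesis units_uniq : uniq [seq rres L u | u <- us].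
Hypothesis Pok : prim_ok L.
Local Notation mx := (mxm emb).
Local Notation M3mul := (m3_mul zadd (zmul t n)).
Local Notation M3adj := (m3_adj (zconj t)).
Local Notation M3det := (m3_det zadd (zmul t n) zneg).
Local Notation M31 := (m3_scal (0, 0)%zz (1, 0)%zz).
Local Notation isG := (isG t n).
Local Notation lifts := (@lifts C d).
Local Notation code := (rcode L).
Local Notation res := (rres L).
Local Notation colv := (colv C d).
Notation zint := (integralOver (intr : int -> C)).

Lemma null_code u : (colv u) ^t* *m J C *m colv u = 0 -> null_vec L (vcode L u).
Proof.
case: u => [[x y] z] E; apply: (code_null C qd Lok gamc); apply: (zC_inj (C := C)).
have := congr1 (fun A : 'M_1 => A 0 0) E.
rewrite -mulmxA !mxE sum3 !mxE !sum3 !mxE /= => E'.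
rewrite rmorph0 -E' zCD -(emb_norm C qd) (ztrE C _ qd) (embM C qd) rmorphM /=.
by rewrite -!(emb_conj C qd) conjCK; ring.
Qed.

Lemma eigen_code M u lam : colv u != 0 -> mx M *m colv u = emb lam *: colv u ->
  has_eig L (code M) (res lam) (vectors1 L) /\
  ((colv u) ^t* *m J C *m colv u = 0 ->
   has_eig L (code M) (res lam) [seq u <- vectors1 L | null_vec L u]).
Proof.
move=> u0 Mu; have [s [u' [s0 Eu' vu']]] := primitive_vector qd Lok Pok u0.
have E : m3_app (radd L) (rmul L) (code M) (vcode L u') == v3_smul L (res lam) (vcode L u').
  rewrite -(vcode_app C qd Lok) -(vcode_smul C qd Lok); apply/eqP; congr vcode.
  apply: (colv_inj (C := C) qd); rewrite -(colv_app C qd) (colv_smul C qd) Eu'.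
  by rewrite -scalemxAr Mu !scalerA mulrC.
split=> [|nu]; apply/hasP; exists (vcode L u') => //.
rewrite mem_filter vu' andbT; apply: null_code; rewrite Eu' adjmxZ.
by rewrite -!(scalemxAl, scalemxAr) nu !scaler0.
Qed.

(** The eigenvalue is a quotient of coordinates, so it lies in the field, and it is an algebraic
    integer. *)
Lemma eigenvalue_int M u c : colv u != 0 -> mx M *m colv u = c *: colv u ->
  exists lam, c = emb lam.
Proof.
move=> u0 Mu; apply/(ring_of_integersP qd sd); split; last first.
  apply: (zint_eigenvalue qd (X := M)); apply/eqP/negPn/negP => nd; case/eqP: u0.
  have uN : mx M - c%:M \in unitmx by rewrite unitmxE unitfE.
  rewrite -[colv u]mul1mx -(mulVmx uN) -mulmxA mulmxBl Mu mul_scalar_mx subrr.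
  by rewrite mulmx0.
have /matrix0Pn[i [j]] := u0; rewrite {j}ord1 => ui.
have Ec : c = colv (m3_app zadd (zmul t n) M u) i 0 / colv u i 0.
  by rewrite -(colv_app C qd) Mu mxE mulfK.
have ui' : nth (0, 0)%zz [:: u.1.1; u.1.2; u.2] i != (0, 0)%zz.
  by apply: contraNneq ui => E; rewrite mxE E emb0.
by rewrite Ec !mxE; exact: (ztau_field C qd _ ui').
Qed.

Variable S : seq (seq (m3 nat)).
Hypotheses (Sok : sub_ok L S) (Uok : scal_ok L us S) (Nok : neat_ok L us S).
Local Notation HL := (products L S).
Local Notation H := (@Hset C d L HL).

(** The eigenvalue lam at the cusp is a unit, and units are separated modulo g, so [neat_ok] gives
    det M = lam^3 exactly. The lift conj(lam) M is then handled by [unipotent_of_fixed]. *)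
Lemma Hset_neat N : torsion_free H -> has_index H (@Gamma C d) N -> neat d H.
Proof.
move=> tH iH; split=> //.
- exact: (Hset_sub C qd Lok gamc Sok).
- have := @Hset_Gamma C d L us qd sd unitsP units12 S. exact.
- by exists N.
move=> v x [v0 nv iv] [[M [gM [A0 EA0 EA0M] cM]] [B [c0 Bv] EB]].
have /(isGP C qd)[uM dM] := gM.
have [u Eu] : exists u, v = colv u.
  have Hc i := (ring_of_integersP qd sd (v i 0)).1 (iv i 0).
  have [a Ea] := Hc 0; have [b Eb] := Hc 1; have [c Ec] := Hc 2%:R.
  by exists (a, b, c); apply: col3P; rewrite mxE.
rewrite {}Eu {iv} in v0 nv Bv.
have /eqmodP/proportionalP[k k0 Ek] : \pi_(PU C) A0 = \pi_(PU C) B by rewrite EA0.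
rewrite EA0M in Ek.
have Mv : mx M *m colv u = (k * c0) *: colv u by rewrite Ek -scalemxAl Bv scalerA.
have [lam Elam] := eigenvalue_int v0 Mv; rewrite {}Elam in Mv.
have l0 : emb lam != 0.
  apply: contraNneq v0 => l0; rewrite l0 scale0r in Mv.
  by rewrite -[colv u]mul1mx -(adj_mx C qd uM) -mulmxA Mv mulmx0.
(* The inverse of lam is an eigenvalue of the integral inverse matrix, so it is an integer of the
   field as well. *)
have M'v : mx (M3adj M) *m colv u = (emb lam)^-1 *: colv u.
  have := congr1 (fun w => (emb lam)^-1 *: (mx (M3adj M) *m w)) Mv.
  by rewrite mulmxA (adj_mx C qd uM) mul1mx -scalemxAr scalerA mulVf // scale1r.
have [lam' El'] := eigenvalue_int v0 M'v.
have ll' : zmul t n lam lam' = (1, 0)%zz.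
  by apply: (emb_inj (C := C) qd); rewrite (embM C qd) emb1 -El' mulfV.
have normM a b : znorm t n (zmul t n a b) = (znorm t n a * znorm t n b)%zz.
  by apply: (zC_inj (C := C)); rewrite zCM -!(emb_norm C qd) (embM C qd) rmorphM /=; ring.
have nl : znorm t n lam = 1%zz.
  have := congr1 (znorm t n) ll'; rewrite normM znorm1.
  by move=> E; apply: (Zmul_eq1 _ _ E); apply: (znorm_ge0 C qd).
have dl : M3det M = zcube t n lam.
  apply: (unit_res_inj unitsP units_uniq).
  - exact: (det_norm C qd uM).
  - by rewrite /zcube !normM nl.
  rewrite (code_det C qd Lok).
  move/allP: Nok => /(_ _ cM)/allP/(_ (res lam, res (zcube t n lam))).
  rewrite (map_f (fun c => (res c, res (zcube t n c)))) ?unitsP // => /(_ isT)/implyP H'.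
  by apply/eqP/H'; case: (eigen_code v0 Mv) => _; apply.
have ncl : emb (zconj t lam) * emb lam = 1.
  by rewrite -(emb_conj C qd) mulrC (emb_norm C qd) nl rmorph1.
have nl' : znorm t n (zconj t lam) = 1%zz.
  apply: (zC_inj (C := C)); rewrite -(emb_norm C qd) -(emb_conj C qd) conjCK mulrC.
  by rewrite (emb_norm C qd) nl.
pose A := MkU (mx_unitaryP C qd (smul_unitary C qd nl' uM)).
have EA : U_val A = emb (zconj t lam) *: mx M by rewrite /= (mx_smul C qd).
exists A.
  rewrite -EA0; apply/eqmodP/proportionalP; exists (emb (zconj t lam)); last by rewrite EA EA0M.
  by apply: contra_eq_neq ncl => ->; rewrite mul0r eq_sym oner_eq0.
have Av : U_val A *m colv u = colv u by rewrite EA -scalemxAl Mv scalerA ncl scale1r.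
(* As A preserves J and fixes v, it also fixes the row v^* J, which kills v because v is
   isotropic. *)
exists 3%N; apply: (unipotent_of_fixed (v := colv u) (w := (colv u)^t* *m J C)) => //.
- apply: contraNneq v0 => w0; apply/eqP/matrixP => i j; rewrite ord1 [RHS]mxE.
  have : (colv u)^t* = 0 by rewrite -[LHS]mulmx1 -JJ mulmxA w0 mul0mx.
  move/(congr1 (fun B : 'rV_3 => B 0 i)); rewrite !mxE => /eqP; rewrite conjC_eq0.
  by move/eqP.
- have /andP[_ /eqP EJ] := valP A.
  rewrite -[in RHS]EJ !mulmxA -map_mxM -trmx_mul Av.
  by [].
rewrite EA detZ -(mxdet C qd) dl !(embM C qd).
transitivity ((emb (zconj t lam) * emb lam) ^+ 3); last by rewrite ncl expr1n.
by ring.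
Qed.
End Neat.

(** * Two-torsion for d = 1 and 2 *)

(** Since g divides N(g), the integers from 0 to N(g) - 1 represent all rational integers modulo
    g. *)
Definition real_residues (L : level) : seq nat :=
  [seq rres L (Z.of_nat k, 0)%zz | k <- iota 0 (Z.to_nat (znorm (lv_t L) (lv_n L) (lv_gam L)))].

(** Each residue must violate one of the conditions necessary for lifting to an involution other
    than 1 and -1: square 1, rational antidiagonal, eigenvectors for both 1 and -1. *)
Definition involution_ok (L : level) (S : seq (seq (m3 nat))) : bool :=
  let V := vectors1 L in let re := real_residues L in
  all (fun h => let: M3 _ _ c _ e _ k _ _ := h in
    [|| m3_seq (rmm L h h) != m3_seq (m3_scal 0%N 1%N),
        ~~ all (fun i => i \in re) [:: c; e; k], ~~ has_eig L h 1 V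
      | ~~ has_eig L h (rres L (-1, 0)%zz) V]) (products L S).

Section Involutions.
Variables (C : numClosedFieldType) (d : nat) (L : level).
Local Notation t := (lv_t L).
Local Notation n := (lv_n L).
Local Notation g := (lv_gam L).
Local Notation emb := (emb C d).
Hypothesis (qd : quad d t n) (sd : sqfree d) (Lok : level_ok L).
Hypothesis gamc : zdvd t n g (zconj t g).
Hypothesis Pok : prim_ok L.
Hypothesis cube1 : forall u, znorm t n u = 1%zz -> emb u ^+ 3 = 1 -> u = (1, 0)%zz.
Local Notation mx := (mxm emb).
Local Notation M3mul := (m3_mul zadd (zmul t n)).
Local Notation M3adj := (m3_adj (zconj t)).
Local Notation M31 := (m3_scal (0, 0)%zz (1, 0)%zz).
Local Notation isG := (isG t n).
Local Notation code := (rcode L).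
Local Notation res := (rres L).
Local Notation colv := (colv C d).

Lemma col_colv M j : exists u, col j (mx M) = colv u.
Proof.
exists (m3_at M (0 + j), m3_at M (3 + j), m3_at M (6 + j))%N.
by apply: col3P; rewrite !mxE.
Qed.

Lemma self_conj_res x : zconj t x = x -> res x \in real_residues L.
Proof.
case: x => a b [_ Eb]; have -> : b = 0%zz by lia.
set N := znorm t n g.
have N0 : (0 < N)%zz.
  have N0 : (0 <= N)%zz := @znorm_ge0 C d t n qd g.
  case: (Z.eq_dec (znorm t n g) 0%zz) => [/(znorm_eq0 C qd) E|]; last by rewrite -/N; lia.
  by have := gam_neq0 Lok; rewrite E eqxx.
have [m0 m1] := Z.mod_pos_bound a N N0.
have -> : res (a, 0)%zz = res ((a mod N)%zz, 0%zz).
  apply: (cong_residue C qd Lok); apply/(congP C qd Lok).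
  exists (zmul t n (zconj t g) ((a / N)%zz, 0%zz)).
  rewrite (embM C qd) mulrA -(emb_conj C qd) (emb_norm C qd) -/N !emb_zC.
  by rewrite -zCM -zCD; congr zC; rewrite Z.add_comm -Z.div_mod; lia.
apply/mapP; exists (Z.to_nat (a mod N)%zz); last by rewrite Z2Nat.id.
by rewrite mem_iota /= add0n; apply/ssrnat.ltP/Z2Nat.inj_lt; lia.
Qed.

Lemma mx_shift M s : exists N, mx N = mx M + (emb s)%:M.
Proof.
case: M => a b c e f h i j k.
exists (M3 (zadd a s) b c e (zadd f s) h i j (zadd k s)).
by apply/mx3P; split; rewrite !mxE /= ?embD ?mulr1n ?mulr0n ?addr0.
Qed.

Lemma eigen_of_root M s N : mx M *m mx N = emb s *: mx N -> mx N <> 0 ->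
  exists2 u, colv u != 0 & mx M *m colv u = emb s *: colv u.
Proof.
move=> E /eqP/matrix0Pn[i [j Nij]]; have [u Eu] := col_colv N j; exists u.
  by rewrite -Eu; apply/matrix0Pn; exists i, 0; rewrite mxE.
rewrite -Eu; apply/matrixP => k l; rewrite !mxE.
have := congr1 (fun B : 'M_3 => B k j) E; rewrite !mxE => <-.
by apply: eq_bigr => m _; rewrite !mxE.
Qed.

Variable S : seq (seq (m3 nat)).
Hypothesis Iok : involution_ok L S.

(* An involution other than 1 and -1 has both eigenvalues, and J A is hermitian,
   so that its antidiagonal is rational. *)
Lemma involution_scalar M u : isG M -> code M \in products L S ->
  znorm t n u = 1%zz -> emb u ^+ 3 = 1 -> mx M ^+ 2 = (emb u)%:M ->
  exists s, mx M = s%:M.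
Proof.
move=> gM cM nu u3; rewrite (cube1 nu u3) emb1 => M2.
have M2' : mx M *m mx M = 1%:M by rewrite -M2.
have /(isGP C qd)[uM _] := gM.
have [->|/eqP A1] := eqVneq (mx M) 1; first by exists 1.
have [->|/eqP AN] := eqVneq (mx M) (- 1)%:M; first by exists (- 1).
(* From M^2 = 1, nonzero columns of M + 1 and M - 1 are eigenvectors for 1 and -1. *)
have [P EP] := mx_shift M (1, 0)%zz; have [Q EQ] := mx_shift M (-1, 0)%zz.
have eN : emb (-1, 0)%zz = -1 by rewrite emb_zC (_ : (-1)%zz = (- (1))%zz) // zCN rmorph1.
rewrite emb1 in EP; rewrite eN in EQ.
have [||v v0 Ev] := eigen_of_root (M := M) (s := (1, 0)%zz) (N := P).
- by rewrite emb1 scale1r EP mulmxDr M2' mulmx1 addrC.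
- by rewrite EP => /eqP; rewrite addr_eq0 -raddfN => /eqP.
have [||w w0 Ew] := eigen_of_root (M := M) (s := (-1, 0)%zz) (N := Q).
- by rewrite eN EQ mulmxDr M2' mul_mx_scalar scalerDr !scaleN1r addrC -raddfN opprK.
- by rewrite EQ => /eqP; rewrite addr_eq0 -raddfN opprK => /eqP.
have [Hv _] := eigen_code qd Lok gamc Pok v0 Ev.
have [Hw _] := eigen_code qd Lok gamc Pok w0 Ew.
have EA : M3adj M = M.
  by apply: (mx_inj (C := C) qd); rewrite -[LHS]mulmx1 -M2' mulmxA (adj_mx C qd uM) mul1mx.
move/allP: Iok => /(_ _ cM).
have re x : zconj t x = x -> res x \in real_residues L by exact: self_conj_res.
have cMM : rmm L (code M) (code M) = m3_scal 0%N 1%N.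
  rewrite -(codeM C qd Lok) -(code1 Lok); congr code.
  by apply: (mx_inj (C := C) qd); rewrite (mxM C qd) M2' mx1.
move: EA Hv Hw cMM; case: (M) => a b c e f h i j k EA Hv Hw cMM.
rewrite [code _]/= in Hv Hw cMM *; rewrite cMM eqxx /= Hw (res1 Lok) in Hv *.
rewrite Hv; case: EA => _ _ Ec _ Ef _ Ei _ _; rewrite !re //.
Qed.
End Involutions.

(** * Elements of order eight *)

(** The vector A v + c v is an eigenvector for c unless it vanishes, and then v is one for -c. *)
Lemma sqrt_eigenvector (F : fieldType) m (A : 'M[F]_m) (v : 'cV_m) c : v != 0 ->
  A *m A *m v = c ^+ 2 *: v ->
  exists (w : 'cV_m) s, [/\ w != 0, s ^+ 2 = c ^+ 2 & A *m w = s *: w].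
Proof.
move=> v0 Ev; have [E|N] := eqVneq (A *m v) (- c *: v).
  by exists v, (- c); rewrite sqrrN.
exists (A *m v + c *: v), c; split=> //.
  by apply: contraNneq N => /eqP; rewrite addr_eq0 scaleNr.
by rewrite mulmxDr mulmxA Ev -scalemxAr scalerDr scalerA -expr2 addrC.
Qed.

Lemma Zsqrt2_irrational (a b : Z) : (2 * (a * a) = b * b)%zz -> a = 0%zz.
Proof.
move=> /(congr1 Z.abs_nat); rewrite !Zabs2Nat.inj_mul => E.
have {}E : (2 * Z.abs_nat a ^ 2 = Z.abs_nat b ^ 2)%N by rewrite -!mulnn.
case: (posnP (Z.abs_nat a)) => [|a0]; first by lia.
have b0 : (0 < Z.abs_nat b)%N.
  rewrite lt0n; apply: contraTneq a0 => b0; move: E; rewrite b0 => /eqP.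
  by rewrite muln_eq0 /= expn_eq0 andbT lt0n negbK.
have := congr1 (logn 2) E; rewrite lognM ?expn_gt0 ?a0 // !lognX (logn_prime 2) //.
by move/(congr1 odd); rewrite oddD !oddM.
Qed.

Section Order8.
Variables (C : numClosedFieldType) (d : nat) (n : Z).
Hypothesis qd : quad d 1 n.
Local Notation emb := (emb C d).
Local Notation mx := (mxm emb).
Local Notation M3mul := (m3_mul zadd (zmul 1 n)).
Local Notation M3adj := (m3_adj (zconj 1)).
Local Notation M3det := (m3_det zadd (zmul 1 n) zneg).
Local Notation M31 := (m3_scal (0, 0)%zz (1, 0)%zz).

(** In determinant 1 the adjugate is the inverse, here the J-adjoint, whose trace is the conjugate
    of that of M. *)
Lemma cof_unitary M : M3mul (M3adj M) M = M31 -> \det (mx M) = 1 ->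
  let e2 := cof (mx M) 0 0 + cof (mx M) 1 1 + cof (mx M) 2%:R 2%:R in
  e2 = (mx M 0 0 + mx M 1 1 + mx M 2%:R 2%:R)^*.
Proof.
move=> uM dM e2.
have EQ : (\matrix_(i, j) cof (mx M) i j) = mx (M3adj M).
  by rewrite -[LHS]mulmx1 -(mx_adj C qd uM) mulmxA mul_cof_mx dM mul1mx.
have H i := congr1 (fun A : 'M_3 => A i i) EQ.
move: (H 0) (H 1) (H 2%:R); rewrite /e2 !mxE => -> -> ->.
case: (M) => a b c e f h i j k /=; rewrite -!(emb_conj C qd) -!rmorphD.
by congr (_ ^*); ring.
Qed.

Definition ztrace (M : m3 (Z * Z)) : Z * Z :=
  let: M3 a _ _ _ e _ _ _ k := M in zadd (zadd a e) k.

Lemma mx_trace M : mx M 0 0 + mx M 1 1 + mx M 2%:R 2%:R = emb (ztrace M).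
Proof. by case: M => a b c e f h i j k; rewrite !mxE /= !embD. Qed.

Lemma two_emb p : 2%:R * emb p = zC C (2 * p.1 + p.2)%zz + zC C p.2 * tau C d.
Proof.
have E := omega_tau C qd; rewrite (_ : (2 - 1 = 1)%zz) // !rmorph1 mul1r in E.
rewrite /emb mulrDr [2%:R * (_ * _)]mulrCA E zCD zCM.
rewrite (_ : zC C 2 = 2%:R); first by ring.
by [].
Qed.

(* An eigenvalue z with z^4 = -1 makes (P + 2)(z + 1/z) + Q tau (z - 1/z) = 2P,
   where the trace is (P + Q tau)/2; squaring, the irrationality of
   z + 1/z = +-sqrt 2 forces P(P + 2) = 0, and then d Q^2 is 4 or 8. *)
Lemma no_order8 M : (forall Q, Z.of_nat d * (Q * Q) <> 4 /\ Z.of_nat d * (Q * Q) <> 8)%zz ->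
  M3mul (M3adj M) M = M31 -> \det (mx M) = 1 -> mx M ^+ 8 = 1 -> mx M ^+ 4 = 1.
Proof.
move=> dQ uM dM M8; apply: contrapT => /eqP M4.
set A := mx M in dM M8 M4.
(* A nonzero column of A^4 - 1 is negated by A^4; two successive square roots then give an
   eigenvector of A with z^4 = -1. *)
have [v v0 Ev] : exists2 v : 'cV_3, v != 0 & A ^+ 4 *m v = - v.
  have : A ^+ 4 - 1 != 0 by rewrite subr_eq0.
  case/matrix0Pn => i [j Nij]; exists (col j (A ^+ 4 - 1)).
    by apply/matrix0Pn; exists i, 0; rewrite mxE.
  rewrite colE mulmxA; suff -> : A ^+ 4 *m (A ^+ 4 - 1) = - (A ^+ 4 - 1) by rewrite mulNmx.
  by rewrite opprB mulmxBr mulmx1 mulmxE -exprD M8.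
have [v1 [s1 [v10 Es1 Ev1]]] : exists (w : 'cV_3) s, [/\ w != 0, s ^+ 2 = 'i ^+ 2 & A ^+ 2 *m w = s *: w].
  apply: (sqrt_eigenvector v0); rewrite mulmxE -exprD Ev sqrCi scaleN1r.
  by [].
have [w [z [w0 Ez Ew]]] : exists (w : 'cV_3) z, [/\ w != 0, z ^+ 2 = (sqrtC s1) ^+ 2 & A *m w = z *: w].
  by apply: (sqrt_eigenvector v10); rewrite mulmxE -expr2 Ev1 sqrtCK.
rewrite sqrtCK in Ez.
have z4 : z ^+ 4 = -1 by rewrite (exprM z 2 2) Ez Es1 sqrCi.
have nz : z * z^* = 1.
  rewrite -normCK; suff -> : `|z| = 1 by rewrite expr1n.
  by apply/eqP; rewrite -(@pexpr_eq1 _ _ 4) // -normrX z4 normrN1.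
set y := z^* in nz.
have y2 : y ^+ 2 = - z ^+ 2.
  have : z ^+ 4 * y ^+ 2 = z ^+ 2 * (z * y) ^+ 2 by ring.
  by rewrite z4 nz expr1n mulr1 mulN1r => <-; rewrite opprK.
pose T := emb (ztrace M).
(* The characteristic equation, with the conjugate trace as middle coefficient; dividing by z and
   conjugating give [E2] and [E3]. *)
have E1 : z ^+ 3 = T * z ^+ 2 - T^* * z + 1.
  have := congr1 (mulmxr w) (cayley_hamilton3 A).
  rewrite /= mx_trace (cof_unitary uM dM) mx_trace dM -/T.
  have P k : A ^+ k *m w = z ^+ k *: w.
    elim: k => [|k IH]; first by rewrite mul1mx scale1r.
    by rewrite exprSr -mulmxE -mulmxA Ew -scalemxAr IH scalerA -exprS.
  rewrite !mulmxDl mulNmx -!scalemxAl !P Ew !scalerA mul1mx -scaleNr -[X in _ + X]scale1r -!scalerDl.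
  move/eqP; rewrite -subr_eq0 -scalerBl scaler_eq0 (negPf w0) orbF subr_eq0.
  by move/eqP=> ->; ring.
have E2 : z ^+ 2 = T * z - T^* + y.
  have : z ^+ 2 * (z * y) = T * z * (z * y) - T^* * (z * y) + y.
    by transitivity (y * z ^+ 3); [ring | rewrite E1; ring].
  by rewrite nz !mulr1.
have E3 : y ^+ 2 = T^* * y - T + z.
  have yc : y^* = z by rewrite /y conjCK.
  have -> : y ^+ 2 = (z ^+ 2)^* by rewrite rmorphXn.
  have HT : T^*^* = T by rewrite conjCK.
  rewrite E2; clearbody T; rewrite rmorphD rmorphB rmorphM /= yc -/y.
  by rewrite HT.
set P := (2 * (ztrace M).1 + (ztrace M).2)%zz; set Q := (ztrace M).2.
have ET : 2%:R * T = zC C P + zC C Q * tau C d by exact: two_emb.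
have ET' : 2%:R * T^* = zC C P - zC C Q * tau C d.
  have := congr1 Num.conj ET; rewrite rmorphM rmorph_nat => ->.
  by rewrite rmorphD rmorphM /= !zC_conj tau_conj mulrN.
have E4 : zC C Q * tau C d * (z - y) = 2%:R * zC C P - (zC C P + 2%:R) * (z + y).
  have : 2%:R * (z ^+ 2 + y ^+ 2) = 0 by rewrite y2 subrr mulr0.
  rewrite E2 E3 => E.
  have : 2%:R * T * z + 2%:R * T^* * y - 2%:R * T - 2%:R * T^* + 2%:R * (z + y) = 0.
    by rewrite -[RHS]E; ring.
  by rewrite ET ET' => E'; apply/eqP; rewrite -subr_eq0 -[X in _ == X]E'; apply/eqP; ring.
have e2 : (z + y) ^+ 2 = 2%:R.
  by rewrite sqrrD y2 nz addrAC subrr add0r.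
have f2 : (z - y) ^+ 2 = - 2%:R.
  by rewrite sqrrB y2 nz addrAC subrr add0r.
have E5 : zC C (4 * P * (P + 2))%zz * (z + y) =
    zC C (4 * P * P + 2 * (P + 2) * (P + 2) - 2 * Z.of_nat d * Q * Q)%zz.
  have E : zC C Q ^+ 2 * tau C d ^+ 2 * (z - y) ^+ 2 =
      4%:R * zC C P ^+ 2 - 4%:R * zC C P * (zC C P + 2%:R) * (z + y)
      + (zC C P + 2%:R) ^+ 2 * (z + y) ^+ 2.
    by transitivity ((zC C Q * tau C d * (z - y)) ^+ 2); [|rewrite E4]; ring.
  rewrite tau2 f2 e2 in E; clearbody P Q.
  rewrite !(zCM, zCD, zCB) zC_nat (_ : zC C 4 = 4%:R) // (_ : zC C 2 = 2%:R) //.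
  apply/eqP; rewrite -subr_eq0; apply/eqP; move/eqP: E; rewrite -subr_eq0 => /eqP E.
  by rewrite -[RHS]E; ring.
have := congr1 (fun x => x ^+ 2) E5; rewrite exprMn e2.
rewrite (_ : 2%:R = zC C 2) // -!rmorphXn mulrC -rmorphM /= => /(zC_inj (C := C)).
rewrite !expr2 => /Zsqrt2_irrational PP.
rewrite PP rmorph0 mul0r in E5.
have := zC_inj (C := C) (etrans (rmorph0 _) E5).
have [] := dQ Q; rewrite /GRing.mul /=.
have : P = 0%zz \/ P = (-2)%zz by move: PP; nia.
case=> -> ; nia.
Qed.
End Order8.

(** * Reduction to matrices over a prime field *)

(** Sending w to s is a ring map onto F_q with kernel generated by g, a prime of norm q. *)
Definition prime_ok (t n : Z) (q : nat) (s : Z) (g : Z * Z) : bool :=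
  [&& prime q, (4 < q)%N, (znorm t n g =? Z.of_nat q)%zz, zdvd t n g ((- s)%zz, 1%zz)
    & ((s * s - t * s + n) mod Z.of_nat q =? 0)%zz].

Section Reduction.
Variables (C : numClosedFieldType) (d : nat) (t n : Z) (us : seq (Z * Z)).
Hypothesis (qd : quad d t n) (sd : sqfree d).
Hypothesis unitsP : forall u, znorm t n u = 1%zz -> u \in us.
Hypothesis units12 : forall u, u \in us -> emb C d u ^+ 12 = 1.
Hypothesis cube1 : forall u, znorm t n u = 1%zz -> emb C d u ^+ 3 = 1 -> u = (1, 0)%zz.
Variables (q : nat) (s : Z) (g : Z * Z).
Hypothesis qok : prime_ok t n q s g.
Local Notation emb := (emb C d).
Local Notation mx := (mxm emb).
Local Notation M3mul := (m3_mul zadd (zmul t n)).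
Local Notation M3adj := (m3_adj (zconj t)).
Local Notation M3det := (m3_det zadd (zmul t n) zneg).
Local Notation M31 := (m3_scal (0, 0)%zz (1, 0)%zz).
Local Notation isG := (isG t n).
Local Notation lifts := (@lifts C d).
Local Notation FF := 'F_q.

Lemma isG_det1 M : isG M -> M3det M = (1, 0)%zz.
Proof.
move=> /(isGP C qd)[uM dM]; apply: cube1; first exact: (det_norm C qd uM).
by rewrite (mxdet C qd).
Qed.

Lemma lifts_uniq M M' x : isG M -> isG M' -> lifts M x -> lifts M' x -> M' = M.
Proof.
move=> gM gM' lM lM'; have [u [-> nu u3]] := lifts_unit qd unitsP units12 gM gM' lM lM'.
apply: (mx_inj (C := C) qd); rewrite (mx_smul C qd) (cube1 nu u3).
by rewrite emb1 scale1r.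
Qed.

Definition zF (z : Z) : FF := (int_of_Z z)%:~R.

Lemma zF_is_zmod_morphism : zmod_morphism zF.
Proof. by move=> x y; rewrite /zF rmorphB rmorphB. Qed.
Lemma zF_is_monoid_morphism : monoid_morphism zF.
Proof. by split=> [|x y]; rewrite /zF ?rmorph1 // rmorphM rmorphM. Qed.
HB.instance Definition _ := GRing.isZmodMorphism.Build Z FF zF zF_is_zmod_morphism.
HB.instance Definition _ := GRing.isMonoidMorphism.Build Z FF zF zF_is_monoid_morphism.

Lemma zF_eq0 z : zF z = 0 <-> exists k, z = (Z.of_nat q * k)%zz.
Proof.
have /and5P[pq _ _ _ _] := qok; have cq := pchar_Fp pq.
split=> [/eqP|[k ->]]; last first.
  rewrite /zF (_ : int_of_Z _ = q%:Z * int_of_Z k); last by lia.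
  by rewrite rmorphM /= -pmulrn (pcharf0 cq) mul0r.
rewrite /zF -(dvdz_pcharf cq) => /dvdzP[k Ek]; exists (Z_of_int k).
by rewrite -[z]int_of_ZK Ek; lia.
Qed.

Definition red (p : Z * Z) : FF := zF p.1 + zF p.2 * zF s.

Lemma redD x y : red (zadd x y) = red x + red y.
Proof. by rewrite /red !rmorphD /=; ring. Qed.
Lemma redN x : red (zneg x) = - red x.
Proof. by rewrite /red !rmorphN /=; ring. Qed.
Lemma redM x y : red (zmul t n x y) = red x * red y.
Proof.
have E : zF (s * s - t * s + n)%zz = 0.
  apply/zF_eq0; have /and5P[_ _ _ _ /Z.eqb_spec E] := qok.
  exists ((s * s - t * s + n) / Z.of_nat q)%zz; apply: Z_div_exact_full_2 => //.
  by have /and5P[pq _ _ _ _] := qok; have := prime_gt0 pq; lia.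
have Es : zF s * zF s = zF t * zF s - zF n.
  by apply/eqP; rewrite -subr_eq0 -E !rmorphD rmorphN !rmorphM /= opprB addrA addrAC.
rewrite /red /zmul /= !(rmorphD, rmorphB, rmorphM) /=.
transitivity (zF x.1 * zF y.1 + (zF x.1 * zF y.2 + zF x.2 * zF y.1) * zF s
  + zF x.2 * zF y.2 * (zF s * zF s)); last by ring.
by rewrite Es; ring.
Qed.
Lemma red0 : red (0, 0)%zz = 0. Proof. by rewrite /red /= rmorph0 mul0r addr0. Qed.
Lemma red1 : red (1, 0)%zz = 1. Proof. by rewrite /red /= rmorph0 rmorph1 mul0r addr0. Qed.

Lemma g_neq0 : g != (0, 0)%zz.
Proof.
have /and5P[_ q4 /Z.eqb_spec E _ _] := qok.
by apply/eqP => g0; move: E; rewrite g0 /znorm /= !Z.mul_0_r /=; lia.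
Qed.

(** If a + b s = q k, then a + b w = q k + b (w - s), and g divides both q = N(g) and w - s. *)
Lemma red_eq0 x : red x = 0 -> exists y, emb x = emb g * emb y.
Proof.
have /and5P[_ q4 /Z.eqb_spec Ng gs _] := qok.
have [y Ey] := zdvdP C qd _ g_neq0 gs.
rewrite /red -rmorphM -rmorphD => /zF_eq0[k Ek].
exists (zadd (zmul t n (zconj t g) (k, 0)%zz) (zmul t n y (x.2, 0)%zz)).
rewrite embD !(embM C qd) mulrDr !mulrA -Ey -(emb_conj C qd) (emb_norm C qd) Ng !emb_zC.
by rewrite -zCM -Ek /emb /= zCD zCM zCN rmorph1; ring.
Qed.

Local Notation mxr := (mxm red).

Lemma mxrM M N : mxr (M3mul M N) = mxr M *m mxr N.
Proof. exact: (mxm_mul redD redM). Qed.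
Lemma mxr1 : mxr M31 = 1%:M.
Proof. by rewrite mxm_scal ?red1 // red0. Qed.
Lemma mxr_det M : \det (mxr M) = red (M3det M).
Proof. by rewrite (mxm_det redD redM redN). Qed.

Lemma mxr_eq1 M : mxr M = 1 -> exists X, mx M = 1%:M + emb g *: mx X.
Proof.
have H0 p : red p = 0 -> exists x, emb p = emb g * emb x by exact: red_eq0.
have H1 p : red p = 1 -> exists x, emb p = 1 + emb g * emb x.
  move=> E; have [|x Ex] := H0 (zadd p (zneg (1, 0)%zz)).
    by rewrite redD redN red1 E subrr.
  by exists x; rewrite -Ex embD embN emb1 addrC subrK.
move=> E; have := fun i j => congr1 (fun A : 'M_3 => A i j) E.
case: (M) => a b c e f h i j k H.
move: (H 0 0) (H 0 1) (H 0 2%:R) (H 1 0) (H 1 1) (H 1 2%:R) (H 2%:R 0) (H 2%:R 1)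
  (H 2%:R 2%:R); rewrite !mxE /= !(mulr1n, mulr0n).
move=> /H1[a' Ea] /H0[b' Eb] /H0[c' Ec] /H0[e' Ee] /H1[f' Ef] /H0[h' Eh] /H0[i' Ei] /H0[j' Ej] /H1[k' Ek].
exists (M3 a' b' c' e' f' h' i' j' k').
by apply/mx3P; split; rewrite !mxE /= ?mulr1n ?mulr0n ?(Ea, Eb, Ec, Ee, Ef, Eh, Ei, Ej, Ek) ?add0r.
Qed.

Lemma reduction_free M p : prime p -> mxr M = 1 -> mx M ^+ p = 1 -> mx M = 1.
Proof.
move=> pp /mxr_eq1[X EX]; apply: (congruent_free qd sd g_neq0 _ pp EX).
by have /and5P[_ q4 /Z.eqb_spec -> _ _] := qok; rewrite Nat2Z.id.
Qed.

Lemma mxr_mpow M k : mxr (mpow t n M k) = mxr M ^+ k.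
Proof. by elim: k => [|k IH]; rewrite ?mxr1 // [mpow _ _ _ _]/= mxrM IH exprS. Qed.

Lemma reduction_trivial M y m : isG M -> lifts M y -> (0 < m)%N -> (y ^+ m = 1)%g ->
  mxr M = 1 -> y = 1%g.
Proof.
move=> gM lM m0 ym M1; apply/eqP; apply: contraT => y1.
have [a [p [pp ya1 yap]]] := prime_order_power m0 ym y1.
have gN := isG_mpow C qd a gM; have lN := lifts_mpow qd a lM.
case/eqP: ya1; suff EN : mpow t n M a = M31.
  by rewrite EN in lN; apply: lifts_inj lN _; exact: lifts1.
apply: (mx_inj (C := C) qd); rewrite mx1; apply: (reduction_free pp).
  by rewrite mxr_mpow M1 expr1n.
rewrite -(mx_mpow C qd) (lifts_uniq (isG1 C qd) (isG_mpow C qd p gN) (lifts1 C d)) ?mx1 //.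
by rewrite -yap; apply: (lifts_mpow qd).
Qed.

(** Lifts being unique, reduction is multiplicative on F; it is injective because no nontrivial
    torsion element reduces to 1. *)
Lemma finite_reduction F k : is_subgroup F -> F `<=` Gamma d -> (F #= `I_k)%card ->
  exists G : {group {'GL_3[FF]}}, #|G| = k /\
    forall x, x \in G -> exists M y, [/\ isG M, F y, lifts M y & GLval x = mxr M].
Proof.
move=> sF FG Fk; have GP := GammaP qd sd unitsP units12.
have [F1 FM FV] := (is_subgroupP F).1 sF.
have [f [fF fI fS]] := enum_finite Fk.
have uM M : isG M -> (mxr M : 'M_(3.-1.+1)) \is a GRing.unit.
  move=> /(isG_det1) dM; rewrite -[_ \is a GRing.unit]/(mxr M \in unitmx).
  by rewrite unitmxE mxr_det dM red1 unitr1.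
have H i : exists x : {'GL_3[FF]}, exists2 M, isG M & lifts M (f i) /\ GLval x = mxr M.
  have [M gM lM] := (GP _).1 (FG _ (fF i)).
  by exists (FinRing.Unit (uM M gM)), M.
have [x xP] := choice H.
pose G := [set x i | i in 'I_k]%SET.
have Gin M y (z : {'GL_3[FF]}) : isG M -> F y -> lifts M y -> GLval z = mxr M -> z \in G.
  move=> gM /fS[i <-] lM zM; apply/imsetP; exists i => //; apply: val_inj.
  have [M' gM' [lM' EM']] := xP i; rewrite [LHS]zM [RHS]EM'.
  by rewrite (lifts_uniq gM gM' lM lM').
have Gout z : z \in G -> exists M y, [/\ isG M, F y, lifts M y & GLval z = mxr M].
  by move=> /imsetP[i _ ->]; have [M gM [lM EM]] := xP i; exists M, (f i).
have gG : group_set G.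
  apply/group_setP; split=> [|a b /Gout[M [y [gM Fy lM EM]]] /Gout[N [z [gN Fz lN EN]]]].
    by apply: (Gin M31 1%g); [exact: (isG1 C qd)| exact: F1 | exact: lifts1|rewrite mxr1].
  apply: (Gin (M3mul M N) (y * z)%g); [exact: (isGM C qd)|exact: FM|exact: (liftsM qd)|].
  by rewrite mxrM -EM -EN.
exists (group gG); split=> //=; rewrite card_imset ?card_ord // => i j Eij.
have [M gM [lM EM]] := xP i; have [N gN [lN EN]] := xP j.
have gQ := isGM C qd (isGV C qd gM) gN; have lQ := liftsM qd (liftsV qd gM lM) lN.
have [m m0 ym] := finite_order sF Fk (FM _ _ (FV _ (fF i)) (fF j)).
apply/fI/esym; apply: (mulgI (f i)^-1%g); rewrite mulVg.
apply: (reduction_trivial gQ lQ m0 ym).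
have /(isGP C qd)[uM' _] := gM.
by rewrite mxrM -EN -Eij EM -mxrM uM' mxr1.
Qed.

Lemma card_dvd_GL (F : set (PU C)) k : is_subgroup F -> F `<=` Gamma d -> (F #= `I_k)%card ->
  (k %| #|'GL_3[FF]%g|)%N.
Proof.
move=> sF FG Fk; have [G [<- _]] := finite_reduction sF FG Fk.
by apply: cardSg; exact: finset.subsetT.
Qed.
End Reduction.

(** The block has characteristic polynomial X^2 - c X - 1, whose roots are primitive eighth roots of
    unity when c^2 = -2. *)
Lemma order8_mx (F : comNzRingType) (c : F) : c ^+ 2 = - 2%:R ->
  let B := mxm id (M3 0 1 0 1 c 0 0 0 1) in B ^+ 4 = mxm id (M3 (-1) 0 0 0 (-1) 0 0 0 1).
Proof.
move=> Ec B.
have E2 : B *m B = mxm id (M3 1 c 0 c (-1) 0 0 0 1).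
  rewrite /B -(mxm_mul (f := id) (add := +%R) (mul := *%R)) //=; congr mxm.
  by congr M3; rewrite ?(mul0r, mulr0, mul1r, mulr1, addr0, add0r) // -expr2 Ec; ring.
rewrite (exprM B 2 2) !expr2 -!mulmxE E2 -(mxm_mul (f := id) (add := +%R) (mul := *%R)) //=.
congr mxm; congr M3; rewrite ?(mul0r, mulr0, mul1r, mulr1, addr0, add0r) // -?expr2 ?Ec; ring.
Qed.

(** * Finite subgroups of order divisible by 16 *)

Section Order16.
Variables (C : numClosedFieldType) (d : nat) (n : Z) (us : seq (Z * Z)).
Hypothesis (qd : quad d 1 n) (sd : sqfree d).
Hypothesis unitsP : forall u, znorm 1 n u = 1%zz -> u \in us.
Hypothesis units12 : forall u, u \in us -> emb C d u ^+ 12 = 1.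
Hypothesis cube1 : forall u, znorm 1 n u = 1%zz -> emb C d u ^+ 3 = 1 -> u = (1, 0)%zz.
Variables (q : nat) (s : Z) (g : Z * Z).
Hypothesis qok : prime_ok 1 n q s g.
Hypothesis dQ : (forall Q, Z.of_nat d * (Q * Q) <> 4 /\ Z.of_nat d * (Q * Q) <> 8)%zz.

(* The group generated by F and -1 would contain a Sylow 2-subgroup of
   GL_3(F_q), hence a conjugate of an element of order 8. *)
Lemma not16_dvd (F : set (PU C)) k (c : 'F_q) : is_subgroup F -> F `<=` Gamma d ->
  (F #= `I_k)%card -> ((#|'GL_3['F_q]%g|)`_2 = 32)%N -> c ^+ 2 = - 2%:R -> ~~ (16 %| k)%N.
Proof.
move=> sF FG Fk GL2 Ec; apply/negP => k16.
have [G [kG GP]] := finite_reduction qd sd unitsP units12 cube1 qok sF FG Fk.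
have /and5P[pq q4 _ _ _] := qok.
have two0 : (2%:R : 'F_q) != 0.
  by rewrite -(dvdn_pcharf (pchar_Fp pq)) gtnNdvd // (leq_trans _ q4).
pose gT := {'GL_3['F_q]}.
have m1 : (-1 : 'M['F_q]_(3.-1.+1)) \is a GRing.unit by rewrite unitrN unitr1.
pose z : gT := FinRing.Unit m1.
have z2 : (z ^+ 2)%g = 1%g.
  by apply: val_inj; rewrite expgS expg1 /= mulrNN mulr1.
have zx (x : gT) : (x * z = z * x)%g by apply: val_inj; rewrite /= mulrN1 mulN1r.
(* The scalar -1 has determinant -1, while G consists of reductions of determinant 1. *)
have zG : z \notin G.
  apply/negP => /GP[M [y [gM _ _ EM]]].
  have := congr1 (fun A : 'M_3 => \det A) EM.
  rewrite (mxr_det qok) (isG_det1 qd cube1 gM) red1 /= -scaleN1r detZ det1 mulr1.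
  rewrite !exprS expr0 mulr1 mulrNN mulr1 mulN1r => /eqP.
  by rewrite eq_sym -subr_eq0 opprK; apply/negP.
have cZ : <[z]>%g \subset 'C(G)%g.
  by rewrite cycle_subG; apply/centP => x _; apply/esym/zx.
have oz : #[z]%g = 2.
  apply: nt_prime_order => //; apply: contraNneq zG => ->; exact: group1.
have memz (x : gT) : x \in <[z]>%g -> x = 1%g \/ x = z.
  move=> /cycleP[i ->]; rewrite -(odd_double_half i) expgnDr -mul2n expgnA z2 expg1n mulg1.
  by case: odd; [right; rewrite expg1|left].
have TI : (G :&: <[z]> = 1)%g.
  apply/eqP; rewrite -subG1; apply/fintype.subsetP => x /finset.setIP[xG].
  by case/memz=> [->|xz]; [rewrite finset.inE|move: zG; rewrite -xz xG].
pose K := (G <*> <[z]>)%G.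
have EK : K = (G * <[z]>)%g :> {set _} by apply: cent_joinEr.
have cK : #|K| = (k * 2)%N by rewrite EK TI_cardMg // kG -orderE oz.
have [P sylP] := Sylow_exists 2 K.
have cP : #|P| = ((#|'GL_3['F_q]%g|)`_2)%N.
  apply/eqP; rewrite eqn_dvd; apply/andP; split.
    rewrite -[#|P|](part_pnat_id (pHall_pgroup sylP)) partn_dvd //.
    by apply: cardSg; exact: finset.subsetT.
  rewrite GL2 (card_Hall sylP) cK.
  have : (32`_2 %| (k * 2)`_2)%N.
    apply: partn_dvd; first by rewrite -cK cardG_gt0.
    by rewrite (_ : 32 = 16 * 2)%N // dvdn_mul.
  by rewrite [X in (X %| _)%N]part_pnat_id.
have sylP' : 2.-Sylow('GL_3['F_q])%g P.
  by rewrite pHallE finset.subsetT cP eqxx.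
have B4 := order8_mx Ec; set B := mxm _ _ in B4.
have B8 : B ^+ 8 = 1.
  rewrite (exprM B 4 2) B4 expr2 -mulmxE -(mxm_mul (f := id) (add := +%R) (mul := *%R)) //=.
  rewrite !(mul0r, mulr0, mulr1, mulrNN, addr0, add0r).
  by apply: (mxm_scal (f := id)).
have uB : (B : 'M['F_q]_(3.-1.+1)) \is a GRing.unit.
  by rewrite -(unitrX_pos _ (isT : 0 < 8)%N) B8 unitr1.
pose b : gT := FinRing.Unit uB.
have vX (x : gT) m : GLval (x ^+ m)%g = GLval x ^+ m.
  by elim: m => [|m IH]; rewrite ?expgS ?exprS //= -IH.
have b8 : (b ^+ 8 = 1)%g by apply: val_inj; rewrite [LHS]vX B8.
have b4 : (b ^+ 4 != 1)%g.
  apply/eqP => /(congr1 (fun x : gT => GLval x 0 0)).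
  rewrite vX /= B4 !mxE /= => /eqP; rewrite eq_sym -subr_eq0 opprK; exact/negP.
have pb : (2.-group <[b]>)%g.
  rewrite /pgroup -orderE; apply: (@pnat_dvd _ 8) => //.
  by rewrite order_dvdn b8.
have [y _ /fintype.subsetP/(_ b)] := Sylow_subJ sylP' (finset.subsetT _) pb.
rewrite cycle_id mem_conjg => /(_ isT) bP.
have : (b ^ y^-1)%g \in K by apply: (fintype.subsetP (pHall_sub sylP)).
rewrite /= EK => /mulsgP[x w xG wz Ebx].
(* The conjugate of b is x w with x in G and w = 1 or -1, so x has the same even powers and order 8
   too. *)
have w2 : (w ^+ 2 = 1)%g.
  by case: (memz _ wz) => ->; rewrite ?expg1n.
have xw : commute x w.
  by case: (memz _ wz) => ->; rewrite /commute ?mulg1 ?mul1g.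
have wX m : (w ^+ (2 * m) = 1)%g by rewrite expgnA w2 expg1n.
have bx m : (x ^+ (2 * m) = (b ^+ (2 * m)) ^ y^-1)%g.
  by rewrite conjXg Ebx expgMn // wX mulg1.
have x8 : (x ^+ 8 = 1)%g by rewrite (bx 4) b8 conj1g.
have x4 : (x ^+ 4 != 1)%g by rewrite (bx 2) conjg_eq1.
have [M [h [gM Fh lM EM]]] := GP x xG; case/eqP: x4.
have xX m : GLval (x ^+ m)%g = mxm (red q s) (mpow 1 n M m).
  by rewrite (mxr_mpow qok) vX EM.
have [m m0 hm] := finite_order sF Fk Fh.
have h8 : (h ^+ 8 = 1)%g.
  have := reduction_trivial qd sd unitsP units12 cube1 qok (isG_mpow C qd 8 gM)
    (lifts_mpow qd 8 lM) m0 _ _; apply.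
    by rewrite -expgnA mulnC expgnA hm expg1n.
  by rewrite -xX x8.
have M8 : mpow 1 n M 8 = m3_scal (0, 0)%zz (1, 0)%zz.
  apply: (lifts_uniq qd unitsP units12 cube1 (isG1 C qd) (isG_mpow C qd 8 gM) (lifts1 C d)).
  by rewrite -h8; apply: (lifts_mpow qd).
have M4 : mpow 1 n M 4 = m3_scal (0, 0)%zz (1, 0)%zz.
  apply: (mx_inj (C := C) qd); rewrite (mx_mpow C qd) mx1.
  have /(isGP C qd)[uM _] := gM.
  apply: (no_order8 qd dQ uM); last by rewrite -(mx_mpow C qd) M8 mx1.
  by rewrite -(mxdet C qd) (isG_det1 qd cube1 gM) emb1.
by apply: val_inj; rewrite [LHS]xX M4 mxr1.
Qed.
End Order16.

(** * Elements of order three for d = 3 *)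

Lemma Zround (a h : Z) : (0 < h)%zz -> exists q, (- h <= 2 * (a - q * h) <= h)%zz.
Proof.
move=> h0; exists ((2 * a + h) / (2 * h))%zz.
have E := Z.div_mod (2 * a + h) (2 * h); have [] := Z.mod_pos_bound (2 * a + h) (2 * h); first by lia.
move: E; set q := (_ / _)%zz; set r := (_ mod _)%zz => E r0 r1.
have {}E : (2 * a + h = 2 * h * q + r)%zz by apply: E; lia.
have -> : (2 * (a - q * h) = r - h)%zz by lia.
by lia.
Qed.

(** The bound a^2 + ab + b^2 <= 3 h^2 / 4, by which the Eisenstein integers are Euclidean. *)
Lemma Znorm3_lt (a b h : Z) : (0 < h)%zz -> (- h <= 2 * a <= h)%zz -> (- h <= 2 * b <= h)%zz ->
  (znorm 1 1 (a, b) < h * h)%zz.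
Proof. by rewrite /znorm /= => h0 [a1 a2] [b1 b2]; nia. Qed.

Section Eigenlines.
Variable F : fieldType.

(** Three distinct eigenvalues in dimension three leave only one-dimensional eigenspaces; transposes
    pass to the row-space convention. *)
Lemma eigenline (A : 'M[F]_3) l1 l2 l3 (x u v y : 'cV_3) :
  l1 != l2 -> l1 != l3 -> l2 != l3 -> x != 0 -> u != 0 -> v != 0 ->
  A *m x = l1 *: x -> A *m u = l2 *: u -> A *m v = l3 *: v -> A *m y = l1 *: y ->
  exists c, y = c *: x.
Proof.
move=> n12 n13 n23 x0 u0 v0 Ax Au Av Ay.
pose a (i : 'I_3) := [:: l1; l2; l3]`_i.
have aI : injective a.
  by move=> [[|[|[|]]]] // ? [[|[|[|]]]] // ?; rewrite /a /= => E; apply: val_inj => //=;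
    move: n12 n13 n23; rewrite E eqxx.
have trE (w : 'cV[F]_3) l : A *m w = l *: w -> (w^T <= eigenspace A^T l)%MS.
  by move=> E; apply/eigenspaceP; rewrite -trmx_mul E linearZ.
have rk (w : 'cV[F]_3) : w != 0 -> \rank (w^T) = 1%N.
  by move=> w0; rewrite rank_rV trmx_eq0 w0.
have rE (w : 'cV[F]_3) l : w != 0 -> A *m w = l *: w -> (0 < \rank (eigenspace A^T l))%N.
  by move=> w0 E; apply: leq_trans (mxrankS (trE _ _ E)); rewrite rk.
have /mxdirectP/= D := mxdirect_sum_eigenspace (A^T) (P := predT) (a_ := a) (in2W aI).
have := rank_leq_row (\sum_i eigenspace A^T (a i))%MS; rewrite D.
rewrite !big_ord_recl big_ord0 addn0 /a /= => R.
have r1 : \rank (eigenspace A^T l1) = 1%N.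
  by have := rE _ _ x0 Ax; have := rE _ _ u0 Au; have := rE _ _ v0 Av; lia.
have xs := trE _ _ Ax; have /eqmxP xE : (x^T == eigenspace A^T l1)%MS.
  by rewrite -(geq_leqif (mxrank_leqif_eq xs)) r1 rk.
have := trE _ _ Ay; rewrite -xE => /sub_rVP[c E]; exists c.
by apply: trmx_inj; rewrite E linearZ.
Qed.
End Eigenlines.

Section CubeRoots.
Variable F : fieldType.
Variables (A : 'M[F]_3) (l : F).
Hypotheses (A3 : A ^+ 3 = 1) (l3 : l ^+ 3 = 1).

(** Three times the projection onto the l-eigenspace of A, since l^2 = 1 / l. *)
Definition cube_proj : 'M[F]_3 := 1 + l ^+ 2 *: A + l *: A ^+ 2.

Lemma cube_proj_eigen : A * cube_proj = l *: cube_proj.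
Proof.
rewrite /cube_proj !mulrDr mulr1 -!scalerAr -expr2 -exprS A3 !scalerDr !scalerA -exprS l3 scale1r -expr2.
by rewrite addrC addrA.
Qed.

Lemma cube_proj_idem : cube_proj * cube_proj = 3%:R *: cube_proj.
Proof.
have A2E : A ^+ 2 * cube_proj = (l * l) *: cube_proj.
  by rewrite expr2 -mulrA cube_proj_eigen -scalerAr cube_proj_eigen scalerA.
rewrite {1}/cube_proj !mulrDl mul1r -!scalerAl cube_proj_eigen A2E !scalerA.
have -> : l ^+ 2 * l = 1 by rewrite -l3; ring.
have -> : l * (l * l) = 1 by rewrite -l3; ring.
by rewrite !scale1r scaler_nat !mulrS mulr0n addr0 addrA.
Qed.
End CubeRoots.

(** * Positive rank-one projections over the Eisenstein integers *)

Section MinimalVector.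
Variable C : numClosedFieldType.
Hypothesis qd : quad 3 1 1.
Local Notation emb := (emb C 3).
Local Notation mx := (mxm emb).
Local Notation colv := (colv C 3).
Local Notation Jp x y := ((colv x) ^t* *m J C *m colv y).
Local Notation M3app := (m3_app zadd (zmul 1 1)).

Definition hvec (u : Z * Z * (Z * Z) * (Z * Z)) : Z :=
  (ztr 1 (zmul 1 1 u.1.1 (zconj 1 u.2)) + znorm 1 1 u.1.2)%zz.
Definition hpair (u v : Z * Z * (Z * Z) * (Z * Z)) : Z * Z :=
  zadd (zadd (zmul 1 1 (zconj 1 u.1.1) v.2) (zmul 1 1 (zconj 1 u.1.2) v.1.2))
    (zmul 1 1 (zconj 1 u.2) v.1.1).

Lemma hpairE u v : Jp u v = (emb (hpair u v))%:M.
Proof.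
apply/matrixP => i j; rewrite !ord1; case: u => [[x y] z]; case: v => [[x' y'] z'].
rewrite -mulmxA !mxE sum3 !mxE !sum3 !mxE /= mulr1n /hpair /=.
by rewrite !embD !(embM C qd) -!(emb_conj C qd); ring.
Qed.

Lemma hvecE u : emb (hpair u u) = zC C (hvec u).
Proof.
case: u => [[x y] z]; rewrite /hpair /hvec /= zCD -(emb_norm C qd) (ztrE C _ qd).
rewrite !embD !(embM C qd) rmorphM /= -!(emb_conj C qd) conjCK; ring.
Qed.

Lemma colvB u v q : exists w, colv w = colv u - emb q *: colv v.
Proof.
case: u => [[x y] z]; case: v => [[x' y'] z'].
exists (zadd x (zneg (zmul 1 1 q x')), zadd y (zneg (zmul 1 1 q y')), zadd z (zneg (zmul 1 1 q z'))).
by apply: col3P; rewrite !mxE /= embD embN (embM C qd).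
Qed.

Variable P : m3 (Z * Z).
Hypotheses (idem : mx P *m mx P = mx P) (selfadj : (mx P) ^t* *m J C = J C *m mx P).
Hypothesis line : forall x y : 'cV[C]_3, x != 0 -> mx P *m x = x -> mx P *m y = y ->
  exists c, y = c *: x.
Hypothesis pos : (0 < (m3_at P 4).1)%zz.

(** The middle column of P is an integral vector of the image whose form value is the middle entry
    of P, so positive values occur. *)
Lemma minimal_vector : exists x, [/\ mx P *m colv x = colv x, (0 < hvec x)%zz &
  forall y, mx P *m colv y = colv y -> (0 < hvec y)%zz -> (hvec x <= hvec y)%zz].
Proof.
pose Q k := `[< exists y, [/\ mx P *m colv y = colv y, (0 < hvec y)%zz & hvec y = Z.of_nat k] >].
have [y0 [Py0 hy0]] : exists y, mx P *m colv y = colv y /\ (0 < hvec y)%zz.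
  have [y Ey] := col_colv C 3 P 1; exists y; rewrite -Ey; split.
    by rewrite colE mulmxA idem.
  have Eh : emb (m3_at P 4) = zC C (hvec y).
    have J1 : ((colv y) ^t* *m J C *m colv y) 0 0 = mx P 1 1.
      transitivity (((mx P) ^t* *m J C *m mx P) 1 1).
        rewrite -Ey -!mulmxA !mxE; apply: eq_bigr => i _; rewrite !mxE; congr (_ * _).
        by apply: eq_bigr => k _; rewrite !mxE.
      rewrite selfadj -mulmxA idem mxE sum3 !mxE /=.
      by rewrite !mul0r mul1r add0r addr0.
    by rewrite -hvecE; have := J1; rewrite hpairE !mxE /= mulr1n.
  by move: Eh pos; rewrite -(emb_zC C 3) => /(emb_inj (C := C) qd)->.
have ex : exists k, Q k.
  by exists (Z.to_nat (hvec y0)); apply/asboolP; exists y0; split=> //; rewrite Z2Nat.id //; lia.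
case: (ex_minnP ex) => k /asboolP[x [Px hx Ex]] kmin; exists x; split=> // y Py hy.
have : (k <= Z.to_nat (hvec y))%N.
  by apply: kmin; apply/asboolP; exists y; split=> //; rewrite Z2Nat.id //; lia.
by rewrite Ex; lia.
Qed.

Lemma Zmul_lt_cancel (a h : Z) : (0 < h)%zz -> (a * h < h * h)%zz -> (a < h)%zz.
Proof. by move=> h0; apply: (proj2 (Z.mul_lt_mono_pos_r h a h h0)). Qed.

(** By Euclidean division the integral vectors of the image are the multiples of a minimal x, so P =
    x qv for an integral row qv. Self-adjointness gives x^* J = h qv with h the value of the form at
    x, and qv x = 1 then forces h = 1. Hence J P = P^* J P has the norms of the entries of qv on its
    diagonal. *)
Lemma proj_diag_norm j : exists q, (J C *m mx P) j j = zC C (znorm 1 1 q).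
Proof.
have [x [Px hx xmin]] := minimal_vector.
set h := hvec x in hx xmin.
have Jx : Jp x x = (zC C h)%:M by rewrite hpairE hvecE.
have h0 : zC C h != 0 by apply/eqP => /zC_eq0; lia.
have x0 : colv x != 0.
  apply/eqP => x0; have := congr1 (fun A : 'M_1 => A 0 0) Jx.
  by rewrite x0 mulmx0 !mxE mulr1n => /esym/eqP; apply/negP.
have span y : mx P *m colv y = colv y -> exists q, colv y = emb q *: colv x.
  move=> Py; have [c Ec] := line x0 Px Py.
  have Eg : emb (hpair x y) = c * zC C h.
    have := hpairE x y; rewrite Ec -scalemxAr Jx => /(congr1 (fun A : 'M_1 => A 0 0)).
    by rewrite !mxE !mulr1n.
  (* Rounding c = (x, y) / h to an Eisenstein integer q leaves w = y - q x with form value below h,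
     hence at most 0 by minimality. As this value times h is the norm of r, it is 0 and so is r. *)
  have [q1 Q1] := Zround (hpair x y).1 hx; have [q2 Q2] := Zround (hpair x y).2 hx.
  pose q := (q1, q2); have [w Ew] := colvB y x q; rewrite Ec -scalerBl in Ew.
  have Pw : mx P *m colv w = colv w by rewrite Ew -scalemxAr Px.
  pose r := ((hpair x y).1 - q1 * h, (hpair x y).2 - q2 * h)%zz.
  have Er : emb r = (c - emb q) * zC C h.
    rewrite mulrBl -Eg /emb /r /q /= !zCB !zCM; ring.
  have Nr : (znorm 1 1 r < h * h)%zz by apply: Znorm3_lt.
  have Nw : znorm 1 1 r = (hvec w * h)%zz.
    apply: (zC_inj (C := C)); rewrite -(emb_norm C qd) zCM -hvecE.
    have := hpairE w w; rewrite Ew adjmxZ -!(scalemxAl, scalemxAr) Jx.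
    move/(congr1 (fun A : 'M_1 => A 0 0)); rewrite !mxE !mulr1n => <-.
    by rewrite Er !rmorphM /= zC_conj; ring.
  have w0 : (hvec w <= 0)%zz.
    case: (Z.le_gt_cases (hvec w) 0) => // /(xmin _ Pw) hw.
    by rewrite Nw in Nr; have := Zmul_lt_cancel hx Nr; lia.
  have r0 : r = (0, 0)%zz.
    apply: (znorm_eq0 C qd); have rp : (0 <= znorm 1 1 r)%zz by apply: (znorm_ge0 C qd).
    by rewrite Nw in rp *; nia.
  exists q; rewrite Ec; congr (_ *: _); apply/eqP; rewrite -subr_eq0.
  by move/esym/eqP: Er; rewrite r0 emb0 mulf_eq0 (negPf h0) orbF.
have Hq i : exists q, col i (mx P) = emb q *: colv x.
  have [y Ey] := col_colv C 3 P i; have [|q Eq] := span y; last by exists q; rewrite Ey.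
  by rewrite -Ey colE mulmxA idem.
have [q qP] := choice Hq.
pose qv : 'rV[C]_3 := \row_i emb (q i).
have EP : mx P = colv x *m qv.
  apply/matrixP => i k; have := congr1 (fun A : 'cV_3 => A i 0) (qP k).
  by rewrite !mxE big_ord1 !mxE mulrC.
have qx : qv *m colv x = 1%:M.
  have E : colv x *m (qv *m colv x) = colv x by rewrite mulmxA -EP.
  rewrite [qv *m _]mx11_scalar in E *; rewrite mul_mx_scalar in E; congr (_%:M).
  move/eqP: E; rewrite -subr_eq0 -[X in _ - X]scale1r -scalerBl scaler_eq0 (negPf x0) orbF.
  by rewrite subr_eq0 => /eqP.
have xJ : (colv x) ^t* *m J C = zC C h *: qv.
  have E : (colv x) ^t* *m J C *m mx P = (colv x) ^t* *m J C.
    by rewrite -mulmxA -selfadj mulmxA -map_mxM -trmx_mul Px.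
  by rewrite -E EP mulmxA Jx mul_scalar_mx.
pose u := (zconj 1 (q 0), zconj 1 (q 1), zconj 1 (q 2%:R)).
have uq : (colv u) ^t* = qv.
  have E i : (colv u) i 0 = (emb (q i))^*.
    by case: i => [[|[|[|]]]] // ?; rewrite mxE /= (emb_conj C qd); congr (emb (zconj 1 (q _))); apply: val_inj.
  by apply/matrixP => i k; rewrite ord1 mxE mxE E [RHS]mxE conjCK.
(* Here x = h J u for the conjugate vector u of qv; substitute this in qv x = 1. *)
have h1 : (h * hvec u = 1)%zz.
  apply: (zC_inj (C := C)); rewrite zCM rmorph1.
  have E : colv x = zC C h *: (J C *m colv u).
    have JE : (J C) ^t* = J C.
      by apply/matrixP => i k; rewrite !mxE addnC rmorph_nat.
    have trK (v : 'cV[C]_3) : (v ^t*) ^t* = v.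
      by apply/matrixP => i k; rewrite !mxE conjCK.
    have := congr1 (fun A : 'rV_3 => A ^t*) xJ.
    rewrite -uq adjmxZ zC_conj trmx_mul map_mxM /= JE !trK => E.
    by rewrite scalemxAr -E mulmxA JJ mul1mx.
  have := qx; rewrite E -scalemxAr -uq mulmxA hpairE hvecE.
  by move/(congr1 (fun A : 'M_1 => A 0 0)); rewrite !mxE !mulr1n.
have {}h1 : h = 1%zz by have [] := Z.eq_mul_1_nonneg _ _ (Z.lt_le_incl _ _ hx) h1.
exists (q j); rewrite -idem mulmxA -selfadj EP trmx_mul map_mxM -!mulmxA.
have -> : (colv x) ^t* *m (J C *m (colv x *m qv)) = qv.
  by rewrite !mulmxA Jx h1 rmorph1 mul1mx.
by rewrite mxE big_ord1 !mxE mulrC (emb_norm C qd).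
Qed.
End MinimalVector.

Definition theta : Z * Z := (-1, 2)%zz.
(** Residues modulo theta = sqrt(-3), in the order 0, 1, -1: index 2 is the class of -1. *)
Definition level_theta :=
  Eval vm_compute in mk_level 1 1 (-1, 2)%zz (-1, 2)%zz 3 [:: (0, 0); (1, 0); (-1, 0)]%zz.
Definition cube_roots : seq (Z * Z) := [:: (1, 0); (-1, 1); (0, -1)]%zz.

Definition m3_add (A B : m3 (Z * Z)) : m3 (Z * Z) :=
  let: M3 a b c d e g h i j := A in let: M3 a' b' c' d' e' g' h' i' j' := B in
  M3 (zadd a a') (zadd b b') (zadd c c') (zadd d d') (zadd e e') (zadd g g')
     (zadd h h') (zadd i i') (zadd j j').

Definition m3_quad (a b c : Z * Z) (X : m3 (Z * Z)) : m3 (Z * Z) :=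
  m3_add (m3_scal (0, 0)%zz a)
    (m3_add (m3_smul 1 1 b X) (m3_smul 1 1 c (m3_mul zadd (zmul 1 1) X X))).

(* When A = 1 + theta X has order three, (1 + A/l + A^2/l^2)/3 is the quadratic
   polynomial in X with these coefficients, for l in cube_roots. *)
Definition proj_coefs : seq (Z * Z * (Z * Z) * (Z * Z)) :=
  [:: ((1, 0), (-1, 2), (-1, 0)); ((0, 0), (0, -1), (1, -1)); ((0, 0), (1, -1), (0, 1))]%zz.
Definition proj3 k X := let: (a, b, c) := nth ((0, 0), (0, 0), (0, 0))%zz proj_coefs k in m3_quad a b c X.

Definition div_theta (x : Z * Z) : Z * Z :=
  let y := zmul 1 1 x (zconj 1 theta) in (y.1 / 3, y.2 / 3)%zz.
Definition m3_diff (L : level) (h : m3 nat) : m3 (Z * Z) :=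
  m3_add (m3_map (nth (0, 0)%zz (lv_rep L)) h) (m3_map zneg (m3_scal (0, 0) (1, 0))%zz).
(** A residue pattern no order-three lift can show: some projection is positive, and
    [proj_diag_norm] forbids the class of -1 on its antidiagonal. *)
Definition special (L : level) (h : m3 nat) : bool :=
  all (zdvd 1 1 theta) (m3_seq (m3_diff L h)) &&
  all (fun k => let: M3 _ _ c _ e _ j _ _ := proj3 k (m3_map div_theta (m3_diff L h)) in
    has (fun x => rres level_theta x == 2%N) [:: c; e; j]) (iota 0 3).

Definition cube_ok (L : level) (S : seq (seq (m3 nat))) : bool :=
  all (fun h => let c := m3_seq (rpow L h 3) in
    [&& c != m3_seq (m3_scal 0%N (rres L (-1, 1)%zz)), c != m3_seq (m3_scal 0%N (rres L (0, -1)%zz))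
      & (c == m3_seq (m3_scal 0%N 1%N)) ==>
        (count (fun l => has_eig L h (rres L l) (vectors1 L)) cube_roots <= 1)%N || special L h])
    (products L S).

Lemma level_theta_ok : level_ok level_theta. Proof. by vm_compute. Qed.

Section OrderThree.
Variable C : numClosedFieldType.
Hypothesis qd : quad 3 1 1.
Local Notation emb := (emb C 3).
Local Notation mx := (mxm emb).
Local Notation M3mul := (m3_mul zadd (zmul 1 1)).
Local Notation M3adj := (m3_adj (zconj 1)).
Local Notation M31 := (m3_scal (0, 0)%zz (1, 0)%zz).
Local Notation colv := (colv C 3).
Local Notation rT := (rres level_theta).

Lemma mx_add A B : mx (m3_add A B) = mx A + mx B.
Proof. by case: A => *; case: B => *; apply/mx3P; split; rewrite !mxE /= embD. Qed.

Lemma mx_quad a b c X :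
  mx (m3_quad a b c X) = (emb a)%:M + (emb b *: mx X + emb c *: (mx X *m mx X)).
Proof. by rewrite !mx_add !(mx_smul C qd) (mxM C qd) mxm_scal ?emb0. Qed.

Lemma cube_roots_cube l : l \in cube_roots -> emb l ^+ 3 = 1.
Proof.
rewrite !inE !exprS expr0 mulr1 -!(embM C qd) => /or3P[]/eqP-> /=;
  rewrite /zmul /= (_ : (_, _) = (1, 0)%zz) ?emb1 //; by [].
Qed.

Lemma cube_roots_conj l : l \in cube_roots -> (emb l)^* = emb l ^+ 2.
Proof.
by rewrite !inE expr2 -(embM C qd) (emb_conj C qd) => /or3P[]/eqP->.
Qed.

Let qT : quad 3 (lv_t level_theta) (lv_n level_theta) := qd.

Section OneProjection.
Variables (M P : m3 (Z * Z)) (l : Z * Z).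
Hypotheses (uM : M3mul (M3adj M) M = M31) (A3 : mx M ^+ 3 = 1) (lr : l \in cube_roots).
Hypothesis EP : 3%:R *: mx P = cube_proj (mx M) (emb l).

Lemma proj3_neq0 : (3%:R : C) != 0. Proof. by rewrite pnatr_eq0. Qed.

Lemma proj_eigen : mx M *m mx P = emb l *: mx P.
Proof.
apply: (scalerI proj3_neq0); rewrite scalemxAr EP mulmxE cube_proj_eigen ?cube_roots_cube //.
by rewrite -EP !scalerA mulrC.
Qed.

Lemma proj_idem : mx P *m mx P = mx P.
Proof.
apply: (scalerI proj3_neq0); apply: (scalerI proj3_neq0).
by rewrite scalemxAr EP scalemxAl EP mulmxE cube_proj_idem ?cube_roots_cube.
Qed.

Lemma proj_selfadj : (mx P) ^t* *m J C = J C *m mx P.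
Proof.
apply: (scalerI proj3_neq0); rewrite scalemxAl scalemxAr EP.
have -> : 3%:R *: (mx P) ^t* = (3%:R *: mx P) ^t* by rewrite adjmxZ rmorph_nat.
move: (A3); set A := mx M => hA.
have A3' : A *m (A *m A) = 1%:M by rewrite -[RHS]hA !exprS expr0 mulr1.
have AJ : A ^t* *m J C = J C *m (A *m A).
  have E : A ^t* *m J C *m A = J C by have /andP[_ /eqP] := mx_unitaryP C qd uM.
  by rewrite -[LHS]mulmx1 -A3' (mulmxA (A ^t* *m J C)) E.
have AAJ : A ^t* *m (A ^t* *m J C) = J C *m A.
  by rewrite AJ mulmxA AJ -!mulmxA A3' mulmx1.
have l2 := cube_roots_conj lr; have l3 := cube_roots_cube lr.
rewrite EP /cube_proj.
have -> : (1 + emb l ^+ 2 *: A + emb l *: A ^+ 2)^t* =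
    1 + emb l *: A ^t* + emb l ^+ 2 *: (A ^t* *m A ^t*).
  rewrite !linearD /= !map_mxD trmx1 map_mx1 -!l2; congr (_ + _ + _).
    by rewrite adjmxZ conjCK.
  by rewrite adjmxZ expr2 -mulmxE trmx_mul map_mxM.
rewrite !mulmxDl !mulmxDr mul1mx mulmx1 -!scalemxAl -!scalemxAr AJ -mulmxA AAJ.
by rewrite addrAC expr2 mulmxE.
Qed.
End OneProjection.

Lemma projEq (M X : m3 (Z * Z)) k : mx M = 1%:M + emb theta *: mx X -> (k < 3)%N ->
  3%:R *: mx (proj3 k X) = cube_proj (mx M) (emb (nth (0, 0)%zz cube_roots k)).
Proof.
move=> EM k3; pose l := nth (0, 0)%zz cube_roots k.
pose abc := nth ((0, 0), (0, 0), (0, 0))%zz proj_coefs k.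
have three : (3%:R : C) = emb (3, 0)%zz by rewrite emb_zC.
have [Ea Eb Ec] : [/\ 3%:R * emb abc.1.1 = 1 + emb l ^+ 2 + emb l,
    3%:R * emb abc.1.2 = emb theta * (emb l ^+ 2 + 2%:R * emb l) &
    3%:R * emb abc.2 = emb l * emb theta ^+ 2].
  have two : (2%:R : C) = emb (2, 0)%zz by rewrite emb_zC.
  rewrite !expr2 three two -(emb1 C 3) -!(embM C qd) -!embD -!(embM C qd) /l /abc.
  by case: k k3 {l abc} => [|[|[|]]].
have -> : proj3 k X = m3_quad abc.1.1 abc.1.2 abc.2 X by rewrite /proj3 -/abc [abc in LHS]surjective_pairing [abc.1 in LHS]surjective_pairing.
have e1 : (1 : 'M[C]_3) = 1%:M by [].
rewrite mx_quad /cube_proj EM -/l !scalerDr !scalerA scale_scalar_mx Ea Eb Ec e1.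
set Y := mx X; set th := emb theta; set m := emb l.
have -> : (1%:M + th *: Y) ^+ 2 = 1%:M + (2%:R * th) *: Y + (th ^+ 2) *: (Y *m Y).
  rewrite expr2 -mulmxE mulmxDl !mulmxDr !mul1mx mulmx1 -!(scalemxAl, scalemxAr) scalerA -expr2.
  by rewrite -!addrA; congr (_ + _); rewrite addrA -scalerDl mulrDl mul1r.
move: (Y *m Y) => Y2; apply/matrixP => i j; rewrite !mxE.
by case: (i == j); rewrite ?mulr1n ?mulr0n; ring.
Qed.

(** As 3 = -theta^2, changing an entry by 3 z changes its quotient by theta by -theta z; so this
    quotient modulo theta is determined by the entry modulo 3. *)
Lemma entry_theta (L : level) m dl : lv_t L = 1%zz -> lv_n L = 1%zz -> lv_gam L = (3, 0)%zz ->
  level_ok L ->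
  let r := zadd (nth (0, 0)%zz (lv_rep L) (rres L m)) (zneg dl) in zdvd 1 1 theta r ->
  exists x, emb m = emb dl + emb theta * emb x /\ rT x = rT (div_theta r).
Proof.
move=> Lt Ln Lg Lok r tr; pose y := div_theta r.
have tt : emb theta * (emb theta)^* = 3%:R by rewrite (emb_norm C qd) -(zC_nat C 3).
have Ey : emb r = emb theta * emb y.
  have E : zmul 1 1 r (zconj 1 theta) = zmul 1 1 (3, 0)%zz y.
    move: tr; rewrite /zdvd (_ : znorm 1 1 theta = 3%zz) // /y /div_theta.
    set z := zmul 1 1 r _ => /andP[/Z.eqb_spec z1 /Z.eqb_spec z2].
    have := Z.div_mod z.1 3; have := Z.div_mod z.2 3; rewrite z1 z2 => E2 E1.
    clearbody z; case: z {z1 z2} E1 E2 => z1 z2 /= E1 E2.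
    by rewrite /zmul /=; congr pair; lia.
  have := congr1 emb E; rewrite !(embM C qd) -(emb_conj C qd) => {}E.
  have c0 : (emb theta)^* != 0.
    by apply: contra_eq_neq tt => ->; rewrite mulr0 eq_sym pnatr_eq0.
  have z3 : zC C 3 = 3%:R := zC_nat C 3.
  by apply: (mulIf c0); rewrite E emb_zC z3 -tt mulrAC.
have [z Ez] : exists z, emb m = emb r + emb dl + emb (3, 0)%zz * emb z.
  have qL : quad 3 (lv_t L) (lv_n L) by rewrite Lt Ln.
  have /(congP C qL Lok)[z Ez] := cong_rep (res_lt C qL Lok m); rewrite Lg in Ez; exists z.
  by rewrite Ez /r embD embN subrK.
exists (zadd y (zneg (zmul 1 1 theta z))); split.
  rewrite Ez Ey embD embN (embM C qd) mulrBr mulrA.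
  have -> : emb theta * emb theta = - emb (3, 0)%zz by rewrite -(embM C qd) -embN.
  by ring.
apply: (cong_residue C qT level_theta_ok); apply/(congP C qT level_theta_ok).
by exists (zneg z); rewrite embD !embN (embM C qd) mulrN.
Qed.

Lemma theta_part (L : level) M : lv_t L = 1%zz -> lv_n L = 1%zz -> lv_gam L = (3, 0)%zz ->
  level_ok L -> all (zdvd 1 1 theta) (m3_seq (m3_diff L (rcode L M))) ->
  exists X, mx M = 1%:M + emb theta *: mx X /\
    rcode level_theta X = rcode level_theta (m3_map div_theta (m3_diff L (rcode L M))).
Proof.
move=> Lt Ln Lg Lok; case: M => a b c e f h i j k.
have E m dl := @entry_theta L m dl Lt Ln Lg Lok.
case/and5P=> /(E a (1, 0)%zz)[a' [Ea Ra]] /(E b (0, 0)%zz)[b' [Eb Rb]] /(E c (0, 0)%zz)[c' [Ec Rc]].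
move=> /(E e (0, 0)%zz)[e' [Ee Re]] /and5P[/(E f (1, 0)%zz)[f' [Ef Rf]] /(E h (0, 0)%zz)[h' [Eh Rh]]].
move=> /(E i (0, 0)%zz)[i' [Ei Ri]] /(E j (0, 0)%zz)[j' [Ej Rj]] /andP[/(E k (1, 0)%zz)[k' [Ek Rk]] _].
exists (M3 a' b' c' e' f' h' i' j' k'); split; last by congr M3.
by apply/mx3P; split; rewrite !mxE /= ?mulr1n ?mulr0n ?(Ea, Eb, Ec, Ee, Ef, Eh, Ei, Ej, Ek) ?emb1 ?emb0.
Qed.

Lemma code_theta_proj k X Y : rcode level_theta X = rcode level_theta Y ->
  rcode level_theta (proj3 k X) = rcode level_theta (proj3 k Y).
Proof.
have Q a b c A : rcode level_theta (m3_quad a b c A) =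
    rcode level_theta (m3_quad a b c A) by [].
rewrite /proj3; case: nth => [[a b] c].
have rD := resD C qT level_theta_ok; have rM := resM C qT level_theta_ok.
case: X => x1 x2 x3 x4 x5 x6 x7 x8 x9; case: Y => y1 y2 y3 y4 y5 y6 y7 y8 y9.
rewrite /rcode /= => -[E1 E2 E3 E4 E5 E6 E7 E8 E9].
by rewrite !(rD, rM) E1 E2 E3 E4 E5 E6 E7 E8 E9.
Qed.

(** Conjugation is trivial modulo theta, so norms become squares in F_3. *)
Lemma norm_res_theta q : rT (znorm 1 1 q, 0%zz) != 2%N.
Proof.
have -> : (znorm 1 1 q, 0%zz) = zmul 1 1 q (zconj 1 q).
  by apply: (emb_inj (C := C) qd); rewrite (embM C qd) -(emb_conj C qd) (emb_norm C qd) emb_zC.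
have gc : zdvd 1 1 (lv_gam level_theta) (zconj 1 (lv_gam level_theta)) by [].
rewrite (resM C qT level_theta_ok) (resJ C qT level_theta_ok gc).
by have := res_lt C qT level_theta_ok q; case: (rT q) => [|[|[|]]].
Qed.
End OrderThree.

(** * Three-torsion for d = 3 *)

Section CubeScalar.
Variable C : numClosedFieldType.
Hypothesis qd : quad 3 1 1.
Local Notation emb := (emb C 3).
Local Notation mx := (mxm emb).
Local Notation M3mul := (m3_mul zadd (zmul 1 1)).
Local Notation M3adj := (m3_adj (zconj 1)).
Local Notation M31 := (m3_scal (0, 0)%zz (1, 0)%zz).
Local Notation colv := (colv C 3).
Local Notation rT := (rres level_theta).

Definition antidiagonal (P : m3 (Z * Z)) := [:: m3_at P 2; m3_at P 4; m3_at P 6].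

(** The antidiagonal of P1 is the diagonal of J P1. The other two projections being nonzero, all
    three eigenvalues occur and the image of P1 is a line. *)
Lemma proj_antidiagonal M P1 P2 P3 l1 l2 l3 : M3mul (M3adj M) M = M31 -> mx M ^+ 3 = 1 ->
  l1 \in cube_roots -> l2 \in cube_roots -> l3 \in cube_roots ->
  l1 != l2 -> l1 != l3 -> l2 != l3 ->
  3%:R *: mx P1 = cube_proj (mx M) (emb l1) -> 3%:R *: mx P2 = cube_proj (mx M) (emb l2) ->
  3%:R *: mx P3 = cube_proj (mx M) (emb l3) -> mx P2 <> 0 -> mx P3 <> 0 ->
  (0 < (m3_at P1 4).1)%zz -> all (fun x => rT x != 2%N) (antidiagonal P1).
Proof.
move=> uM A3 r1 r2 r3 n12 n13 n23 E1 E2 E3 P20 P30 pos.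
have nE a b : a != b -> emb a != emb b by apply: contra_neq => /(emb_inj (C := C) qd).
have [u u0 Au] := eigen_of_root (C := C) (d := 3) (proj_eigen qd A3 r2 E2) P20.
have [v v0 Av] := eigen_of_root (C := C) (d := 3) (proj_eigen qd A3 r3 E3) P30.
have line (x y : 'cV[C]_3) : x != 0 -> mx P1 *m x = x -> mx P1 *m y = y -> exists c, y = c *: x.
  have fixE (z : 'cV[C]_3) : mx P1 *m z = z -> mx M *m z = emb l1 *: z.
    by move=> Ez; rewrite -{1}Ez mulmxA (proj_eigen qd A3 r1 E1) -scalemxAl Ez.
  move=> x0 /fixE Ax /fixE Ay.
  exact: (eigenline (nE _ _ n12) (nE _ _ n13) (nE _ _ n23) x0 u0 v0 Ax Au Av Ay).
have H := proj_diag_norm qd (proj_idem qd A3 r1 E1) (proj_selfadj qd uM A3 r1 E1) line pos.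
have N x q : emb x = zC C (znorm 1 1 q) -> rT x != 2%N.
  rewrite -(emb_zC C 3) => /(emb_inj (C := C) qd)->; exact: (norm_res_theta C qd).
have [q0 H0] := H 0; have [q1 H1] := H 1; have [q2 H2] := H 2%:R.
rewrite /= andbT; apply/and3P; split.
- by apply: (N _ q2); rewrite -H2 !mxE sum3 !mxE /= !(mul0r, mul1r, add0r, addr0).
- by apply: (N _ q1); rewrite -H1 !mxE sum3 !mxE /= !(mul0r, mul1r, add0r, addr0).
- by apply: (N _ q0); rewrite -H0 !mxE sum3 !mxE /= !(mul0r, mul1r, add0r, addr0).
Qed.

Lemma sum_cube_roots : emb (-1, 1)%zz + emb (0, -1)%zz = -1.
Proof. by rewrite -embD -(emb1 C 3) -embN. Qed.

Lemma sum_cube_proj (A : 'M[C]_3) :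
  cube_proj A (emb (1, 0)%zz) + (cube_proj A (emb (-1, 1)%zz) + cube_proj A (emb (0, -1)%zz)) = 3%:R%:M.
Proof.
have s2 : emb (0, -1)%zz = -1 - emb (-1, 1)%zz by rewrite -sum_cube_roots addrAC subrr add0r.
have o2 : emb (-1, 1)%zz ^+ 2 = emb (0, -1)%zz by rewrite expr2 -(embM C qd).
have o4 : emb (0, -1)%zz ^+ 2 = emb (-1, 1)%zz by rewrite expr2 -(embM C qd).
rewrite /cube_proj emb1 o2 o4 s2 (_ : (1 : 'M_3) = 1%:M) //.
by apply/matrixP => i j; rewrite !mxE; case: (i == j); rewrite ?mulr1n ?mulr0n; ring.
Qed.

Variables (L : level) (us : seq (Z * Z)) (S : seq (seq (m3 nat))).
Hypotheses (Lt : lv_t L = 1%zz) (Ln : lv_n L = 1%zz) (Lg : lv_gam L = (3, 0)%zz).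
Hypotheses (Lok : level_ok L) (Cok : cube_ok L S).
Hypothesis gamc : zdvd (lv_t L) (lv_n L) (lv_gam L) (zconj (lv_t L) (lv_gam L)).
Hypothesis Pok : prim_ok L.
Hypothesis cubeP : forall u, znorm 1 1 u = 1%zz -> emb u ^+ 3 = 1 -> u \in cube_roots.

(** The three projections sum to 1, so some middle entry has a positive first coordinate. A residue
    -1 makes every projection nonzero, so [proj_antidiagonal] applies to that one and contradicts
    its residue -1. *)
Lemma special_false M : M3mul (M3adj M) M = M31 -> mx M ^+ 3 = 1 -> ~~ special L (rcode L M).
Proof.
move=> uM A3; apply/negP => /andP[/(theta_part C qd Lt Ln Lg Lok)[X [EX cX]] /and4P[s0 s1 s2 _]].
have A k : has (fun x => rT x == 2%N) (antidiagonal (proj3 k (m3_map div_theta (m3_diff L (rcode L M))))) ->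
    has (fun x => rT x == 2%N) (antidiagonal (proj3 k X)).
  have := code_theta_proj C qd k cX; set P := proj3 k X; set Q := proj3 k _.
  rewrite /rcode; case: P => a b c e f h i j l; case: Q => a' b' c' e' f' h' i' j' l' /=.
  by case=> _ _ -> _ -> _ -> _ _.
have {s0} s0 : has (fun x => rT x == 2%N) (antidiagonal (proj3 0 X)).
  by apply: A; move: s0; case: (proj3 0 _).
have {s1} s1 : has (fun x => rT x == 2%N) (antidiagonal (proj3 1 X)).
  by apply: A; move: s1; case: (proj3 1 _).
have {A s2} s2 : has (fun x => rT x == 2%N) (antidiagonal (proj3 2 X)).
  by apply: A; move: s2; case: (proj3 2 _).
have nz k : has (fun x => rT x == 2%N) (antidiagonal (proj3 k X)) -> mx (proj3 k X) <> 0.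
  move=> /hasP[x xP x2] E; have x0 : x = (0, 0)%zz.
    apply: (emb_inj (C := C) qd); rewrite emb0; move: E xP; case: (proj3 k X) => a b c e f h i j l E.
    have H i0 j0 := congr1 (fun B : 'M_3 => B i0 j0) E.
    by rewrite !inE => /or3P[]/eqP->; [have := H 0 2%:R|have := H 1 1|have := H 2%:R 0]; rewrite !mxE.
  by rewrite x0 in x2.
have [z0 z1 z2] := And3 (nz _ s0) (nz _ s1) (nz _ s2).
have E0 := projEq qd (k := 0) EX isT; have E1 := projEq qd (k := 1) EX isT.
have E2 := projEq qd (k := 2) EX isT.
have r0 : (1, 0)%zz \in cube_roots by [].
have r1 : (-1, 1)%zz \in cube_roots by [].
have r2 : (0, -1)%zz \in cube_roots by [].
have nall P : has (fun x => rT x == 2%N) (antidiagonal P) -> all (fun x => rT x != 2%N) (antidiagonal P) -> False.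
  by move=> /hasP[x xP x2] /allP/(_ x xP); rewrite x2.
have [p0 p1 p2] : [/\ ~ (0 < (m3_at (proj3 0 X) 4).1)%zz, ~ (0 < (m3_at (proj3 1 X) 4).1)%zz
    & ~ (0 < (m3_at (proj3 2 X) 4).1)%zz].
  split=> pos; [apply: (nall _ s0)|apply: (nall _ s1)|apply: (nall _ s2)].
  - exact: (proj_antidiagonal uM A3 r0 r1 r2 _ _ _ E0 E1 E2).
  - exact: (proj_antidiagonal uM A3 r1 r0 r2 _ _ _ E1 E0 E2).
  - exact: (proj_antidiagonal uM A3 r2 r0 r1 _ _ _ E2 E0 E1).
have := sum_cube_proj (mx M); rewrite -E0 -E1 -E2 -!scalerDr.
move: p0 p1 p2; move: (proj3 0 X) (proj3 1 X) (proj3 2 X) => P0 P1 P2 p0 p1 p2.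
move/(congr1 (fun B : 'M_3 => B 1 1)); rewrite !mxE /= mulr1n.
rewrite -!embD -[RHS]mulr1 => /(mulfI (proj3_neq0 C)).
rewrite -(emb1 C 3) => /(emb_inj (C := C) qd)/(congr1 fst); rewrite /zadd /=; rewrite (_ : (3 * (1 %% 3) + 1 %% 3)%N = 4%N) //; clear -p0 p1 p2; lia.
Qed.

(** A cube root of unity without an eigenvector modulo 3 has zero projection. If at most one
    projection survives, it is the identity and M is scalar; otherwise the residue is [special]. *)
Lemma cube_scalar M u : isG 1 1 M -> rcode L M \in products L S ->
  znorm 1 1 u = 1%zz -> emb u ^+ 3 = 1 -> mx M ^+ 3 = (emb u)%:M ->
  exists s, mx M = s%:M.
Proof.
move=> gM cM nu u3 M3.
have qL : quad 3 (lv_t L) (lv_n L) by rewrite Lt Ln.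
have /(isGP C qd)[uM _] := gM.
have cu : rpow L (rcode L M) 3 = m3_scal 0%N (rres L u).
  have := code_mpow C qL Lok M 3; rewrite Lt Ln => <-.
  have -> : mpow 1 1 M 3 = m3_scal (0, 0)%zz u.
    by apply: (mx_inj (C := C) qd); rewrite (mx_mpow C qd) M3 mxm_scal ?emb0.
  by rewrite /rcode /= (res0 Lok).
have := allP Cok _ cM; rewrite cu => /and3P[ne1 ne2 sp].
have u1 : u = (1, 0)%zz.
  move: (cubeP nu u3) ne1 ne2; rewrite !inE => /or3P[]/eqP-> //; by rewrite eqxx.
rewrite {}u1 emb1 in M3 sp; rewrite (res1 Lok) eqxx /= (negPf (special_false uM M3)) orbF in sp.
have E l : l \in cube_roots -> ~~ has_eig L (rcode L M) (rres L l) (vectors1 L) ->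
    cube_proj (mx M) (emb l) = 0.
  move=> lr; apply: contraNeq => /eqP.
  have -> : cube_proj (mx M) (emb l) = mx (m3_quad (1, 0)%zz (zmul 1 1 l l) l M).
    by rewrite (mx_quad C qd) emb1 /cube_proj (embM C qd) -!expr2 -addrA.
  move=> N0; have := eigen_of_root (C := C) (d := 3) (M := M) (s := l) _ N0; case.
    have -> : mx (m3_quad (1, 0)%zz (zmul 1 1 l l) l M) = cube_proj (mx M) (emb l).
      by rewrite (mx_quad C qd) emb1 /cube_proj (embM C qd) -!expr2 -addrA.
    by rewrite mulmxE cube_proj_eigen // (cube_roots_cube C qd).
  move=> v v0 Ev; have := eigen_code qL Lok gamc Pok v0 Ev; by case.
have sc l : l \in cube_roots -> cube_proj (mx M) (emb l) = 3%:R%:M -> exists s, mx M = s%:M.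
  move=> lr El; exists (emb l).
  have := cube_proj_eigen M3 (cube_roots_cube C qd lr); rewrite El -mulmxE mul_mx_scalar.
  by rewrite scale_scalar_mx mulrC -scale_scalar_mx => /(scalerI (proj3_neq0 C)).
have r0 : (1, 0)%zz \in cube_roots by [].
have r1 : (-1, 1)%zz \in cube_roots by [].
have r2 : (0, -1)%zz \in cube_roots by [].
have S3 := sum_cube_proj (mx M).
move: sp; rewrite /= addn0.
case: (boolP (has_eig _ _ (rres L (1, 0)%zz) _)) => [h0|/(E _ r0) e0];
case: (boolP (has_eig _ _ (rres L (-1, 1)%zz) _)) => [h1|/(E _ r1) e1];
case: (boolP (has_eig _ _ (rres L (0, -1)%zz) _)) => [h2|/(E _ r2) e2] // _.
- by apply: (sc _ r0); rewrite -S3 e1 e2 !addr0.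
- by apply: (sc _ r1); rewrite -S3 e0 e2 addr0 add0r.
- by apply: (sc _ r2); rewrite -S3 e0 e1 !add0r.
by apply: (sc _ r2); rewrite -S3 e0 e1 !add0r.
Qed.
End CubeScalar.

(** * Finite subgroups *)

Definition mclosure (t n : Z) (k : nat) (gs : seq (m3 (Z * Z))) : seq (m3 (Z * Z)) :=
  iter k (fun S => undup (S ++ [seq m3_mul zadd (zmul t n) s g | s <- S, g <- gs]))
    [:: m3_scal (0, 0)%zz (1, 0)%zz].

(** The last clause allows no two elements to differ by a nontrivial cube root of unity, so the list
    maps injectively to PU. *)
Definition finite_ok (t n : Z) (cs : seq (Z * Z)) (F : seq (m3 (Z * Z))) : bool :=
  [&& uniq F, all (isG t n) F, m3_scal (0, 0)%zz (1, 0)%zz \in F,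
      all (fun A => all (fun B => m3_mul zadd (zmul t n) A B \in F) F) F &
      all (fun A => (m3_adj (zconj t) A \in F) &&
        all (fun u => (m3_smul t n u A \in F) ==> (u == (1, 0)%zz)) cs) F].

Section FiniteSubgroups.
Variables (C : numClosedFieldType) (d : nat) (t n : Z) (us cs : seq (Z * Z)).
Hypothesis (qd : quad d t n) (sd : sqfree d).
Hypothesis unitsP : forall u, znorm t n u = 1%zz -> u \in us.
Hypothesis units12 : forall u, u \in us -> emb C d u ^+ 12 = 1.
Hypothesis cubeP : forall u, znorm t n u = 1%zz -> emb C d u ^+ 3 = 1 -> u \in cs.
Local Notation isG := (isG t n).
Local Notation lifts := (@lifts C d).
Local Notation M31 := (m3_scal (0, 0)%zz (1, 0)%zz).

Lemma finite_subgroup F : finite_ok t n cs F ->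
  finite_subgroup_order (@Gamma C d) (size F).
Proof.
case/and5P=> uF /allP gF F1 /allP FM /allP FV.
have GP := GammaP qd sd unitsP units12.
pose K : set (PU C) := [set x | exists2 M, M \in F & lifts M x].
have ex i : exists x, (i < size F)%N -> lifts (nth M31 F i) x.
  case: (ltnP i (size F)) => // iF; last by exists 1%g.
  by have [x lx] := lifts_ex C qd (gF _ (mem_nth M31 iF)); exists x.
have [f fP] := choice ex; exists K; split.
- apply/is_subgroupP; split.
  + by exists M31; [|exact: lifts1].
  + move=> x y [M MF lM] [N NF lN]; exists (m3_mul zadd (zmul t n) M N); last exact: (liftsM qd).
    exact: (allP (FM _ MF)).
  move=> x [M MF lM]; exists (m3_adj (zconj t) M); last exact: (liftsV qd (gF _ MF)).
  by have /andP[] := FV _ MF.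
- by move=> x [M MF lM]; apply: (proj2 (GP x)); exists M => //; apply: gF.
have -> : K = f @` `I_(size F).
  apply/seteqP; split=> [x [M MF lM]|x [i iF <-]]; last first.
    by exists (nth M31 F i); [exact: mem_nth|exact: fP].
  have iF : (index M F < size F)%N by rewrite index_mem.
  exists (index M F); first exact: iF.
  by have := fP _ iF; rewrite nth_index // => l2; exact: (lifts_inj l2 lM).
apply: inj_card_eq => i j; rewrite !inE => iF jF Eij.
have li := fP i iF; have lj := fP j jF; rewrite Eij in li.
have [u [Eu nu u3]] := lifts_unit qd unitsP units12 (gF _ (mem_nth M31 iF)) (gF _ (mem_nth M31 jF)) li lj.
have /andP[_ /allP/(_ u (cubeP nu u3))] := FV _ (mem_nth M31 iF).
rewrite -Eu mem_nth //= => /eqP u1.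
apply/eqP; rewrite -(nth_uniq M31 iF jF uF) Eu u1.
apply/eqP/(mx_inj (C := C) qd); rewrite (mx_smul C qd).
by rewrite emb1 scale1r.
Qed.
End FiniteSubgroups.

Section CoprimeTorsion.
Variables (C : numClosedFieldType) (d : nat) (t n : Z).
Hypothesis (qd : quad d t n) (sd : sqfree d).
Hypothesis cube1 : forall u, znorm t n u = 1%zz -> emb C d u ^+ 3 = 1 -> u = (1, 0)%zz.
Variables (q : nat) (s : Z) (g : Z * Z).
Hypothesis qok : prime_ok t n q s g.

(** The reduction of M has order dividing both p and the order of GL_3(F_q), hence is trivial, and
    reduction is faithful on torsion. *)
Lemma coprime_scalar p M u : prime p -> ~~ (p %| #|'GL_3['F_q]%g|)%N -> isG t n M ->
  znorm t n u = 1%zz -> emb C d u ^+ 3 = 1 -> mxm (emb C d) M ^+ p = (emb C d u)%:M ->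
  exists c, mxm (emb C d) M = c%:M.
Proof.
move=> pp pGL gM nu u3; rewrite (cube1 nu u3) emb1 => Mp; exists 1.
apply: (reduction_free qd sd qok pp) => //.
have EM : mpow t n M p = m3_scal (0, 0)%zz (1, 0)%zz.
  by apply: (mx_inj (C := C) qd); rewrite (mx_mpow C qd) Mp mx1.
have rp : mxm (red q s) M ^+ p = 1 by rewrite -(mxr_mpow qok) EM; exact: mxr1.
have uM : (mxm (red q s) M : 'M_(3.-1.+1)) \is a GRing.unit.
  by rewrite -(unitrX_pos _ (prime_gt0 pp)) rp unitr1.
pose x : {'GL_3['F_q]} := FinRing.Unit uM.
have vX m : GLval (x ^+ m)%g = GLval x ^+ m.
  by elim: m => [|m IH]; rewrite ?expgS ?exprS //= -IH.
have xp : (x ^+ p = 1)%g by apply: val_inj; rewrite [LHS]vX rp.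
have ox : (#[x]%g %| #|'GL_3['F_q]%g|)%N by apply: order_dvdG; rewrite finset.in_setT.
have /eqP := xp; rewrite -order_dvdn.
have /primeP[_ H] := pp; move/H => /orP[/eqP o1|/eqP op]; last by rewrite -op ox in pGL.
by have := congr1 GLval (expg_order x); rewrite o1 expg1.
Qed.
End CoprimeTorsion.

(** * Generators of explicit finite subgroups *)

Definition fin1_3 : seq (m3 (Z * Z)) := mclosure 0 1 3
  [:: M3 (0,0) (0,0) (0,(-1)) (0,0) (1,0) (0,0) (0,(-1)) (0,0) ((-1),0)]%zz.
Definition fin1_32 : seq (m3 (Z * Z)) := mclosure 0 1 8
  [:: M3 (0,1) ((-1),(-1)) ((-1),(-1)) (0,0) ((-1),0) ((-1),(-1)) (0,0) (0,0) (0,1);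
      M3 (0,(-1)) (1,1) (1,1) ((-1),(-1)) (1,0) (1,(-1)) (0,1) (0,0) ((-1),0)]%zz.
Definition fin2_3 : seq (m3 (Z * Z)) := mclosure 0 2 3
  [:: M3 (0,0) (0,0) ((-1),0) (0,0) ((-1),0) (0,1) ((-1),0) (0,1) (1,0)]%zz.
Definition fin2_16 : seq (m3 (Z * Z)) := mclosure 0 2 6
  [:: M3 ((-1),0) ((-2),(-1)) (3,0) (0,0) (1,0) ((-2),1) (0,0) (0,0) ((-1),0);
      M3 ((-1),0) (0,(-1)) (1,1) (2,0) (1,2) ((-2),(-1)) (2,1) (0,2) ((-1),(-1))]%zz.
Definition fin3_8 : seq (m3 (Z * Z)) := mclosure 1 1 4
  [:: M3 (1,(-1)) (0,1) ((-1),0) ((-1),0) (0,0) ((-1),1) ((-1),0) (1,0) (0,1);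
      M3 ((-1),0) (0,0) (0,0) (0,0) (1,0) (0,0) (0,0) (0,0) ((-1),0)]%zz.
Definition fin3_9 : seq (m3 (Z * Z)) := mclosure 1 1 5
  [:: M3 (0,2) (0,0) ((-2),1) (0,0) (1,0) (0,0) ((-2),1) (0,0) (0,(-1));
      M3 (1,0) (0,0) (0,0) (0,0) ((-1),1) (0,0) (0,0) (0,0) (1,0)]%zz.
Definition fin7_3 : seq (m3 (Z * Z)) := mclosure 1 2 3
  [:: M3 (1,0) (1,(-1)) ((-1),0) (0,(-1)) ((-1),0) (0,0) ((-1),0) (0,0) (0,0)]%zz.
Definition fin7_7 : seq (m3 (Z * Z)) := mclosure 1 2 7
  [:: M3 (0,0) (0,0) ((-1),0) (0,0) ((-1),0) (1,0) ((-1),0) ((-1),0) (1,(-1))]%zz.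
Definition fin7_8 : seq (m3 (Z * Z)) := mclosure 1 2 5
  [:: M3 ((-1),0) (0,0) (0,0) (0,0) (1,0) (0,0) (0,0) (0,0) ((-1),0);
      M3 (0,(-1)) ((-1),1) (2,0) ((-1),0) (0,0) (0,(-1)) (1,0) ((-1),0) ((-1),1)]%zz.
Definition fin11_3 : seq (m3 (Z * Z)) := mclosure 1 3 3
  [:: M3 (3,0) ((-3),3) ((-5),1) (0,3) ((-8),0) ((-3),(-3)) ((-4),(-1)) (6,(-3)) (5,0)]%zz.
Definition fin11_8 : seq (m3 (Z * Z)) := mclosure 1 3 5
  [:: M3 ((-1),0) (0,0) (0,0) ((-2),0) (1,0) (0,0) (2,0) ((-2),0) ((-1),0);
      M3 (0,0) (0,0) (1,0) (0,0) ((-1),0) (0,0) (1,0) (0,0) (0,0)]%zz.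
Definition fin19_3 : seq (m3 (Z * Z)) := mclosure 1 5 3
  [:: M3 ((-3),1) (4,(-1)) (2,(-1)) ((-1),2) (2,(-2)) (0,(-1)) (1,(-2)) ((-1),2) (1,1)]%zz.
Definition fin19_8 : seq (m3 (Z * Z)) := mclosure 1 5 4
  [:: M3 (2,0) ((-2),0) ((-1),0) (2,0) ((-1),0) (0,0) ((-1),0) (0,0) (0,0);
      M3 ((-1),0) (0,0) (0,0) ((-2),0) (1,0) (0,0) (2,0) ((-2),0) ((-1),0)]%zz.
(** * The seven congruence subgroups *)

Definition sqfree_ok (d : nat) : bool :=
  (0 < d)%N && all (fun k => (k ^ 2 %| d)%N ==> (k == 1%N)) (iota 0 d.+1).

Lemma sqfree_okP d : sqfree_ok d -> sqfree d.
Proof.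
case/andP=> d0 /allP H k kd; apply/eqP; apply: (implyP (H k _) kd).
rewrite mem_iota /= add0n ltnS; apply: leq_trans (dvdn_leq d0 kd).
by case: (k) => // m; rewrite -mulnn leq_pmulr.
Qed.

Definition ring_ok (t n : Z) (us cs : seq (Z * Z)) : bool :=
  let r := [:: -2; -1; 0; 1; 2]%zz in
  [&& (3 <=? 4 * n - t * t)%zz, (0 <=? t)%zz, (t <=? 1)%zz,
    all (fun a => all (fun b => (znorm t n (a, b) =? 1)%zz ==> ((a, b) \in us)) r) r &
    all (fun u => (iter 12 (zmul t n u) (1, 0)%zz == (1, 0)%zz) &&
      ((zcube t n u == (1, 0)%zz) ==> (u \in cs))) us].

(** Four times the norm is (2a + t b)^2 + (4n - t^2) b^2, so units lie in the finite box searched by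
    [ring_ok]. *)
Lemma Znorm1_bound (t n a b : Z) : (3 <= 4 * n - t * t)%zz -> (0 <= t <= 1)%zz ->
  (a * a + t * (a * b) + n * (b * b) = 1)%zz -> (-2 <= a <= 2)%zz /\ (-2 <= b <= 2)%zz.
Proof.
move=> D [t0 t1] E.
have E4 : ((2 * a + t * b) * (2 * a + t * b) + (4 * n - t * t) * (b * b) = 4)%zz.
  by transitivity (4 * (a * a + t * (a * b) + n * (b * b)))%zz; [ring | rewrite E].
have sq x : (0 <= x * x)%zz by apply: Z.square_nonneg.
have sqle m x : (0 <= m)%zz -> (x * x <= m * m)%zz -> (- m <= x <= m)%zz.
  by move=> m0 H; apply/Z.abs_le/Z.square_le_simpl_nonneg => //; rewrite Z.abs_square.
have Db := Z.mul_le_mono_nonneg_r _ _ _ (sq b) D.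
have s0 := sq (2 * a + t * b)%zz.
have b1 : (- (1) <= b <= 1)%zz.
  by apply: sqle; [lia | move: E4 Db s0 (sq b); set x := (_ * _)%zz; set y := (b * b)%zz; lia].
have a2 : (- (2) <= 2 * a + t * b <= 2)%zz.
  by apply: sqle; [lia | move: E4 Db s0 (sq b); set x := (_ * _)%zz; set y := (b * b)%zz; lia].
have tb : (- (1) <= t * b <= 1)%zz.
  have t01 : t = 0%zz \/ t = 1%zz by lia.
  by case: t01 => ->; rewrite ?Z.mul_0_l ?Z.mul_1_l.
by move: tb a2; set y := (t * b)%zz => tb a2; split; lia.
Qed.

Lemma mem_range5 a : (-2 <= a <= 2)%zz -> a \in [:: -2; -1; 0; 1; 2]%zz.
Proof.
move=> H; have : (a = -2 \/ a = -1 \/ a = 0 \/ a = 1 \/ a = 2)%zz by lia.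
by case=> [->|[->|[->|[->|->]]]].
Qed.

Section RingFacts.
Variables (C : numClosedFieldType) (d : nat) (t n : Z) (us cs : seq (Z * Z)).
Hypotheses (qd : quad d t n) (Rok : ring_ok t n us cs).

Lemma ring_units u : znorm t n u = 1%zz -> u \in us.
Proof.
case: u => a b; case/and5P: Rok => /Z.leb_spec0 D /Z.leb_spec0 t0 /Z.leb_spec0 t1 H _ E.
have [ra rb] := Znorm1_bound D (conj t0 t1) E.
move/allP: H => /(_ _ (mem_range5 ra))/allP/(_ _ (mem_range5 rb)).
by rewrite E.
Qed.

Lemma ring_units12 u : u \in us -> emb C d u ^+ 12 = 1.
Proof.
case/and5P: Rok => _ _ _ _ /allP H /H/andP[/eqP E _].
rewrite -(emb1 C d) -E; elim: 12%N => [|k IH]; first by rewrite expr0 /= emb1.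
by rewrite exprS IH iterS (embM C qd).
Qed.

Lemma ring_cubes u : znorm t n u = 1%zz -> emb C d u ^+ 3 = 1 -> u \in cs.
Proof.
case/and5P: Rok => _ _ _ _ /allP H /ring_units/H/andP[_ /implyP K] u3; apply/K/eqP.
apply: (emb_inj (C := C) qd); rewrite emb1 -u3 /zcube !(embM C qd).
by rewrite !exprS expr0 mulr1.
Qed.
End RingFacts.

(** * Consequences of the computed certificates *)

Definition instance_ok (L : level) (us cs : seq (Z * Z)) (R : seq (seq (m3 (Z * Z))))
    (S : seq (seq (m3 nat))) (q N : nat) : bool :=
  [&& level_ok L, zdvd (lv_t L) (lv_n L) (lv_gam L) (zconj (lv_t L) (lv_gam L)),
      uniq [seq rres L u | u <- us], prim_ok L & sub_ok L S] &&
  [&& scal_ok L us S, reps_ok L R,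
      index_check L [seq rres L u | u <- cs] (products L (codes L R)) (products L S),
      exponent_ok L S q & size (products L (codes L R)) == N] &&
  (4 < Z.to_nat (znorm (lv_t L) (lv_n L) (lv_gam L)))%N.

Section Instance.
Variables (C : numClosedFieldType) (d : nat) (L : level) (us cs : seq (Z * Z)).
Variables (R : seq (seq (m3 (Z * Z)))) (S : seq (seq (m3 nat))) (q N : nat).
Local Notation t := (lv_t L).
Local Notation n := (lv_n L).
Hypotheses (qd : quad d t n) (sd : sqfree_ok d) (Rok : ring_ok t n us cs).
Hypothesis Iok : instance_ok L us cs R S q N.
Local Notation H := (@Hset C d L (products L S)).
Let unitsP := ring_units Rok.
Let units12 := ring_units12 C qd Rok.
Let cubes := ring_cubes (C := C) qd Rok.

Lemma instance_index : [/\ is_subgroup H, H `<=` Gamma d & has_index H (@Gamma C d) N].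
Proof.
case/andP: Iok => /andP[/and5P[Lok gc _ _ Sok] /and5P[sc Rp ic _ /eqP <-]] _; split.
- exact: (Hset_sub C qd Lok gc Sok).
- have := @Hset_Gamma C d L us qd (sqfree_okP sd) unitsP units12 S; exact.
apply: (Hset_index qd (sqfree_okP sd) Lok gc unitsP units12 Sok sc Rp _ ic).
by move=> u nu u3; apply/map_f/cubes.
Qed.

Lemma instance_torsion_free p : prime p -> p.-nat q ->
  (forall M u, isG t n M -> rcode L M \in products L S -> znorm t n u = 1%zz ->
     emb C d u ^+ 3 = 1 -> mxm (emb C d) M ^+ p = (emb C d u)%:M ->
     exists s, mxm (emb C d) M = s%:M) -> torsion_free H.
Proof.
case/andP: Iok => /andP[/and5P[Lok gc uu _ Sok] /and5P[_ _ _ eo _]] g4 pp pq.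
exact: (Hset_torsion_free qd (sqfree_okP sd) Lok gc unitsP units12 uu Sok pp pq eo g4).
Qed.

Lemma instance_neat : torsion_free H -> neat_ok L us S -> has_neat_subgroup C d N.
Proof.
move=> tH nH; have [sH HG iH] := instance_index; exists H; split=> //.
case/andP: Iok => /andP[/and5P[Lok gc uu Pok Sok] /and5P[sc _ _ _ _]] _.
exact: (Hset_neat qd (sqfree_okP sd) Lok gc unitsP units12 uu Pok Sok nH tH iH).
Qed.

Lemma instance_bound k : torsion_free H -> finite_subgroup_order (@Gamma C d) k -> (k %| N)%N.
Proof.
move=> tH [F [sF FG Fk]]; have [sH HG iH] := instance_index.
have sG : is_subgroup (@Gamma C d) by apply: (Gamma_sub qd (sqfree_okP sd) unitsP units12).
exact: (card_dvd_index sH sG sF FG Fk tH iH).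
Qed.
End Instance.

Lemma card_GL3 q : prime q ->
  #|'GL_3['F_q]%g| = (q ^ 3 * ((q - 1) * ((q ^ 2 - 1) * (q ^ 3 - 1))))%N.
Proof.
move=> pq; rewrite (@card_GL 'F_q 3 isT) (card_Fp pq).
have -> : 'C(3, 2) = 3 by [].
congr muln; move: {pq}q => m.
by do 3![rewrite big_ltn; last by []]; rewrite big_geq ?muln1 ?expn1.
Qed.

Lemma logn_GL3 p q : prime q -> logn p #|'GL_3['F_q]%g| =
  (logn p (q ^ 3) + (logn p (q - 1) + (logn p (q ^ 2 - 1) + logn p (q ^ 3 - 1))))%N.
Proof.
move=> pq; have q1 := prime_gt1 pq.
have H k : (0 < k)%N -> (0 < q ^ k - 1)%N by move=> k0; rewrite subn_gt0 -(exp1n k) ltn_exp2r.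
have H1 := H 1%N isT; rewrite expn1 in H1.
by rewrite (card_GL3 pq) !lognM ?muln_gt0 ?expn_gt0 ?(ltnW q1) ?H1 ?H.
Qed.

Lemma sqrt_minus2 q c : prime q -> (q %| c ^ 2 + 2)%N -> (c%:R : 'F_q) ^+ 2 = - 2%:R.
Proof.
move=> pq; rewrite (dvdn_pcharf (pchar_Fp pq)) natrD natrX => /eqP E.
by apply/eqP; rewrite -subr_eq0 opprK E.
Qed.

Lemma part2_GL3 q : prime q -> logn 2 #|'GL_3['F_q]%g| = 5 -> ((#|'GL_3['F_q]%g|)`_2 = 32)%N.
Proof. by move=> _ E; rewrite p_part E. Qed.

Definition units2 : seq (Z * Z) := [:: (1, 0); (-1, 0)]%zz.
Definition units4 : seq (Z * Z) := [:: (1, 0); (-1, 0); (0, 1); (0, -1)]%zz.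
Definition units6 : seq (Z * Z) := [:: (1, 0); (-1, 0); (0, 1); (0, -1); (1, -1); (-1, 1)]%zz.
Definition one1 : seq (Z * Z) := [:: (1, 0)]%zz.

Lemma instance1 : instance_ok level1 units4 one1 reps1 sub1 4 96.
Proof. by vm_compute. Qed.
Lemma instance2 : instance_ok level2 units2 one1 reps2 sub2 2 96.
Proof. by vm_compute. Qed.
Lemma instance2t : instance_ok level2t units2 one1 reps2t sub2t 4 48.
Proof. by vm_compute. Qed.
Lemma instance3 : instance_ok level3 units6 cube_roots reps3 sub3 9 72.
Proof. by vm_compute. Qed.
Lemma instance7 : instance_ok level7 units2 one1 reps7 sub7 1 336.
Proof. by vm_compute. Qed.
Lemma instance11 : instance_ok level11 units2 one1 reps11 sub11 13 432.
Proof. by vm_compute. Qed.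
Lemma instance19 : instance_ok level19 units2 one1 reps19 sub19 7 864.
Proof. by vm_compute. Qed.

Lemma neat1 : neat_ok level1 units4 sub1. Proof. by vm_compute. Qed.
Lemma neat2 : neat_ok level2 units2 sub2. Proof. by vm_compute. Qed.
Lemma neat3 : neat_ok level3 units6 sub3. Proof. by vm_compute. Qed.
Lemma neat7 : neat_ok level7 units2 sub7. Proof. by vm_compute. Qed.
Lemma neat11 : neat_ok level11 units2 sub11. Proof. by vm_compute. Qed.
Lemma neat19 : neat_ok level19 units2 sub19. Proof. by vm_compute. Qed.

Lemma involution1 : involution_ok level1 sub1. Proof. by vm_compute. Qed.
Lemma involution2 : involution_ok level2 sub2. Proof. by vm_compute. Qed.
Lemma involution2t : involution_ok level2t sub2t. Proof. by vm_compute. Qed.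
Lemma cube3 : cube_ok level3 sub3. Proof. by vm_compute. Qed.

Lemma ring1 : ring_ok 0 1 units4 one1. Proof. by vm_compute. Qed.
Lemma ring2 : ring_ok 0 2 units2 one1. Proof. by vm_compute. Qed.
Lemma ring3 : ring_ok 1 1 units6 cube_roots. Proof. by vm_compute. Qed.
Lemma ring7 : ring_ok 1 2 units2 one1. Proof. by vm_compute. Qed.
Lemma ring11 : ring_ok 1 3 units2 one1. Proof. by vm_compute. Qed.
Lemma ring19 : ring_ok 1 5 units2 one1. Proof. by vm_compute. Qed.

Lemma finite1_32 : finite_ok 0 1 one1 fin1_32 && (size fin1_32 == 32). Proof. by vm_compute. Qed.
Lemma finite1_3 : finite_ok 0 1 one1 fin1_3 && (size fin1_3 == 3). Proof. by vm_compute. Qed.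
Lemma finite2_16 : finite_ok 0 2 one1 fin2_16 && (size fin2_16 == 16). Proof. by vm_compute. Qed.
Lemma finite2_3 : finite_ok 0 2 one1 fin2_3 && (size fin2_3 == 3). Proof. by vm_compute. Qed.
Lemma finite3_8 : finite_ok 1 1 cube_roots fin3_8 && (size fin3_8 == 8). Proof. by vm_compute. Qed.
Lemma finite3_9 : finite_ok 1 1 cube_roots fin3_9 && (size fin3_9 == 9). Proof. by vm_compute. Qed.
Lemma finite7_8 : finite_ok 1 2 one1 fin7_8 && (size fin7_8 == 8). Proof. by vm_compute. Qed.
Lemma finite7_3 : finite_ok 1 2 one1 fin7_3 && (size fin7_3 == 3). Proof. by vm_compute. Qed.
Lemma finite7_7 : finite_ok 1 2 one1 fin7_7 && (size fin7_7 == 7). Proof. by vm_compute. Qed.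
Lemma finite11_8 : finite_ok 1 3 one1 fin11_8 && (size fin11_8 == 8). Proof. by vm_compute. Qed.
Lemma finite11_3 : finite_ok 1 3 one1 fin11_3 && (size fin11_3 == 3). Proof. by vm_compute. Qed.
Lemma finite19_8 : finite_ok 1 5 one1 fin19_8 && (size fin19_8 == 8). Proof. by vm_compute. Qed.
Lemma finite19_3 : finite_ok 1 5 one1 fin19_3 && (size fin19_3 == 3). Proof. by vm_compute. Qed.

Lemma L_spec_of_orders (C : numClosedFieldType) d l (ks : seq nat) : (0 < l)%N ->
  (forall k, finite_subgroup_order (@Gamma C d) k -> (k %| l)%N) ->
  (forall k, k \in ks -> finite_subgroup_order (@Gamma C d) k) ->
  (forall m, all (fun k => k %| m)%N ks -> (l %| m)%N) -> L_spec C d l.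
Proof.
move=> l0 ub ex lb; split=> // m m0 H; apply: dvdn_leq => //; apply: lb.
by apply/allP => k /ex /H.
Qed.

Section Bounds.
Variables (C : numClosedFieldType) (d : nat) (n : Z) (us : seq (Z * Z)).
Hypotheses (qd : quad d 1 n) (sd : sqfree_ok d) (Rok : ring_ok 1 n us one1).
Hypothesis d7 : (6 < d)%N && (d != 8%N).
Let unitsP := ring_units Rok.
Let units12 := ring_units12 C qd Rok.

Lemma one1_cube (t m : Z) (vs : seq (Z * Z)) : quad d t m -> ring_ok t m vs one1 ->
  forall u, znorm t m u = 1%zz -> emb C d u ^+ 3 = 1 -> u = (1, 0)%zz.
Proof. by move=> q R u nu u3; have := ring_cubes q R nu u3; rewrite inE => /eqP. Qed.

Let cube1 := one1_cube qd Rok.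

Lemma order_not16 q s g c k : prime_ok 1 n q s g -> logn 2 #|'GL_3['F_q]%g| = 5 ->
  (q %| c ^ 2 + 2)%N -> finite_subgroup_order (@Gamma C d) k -> ~~ (16 %| k)%N.
Proof.
move=> qok l5 qc [F [sF FG Fk]]; have /and5P[pq _ _ _ _] := qok.
apply: (not16_dvd qd (sqfree_okP sd) unitsP units12 cube1 qok _ sF FG Fk _ (sqrt_minus2 pq qc)).
  (* With d > 6, the product d Q^2 can be 4 or 8 only if d = 8. *)
  have /andP[d6 /eqP d8] := d7; move=> Q; have [E|] := Z.eq_dec (Q * Q) 0; first by rewrite E; split; lia.
  have := Z.square_nonneg Q; set y := (Q * Q)%zz => y0 y1.
  by split; nia.
by rewrite p_part l5.
Qed.

Lemma order_not9 q s g k : prime_ok 1 n q s g -> (logn 3 #|'GL_3['F_q]%g| < 2)%N ->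
  finite_subgroup_order (@Gamma C d) k -> ~~ (9 %| k)%N.
Proof.
move=> qok l3 [F [sF FG Fk]]; apply/negP => k9.
have := dvdn_trans k9 (card_dvd_GL qd (sqfree_okP sd) unitsP units12 cube1 qok sF FG Fk).
by rewrite (_ : 9 = 3 ^ 2)%N // pfactor_dvdn ?cardG_gt0 // leqNgt l3.
Qed.
End Bounds.

Section Main.
Variable C : numClosedFieldType.

Lemma quad1 : quad 1 0 1. Proof. by []. Qed.
Lemma quad2 : quad 2 0 2. Proof. by []. Qed.
Lemma quad3 : quad 3 1 1. Proof. by []. Qed.
Lemma quad7 : quad 7 1 2. Proof. by []. Qed.
Lemma quad11 : quad 11 1 3. Proof. by []. Qed.
Lemma quad19 : quad 19 1 5. Proof. by []. Qed.

Lemma prim_level L us cs R S q N : instance_ok L us cs R S q N ->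
  [/\ level_ok L, zdvd (lv_t L) (lv_n L) (lv_gam L) (zconj (lv_t L) (lv_gam L)), prim_ok L
    & (4 < Z.to_nat (znorm (lv_t L) (lv_n L) (lv_gam L)))%N].
Proof. by case/andP => /andP[/and5P[? ? _ ? _] _]. Qed.

Lemma torsion_free_involution d L us R S q N : quad d (lv_t L) (lv_n L) -> sqfree_ok d ->
  ring_ok (lv_t L) (lv_n L) us one1 -> instance_ok L us one1 R S q N -> 2%N.-nat q ->
  involution_ok L S -> torsion_free (@Hset C d L (products L S)).
Proof.
move=> qd sd Rok Iok q2 inv; have [Lok gc Pok _] := prim_level Iok.
apply: (instance_torsion_free qd sd Rok Iok (p := 2) isT q2) => M u.
exact: (involution_scalar qd Lok gc Pok (one1_cube qd Rok) inv).
Qed.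

Lemma torsion_free_coprime d L us R S p N q s g : quad d (lv_t L) (lv_n L) -> sqfree_ok d ->
  ring_ok (lv_t L) (lv_n L) us one1 -> instance_ok L us one1 R S p N -> prime p ->
  prime_ok (lv_t L) (lv_n L) q s g -> ~~ (p %| #|'GL_3['F_q]%g|)%N ->
  torsion_free (@Hset C d L (products L S)).
Proof.
move=> qd sd Rok Iok pp qok pG.
apply: (instance_torsion_free qd sd Rok Iok pp (pnat_id pp)) => M u gM _ nu u3.
exact: (coprime_scalar qd (sqfree_okP sd) (one1_cube qd Rok) qok pp pG gM nu u3).
Qed.

Let tf1 := torsion_free_involution (L := level1) quad1 isT ring1 instance1 isT involution1.
Let tf2 := torsion_free_involution (L := level2) quad2 isT ring2 instance2 isT involution2.
Let tf2t := torsion_free_involution (L := level2t) quad2 isT ring2 instance2t isT involution2t.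

Let tf3 : torsion_free (@Hset C 3 level3 (products level3 sub3)).
Proof.
have [Lok gc Pok _] := prim_level instance3.
apply: (instance_torsion_free (L := level3) quad3 isT ring3 instance3 (p := 3) isT isT) => M u.
have cubes := ring_cubes (C := C) quad3 ring3.
exact: (cube_scalar quad3 (L := level3) (erefl _) (erefl _) (erefl _) Lok cube3 gc Pok cubes).
Qed.

(** The finite group is trivial, so the prime 2 is covered by the kernel argument like every other
    prime. *)
Let tf7 : torsion_free (@Hset C 7 level7 (products level7 sub7)).
Proof.
have [Lok gc Pok N4] := prim_level instance7.
apply: (instance_torsion_free (L := level7) quad7 isT ring7 instance7 (p := 2) isT isT) => M u gM cM nu u3.
rewrite (one1_cube (C := C) quad7 ring7 nu u3) emb1 => M2; exists 1.
apply: (kernel_free (L := level7) quad7 (sqfree_okP (d := 7) isT) Lok N4 (isT : prime 2%N)) => //.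
by move: cM; rewrite inE => /eqP.
Qed.

(** The primes above 5 serve to exclude 9 and the torsion of order 13 or 7. At q = 11 and 19, -2 is
    a square and the order of GL_3(F_q) has 2-part 32, as needed to exclude 16. *)
Lemma prime5_11 : prime_ok 1 3 5 (-1) (1, 1)%zz. Proof. by vm_compute. Qed.
Lemma prime5_19 : prime_ok 1 5 5 0 (0, 1)%zz. Proof. by vm_compute. Qed.
Lemma prime11_7 : prime_ok 1 2 11 5 (1, 2)%zz. Proof. by vm_compute. Qed.
Lemma prime11_11 : prime_ok 1 3 11 6 (-1, 2)%zz. Proof. by vm_compute. Qed.
Lemma prime19_19 : prime_ok 1 5 19 10 (-1, 2)%zz. Proof. by vm_compute. Qed.

Let tf11 : torsion_free (@Hset C 11 level11 (products level11 sub11)).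
Proof.
apply: (torsion_free_coprime (L := level11) quad11 isT ring11 instance11 isT prime5_11).
by rewrite card_GL3 // !Euclid_dvdM // !Euclid_dvdX.
Qed.
Let tf19 : torsion_free (@Hset C 19 level19 (products level19 sub19)).
Proof.
apply: (torsion_free_coprime (L := level19) quad19 isT ring19 instance19 isT prime5_19).
by rewrite card_GL3 // !Euclid_dvdM // !Euclid_dvdX.
Qed.

Lemma finite_order_instance d t n us cs F k : quad d t n -> sqfree_ok d -> ring_ok t n us cs ->
  finite_ok t n cs F && (size F == k) -> finite_subgroup_order (@Gamma C d) k.
Proof.
move=> qd sd Rok /andP[Fok /eqP <-].
exact: (finite_subgroup qd (sqfree_okP sd) (ring_units Rok) (ring_units12 C qd Rok) (ring_cubes (C := C) qd Rok)).
Qed.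

Lemma L1 : L_spec C 1 96.
Proof.
apply: (@L_spec_of_orders C 1 96 [:: 32; 3]%N) => //.
- by move=> k; apply: (instance_bound (L := level1) quad1 isT ring1 instance1 tf1).
- move=> k; rewrite !inE => /orP[]/eqP->.
    exact: (finite_order_instance quad1 isT ring1 finite1_32).
  exact: (finite_order_instance quad1 isT ring1 finite1_3).
by move=> m /and3P[a b _]; rewrite (_ : 96 = 32 * 3)%N // Gauss_dvd // a b.
Qed.

(** The level modulo 4 gives the sharp bound; the neat subgroup of index 96 would lose a factor
    2. *)
Lemma L2 : L_spec C 2 48.
Proof.
apply: (@L_spec_of_orders C 2 48 [:: 16; 3]%N) => //.
- by move=> k; apply: (instance_bound (L := level2t) quad2 isT ring2 instance2t tf2t).
- move=> k; rewrite !inE => /orP[]/eqP->.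
    exact: (finite_order_instance quad2 isT ring2 finite2_16).
  exact: (finite_order_instance quad2 isT ring2 finite2_3).
by move=> m /and3P[a b _]; rewrite (_ : 48 = 16 * 3)%N // Gauss_dvd // a b.
Qed.

Lemma L3 : L_spec C 3 72.
Proof.
apply: (@L_spec_of_orders C 3 72 [:: 8; 9]%N) => //.
- by move=> k; apply: (instance_bound (L := level3) quad3 isT ring3 instance3 tf3).
- move=> k; rewrite !inE => /orP[]/eqP->.
    exact: (finite_order_instance quad3 isT ring3 finite3_8).
  exact: (finite_order_instance quad3 isT ring3 finite3_9).
by move=> m /and3P[a b _]; rewrite (_ : 72 = 8 * 9)%N // Gauss_dvd // a b.
Qed.

Lemma divisors_check N (P : pred nat) k : (0 < N)%N -> all P (divisors N) -> (k %| N)%N -> P k.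
Proof. by move=> N0 /allP H kN; apply: H; rewrite -dvdn_divisors. Qed.

Lemma L7 : L_spec C 7 168.
Proof.
apply: (@L_spec_of_orders C 7 168 [:: 8; 3; 7]%N) => //.
- move=> k Fk; have kN := instance_bound (L := level7) quad7 isT ring7 instance7 tf7 Fk.
  have n16 : ~~ (16 %| k)%N.
    by apply: (order_not16 quad7 isT ring7 isT (c := 3) prime11_7 _ _ Fk); rewrite ?logn_GL3.
  have : (k %| 168)%N || (16 %| k)%N by apply: (@divisors_check 336 (fun k => (k %| 168) || (16 %| k))%N).
  by rewrite (negPf n16) orbF.
- move=> k; rewrite !inE => /or3P[]/eqP->.
  + exact: (finite_order_instance quad7 isT ring7 finite7_8).
  + exact: (finite_order_instance quad7 isT ring7 finite7_3).
  exact: (finite_order_instance quad7 isT ring7 finite7_7).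
by move=> m /and4P[a b c _]; rewrite (_ : 168 = 8 * (3 * 7))%N // !Gauss_dvd // a b c.
Qed.

(** The order divides 432 = 16 * 27, and excluding 16 and 9 leaves a divisor of 24. *)
Lemma L11 : L_spec C 11 24.
Proof.
apply: (@L_spec_of_orders C 11 24 [:: 8; 3]%N) => //.
- move=> k Fk; have kN := instance_bound (L := level11) quad11 isT ring11 instance11 tf11 Fk.
  have n16 : ~~ (16 %| k)%N.
    by apply: (order_not16 quad11 isT ring11 isT (c := 3) prime11_11 _ _ Fk); rewrite ?logn_GL3.
  have n9 : ~~ (9 %| k)%N.
    by apply: (order_not9 quad11 isT ring11 prime5_11 _ Fk); rewrite logn_GL3.
  have : [|| k %| 24, 16 %| k | 9 %| k]%N.
    by apply: (@divisors_check 432 (fun k => [|| k %| 24, 16 %| k | 9 %| k])%N).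
  by rewrite (negPf n16) (negPf n9) !orbF.
- move=> k; rewrite !inE => /orP[]/eqP->.
    exact: (finite_order_instance quad11 isT ring11 finite11_8).
  exact: (finite_order_instance quad11 isT ring11 finite11_3).
by move=> m /and3P[a b _]; rewrite (_ : 24 = 8 * 3)%N // Gauss_dvd // a b.
Qed.

Lemma L19 : L_spec C 19 24.
Proof.
apply: (@L_spec_of_orders C 19 24 [:: 8; 3]%N) => //.
- move=> k Fk; have kN := instance_bound (L := level19) quad19 isT ring19 instance19 tf19 Fk.
  have n16 : ~~ (16 %| k)%N.
    by apply: (order_not16 quad19 isT ring19 isT (c := 6) prime19_19 _ _ Fk); rewrite ?logn_GL3.
  have n9 : ~~ (9 %| k)%N.
    by apply: (order_not9 quad19 isT ring19 prime5_19 _ Fk); rewrite logn_GL3.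
  have : [|| k %| 24, 16 %| k | 9 %| k]%N.
    by apply: (@divisors_check 864 (fun k => [|| k %| 24, 16 %| k | 9 %| k])%N).
  by rewrite (negPf n16) (negPf n9) !orbF.
- move=> k; rewrite !inE => /orP[]/eqP->.
    exact: (finite_order_instance quad19 isT ring19 finite19_8).
  exact: (finite_order_instance quad19 isT ring19 finite19_3).
by move=> m /and3P[a b _]; rewrite (_ : 24 = 8 * 3)%N // Gauss_dvd // a b.
Qed.

Lemma neat_subgroups : [/\ has_neat_subgroup C 1 96, has_neat_subgroup C 2 96 &
  has_neat_subgroup C 3 72] /\ [/\ has_neat_subgroup C 7 336, has_neat_subgroup C 11 432 &
  has_neat_subgroup C 19 864].
Proof.
split; split.
- exact: (instance_neat (L := level1) quad1 isT ring1 instance1 tf1 neat1).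
- exact: (instance_neat (L := level2) quad2 isT ring2 instance2 tf2 neat2).
- exact: (instance_neat (L := level3) quad3 isT ring3 instance3 tf3 neat3).
- exact: (instance_neat (L := level7) quad7 isT ring7 instance7 tf7 neat7).
- exact: (instance_neat (L := level11) quad11 isT ring11 instance11 tf11 neat11).
exact: (instance_neat (L := level19) quad19 isT ring19 instance19 tf19 neat19).
Qed.

Lemma torsion_free_index48 : has_torsion_free_subgroup C 2 48.
Proof.
have [sH HG iH] := instance_index C (L := level2t) quad2 isT ring2 instance2t.
by exists (@Hset C 2 level2t (products level2t sub2t)); split=> //; exact: tf2t.
Qed.
End Main.

Theorem mainTheorem4 (R : realType) :
  (L_spec R[i] 1 96 /\ L_spec R[i] 2 48 /\ L_spec R[i] 3 72 /\
   L_spec R[i] 7 168 /\ L_spec R[i] 11 24 /\ L_spec R[i] 19 24) /\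
  (has_neat_subgroup R[i] 1 96 /\ has_neat_subgroup R[i] 2 96 /\
   has_neat_subgroup R[i] 3 72 /\ has_neat_subgroup R[i] 7 336 /\
   has_neat_subgroup R[i] 11 432 /\ has_neat_subgroup R[i] 19 864) /\
  has_torsion_free_subgroup R[i] 2 48.
Proof.
have [[n1 n2 n3] [n7 n11 n19]] := neat_subgroups R[i].
split; first exact: (conj (L1 _) (conj (L2 _) (conj (L3 _) (conj (L7 _) (conj (L11 _) (L19 _)))))).
split; last exact: torsion_free_index48.
exact: (conj n1 (conj n2 (conj n3 (conj n7 (conj n11 n19))))).
Qed.
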